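(* There exist absolute constants $C,C_1,C_2,C_3>0$ such that the following holds. Let $d,n,k,m$ be positive integers with $k\le n$, $\gamma\in(0,1)$, $\delta\in(0,1)$, $\alpha\in(0,1]$, $v\in\mathbb{S}^{d-1}$. Let $f(W,x)=\sum_{j=1}^{2m}(-1)^j\sigma(\langle w_j,x\rangle)$ with $\sigma(z)=\max(z,\alpha z)$, where $w_j$ is the $j$-th row of $W\in\mathbb{R}^{2m\times d}$. Let $(X,\hat y,\mathbf y,x,y)\sim\mathcal{D}(d,n,k,\gamma,v)$, let $\eta,\lambda>0$ satisfy $\eta\le\frac{1}{mn\max_i\|x_i\|^2}$ and $\lambda\le\frac{\sqrt\alpha}{m\min_i\|x_i\|}$, and let $W=\mathcal{A}_{GD}(X,\hat y,\eta,\lambda)$ be the output of gradient descent on the hinge loss. If $$n\ge C_1k,\qquad d\ge C_2n,\qquad k\ge C_3\left(\log\tfrac1\delta+\tfrac1\alpha\right),$$ then with probability at least $1-\delta$ over the training data $(X,\hat y)$, $$\mathbb{P}\big(yf(W,x)\le0\,\big|\,X,\hat y\big)\ge\exp\left(-C\cdot\frac{d}{\alpha k}\right).$$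
   Context: Data model $\mathcal D(d,n,k,\gamma,v)$: the true labels $\mathbf y=(y_1,\dots,y_n)$ are i.i.d. uniform on $\{\pm1\}$; the noise vectors $\mathbf n_1,\dots,\mathbf n_n$ are i.i.d. $\mathcal N(0,\frac1d(I_d-vv^T))$, independent of $\mathbf y$; $X\in\mathbb R^{n\times d}$ has rows $x_i=\sqrt\gamma\,y_iv+\sqrt{1-\gamma}\,\mathbf n_i$. $\mathcal B\subset[n]$ is any subset with $|\mathcal B|=k$ chosen independently of $\mathbf y$; the observed labels are $\hat y_i=-y_i$ for $i\in\mathcal B$ and $\hat y_i=y_i$ for $i\notin\mathcal B$. The test label $y$ is uniform on $\{\pm1\}$ and the test input is $x=\sqrt\gamma\,yv+\sqrt{1-\gamma}\,\mathbf n$ with $\mathbf n\sim\mathcal N(0,\frac1d(I_d-vv^T))$; $y$ and $\mathbf n$ are independent of each other and of the training data. $(X,\hat y)$ is the training data. Gradient descent: $\dot\sigma(z)=1$ if $z\ge0$, $\dot\sigma(z)=\alpha$ if $z<0$. The training loss is $\sum_{i=1}^n\max\{0,1-\hat y_if(W,x_i)\}$. From an initialization $W^{(0)}$, for $t\ge1$, $j\in[2m]$, $$w_j^{(t)}=w_j^{(t-1)}+\eta(-1)^j\sum_{i\in\mathcal F^{(t-1)}}\hat y_i\,\dot\sigma(\langle w_j^{(t-1)},x_i\rangle)\,x_i,\qquad \mathcal F^{(t)}=\{i\in[n]:\hat y_if(W^{(t)},x_i)<1\}.$$ $\mathcal A_{GD}(X,\hat y,\eta,\lambda)$ denotes the limit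 $\lim_tW^{(t)}$; statements about it are meant for every initialization $W^{(0)}$ with $\|w_j^{(0)}\|\le\lambda$ for all $j\in[2m]$ (the choice not depending on the test point). *)

(* Defs.v *)
From mathcomp Require Import all_boot all_order all_algebra.
From mathcomp Require Import all_classical all_reals all_analysis.

Set Implicit Arguments.
Unset Strict Implicit.
Unset Printing Implicit Defensive.

Import Order.TTheory GRing.Theory Num.Theory.
Import numFieldNormedType.Exports.

Local Open Scope classical_set_scope.
Local Open Scope ring_scope.

Section EuclideanSpace.
Context {R : realType} {d : nat}.

Definition dotp (u w : 'rV[R]_d) : R := \sum_(l < d) u 0 l * w 0 l.

(* The norm `|u| of MathComp-Analysis on row vectors is the sup norm, hence
   this separate Euclidean norm. *)
Definition enorm (u : 'rV[R]_d) : R := Num.sqrt (dotp u u).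

End EuclideanSpace.

Section Probability.
Context {R : realType} {disp : measure_display} {T : measurableType disp}.
Variable P : probability T R.

Definition sigma_rv (J : Type) (F : J -> T -> R) : set (set T) :=
  <<s \bigcup_j preimage_set_system setT (F j) measurable >>.

Definition sigma_discrete (V : Type) (B : T -> V) : set (set T) :=
  [set A | exists S : set V, A = B @^-1` S].

Definition mutually_independent (I : finType) (G : I -> set (set T)) : Prop :=
  forall (J : {set I}) (A : I -> set T),
    (forall i, i \in J -> G i (A i)) ->
    P (\bigcap_(i in [set` J]) A i) = (\prod_(i in J) P (A i))%E.

Definition uniform_sign (y : T -> R) : Prop :=
  [/\ measurable_fun setT y,
      P (y @^-1` [set 1]) = (2^-1)%:E &
      P (y @^-1` [set -1]) = (2^-1)%:E].

Definition coords d (Z : T -> 'rV[R]_d) : 'I_d -> T -> R := fun l w => Z w 0 l.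

(* The rows-as-vectors form of: Z = A^T g almost surely, with g a vector of
   i.i.d. N(0,1) variables and A^T A = S.  The covariance S may be singular. *)
Definition normal_vec d (S : 'M[R]_d) (Z : T -> 'rV[R]_d) : Prop :=
  (forall l, measurable_fun setT (coords Z l)) /\
  exists (r : nat) (A : 'M[R]_(r, d)) (g : T -> 'rV[R]_r),
    [/\ A^T *m A = S,
        forall l, measurable_fun setT (coords g l),
        forall l (B : set R), measurable B ->
          P (coords g l @^-1` B) = normal_prob 0 1 B,
        mutually_independent (fun l => sigma_rv (fun _ : unit => coords g l)) &
        {ae P, forall w, Z w = g w *m A}].

End Probability.

Section DataModel.
Context {R : realType} {disp : measure_display} {T : measurableType disp}.
Variable P : probability T R.
Variables (d n k : nat) (gamma : R) (v : 'rV[R]_d).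

Definition noise_cov : 'M[R]_d := d%:R^-1 *: (1%:M - v^T *m v).

Definition input (y : T -> R) (N : T -> 'rV[R]_d) (w : T) : 'rV[R]_d :=
  (Num.sqrt gamma * y w) *: v + Num.sqrt (1 - gamma) *: N w.

Definition train_X (y : 'I_n -> T -> R) (N : 'I_n -> T -> 'rV[R]_d) (w : T) :
    'M[R]_(n, d) :=
  \matrix_(i < n) input (y i) (N i) w.

Definition observed (y : 'I_n -> T -> R) (B : T -> {set 'I_n}) (w : T)
    (i : 'I_n) : R :=
  if i \in B w then - y i w else y i w.

Definition sigma_train (y : 'I_n -> T -> R) (N : 'I_n -> T -> 'rV[R]_d)
    (B : T -> {set 'I_n}) : set (set T) :=
  sigma_rv (fun (s : ('I_n * 'I_d) + 'I_n) w =>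
    match s with
    | inl (i, l) => train_X y N w i l
    | inr i => observed y B w i
    end).

(* The set B of flipped labels is random and only required to be independent
   of the true labels: it may depend on the noise, or be deterministic. *)
Record data_model (y : 'I_n -> T -> R) (N : 'I_n -> T -> 'rV[R]_d)
    (B : T -> {set 'I_n}) (yt : T -> R) (Nt : T -> 'rV[R]_d) : Prop := {
  labels_uniform : forall i, uniform_sign P (y i) ;
  noise_normal : forall i, normal_vec P noise_cov (N i) ;
  labels_noise_indep : mutually_independent P
    (fun s : 'I_n + 'I_n =>
       match s with
       | inl i => sigma_rv (fun _ : unit => y i)
       | inr i => sigma_rv (coords (N i))
       end) ;
  flips_measurable : sigma_discrete B `<=` measurable ;
  flips_card : forall w, #|B w| = k ;
  flips_indep : mutually_independent P
    (fun b : bool => if b then sigma_discrete B else sigma_rv y) ;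
  test_label_uniform : uniform_sign P yt ;
  test_noise_normal : normal_vec P noise_cov Nt ;
  test_indep : mutually_independent P
    (tnth [tuple sigma_rv (fun _ : unit => yt); sigma_rv (coords Nt);
                 sigma_train y N B])
}.

End DataModel.

Section Network.
Context {R : realType} {d m : nat}.
Variable alpha : R.

Definition lrelu (z : R) : R := Num.max z (alpha * z).

Definition dlrelu (z : R) : R := if 0 <= z then 1 else alpha.

(* Neurons are numbered 1..2m; the ordinal j stands for neuron j+1. *)
Definition neuron_sign (j : 'I_(2 * m)) : R := (-1) ^+ j.+1.

Definition net (W : 'M[R]_(2 * m, d)) (x : 'rV[R]_d) : R :=
  \sum_(j < 2 * m) neuron_sign j * lrelu (dotp (row j W) x).

Section GradientDescent.
Variables (n : nat) (eta : R) (X : 'M[R]_(n, d)) (yhat : 'I_n -> R).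

Definition gd_step (W : 'M[R]_(2 * m, d)) : 'M[R]_(2 * m, d) :=
  \matrix_(j < 2 * m)
    (row j W + (eta * neuron_sign j) *:
       \sum_(i < n | yhat i * net W (row i X) < 1)
          (yhat i * dlrelu (dotp (row j W) (row i X))) *: row i X).

Definition gd (W0 : 'M[R]_(2 * m, d)) (t : nat) : 'M[R]_(2 * m, d) :=
  iter t gd_step W0.

Definition A_GD (W0 : 'M[R]_(2 * m, d)) : 'M[R]_(2 * m, d) :=
  lim (gd W0 t @[t --> \oo]).

End GradientDescent.
End Network.

Section Norms.
Context {R : realType} {n d : nat}.

Definition max_norm (X : 'M[R]_(n, d)) : R :=
  \big[Num.max/0]_(i < n) enorm (row i X).

(* The base value of the iterated min is neutral, being the largest norm. *)
Definition min_norm (X : 'M[R]_(n, d)) : R :=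
  \big[Num.min/max_norm X]_(i < n) enorm (row i X).

End Norms.

(* The conditional probability P(y f(W,x) <= 0 | X, yhat): as (y, x) is
   independent of the training data, it is the probability over the test point
   of the error of the network with its weights W frozen. *)
Definition test_error {R : realType} {disp : measure_display}
    {T : measurableType disp} (P : probability T R) (d m : nat)
    (gamma alpha : R) (v : 'rV[R]_d) (yt : T -> R) (Nt : T -> 'rV[R]_d)
    (W : 'M[R]_(2 * m, d)) : \bar R :=
  P [set w | yt w * net alpha W (input gamma v yt Nt w) <= 0].

(* Main.v *)
(* On an event of probability at least 1 - delta the noise matrix Y is well
   conditioned (12 and 1/32 bound its singular values, by nets together with a
   Gaussian tail bound and a small ball estimate), and at least k/16 flipped
   examples have each true label.  Gradient descent then interpolates in
   finitely many steps, by the perceptron argument, and it ends with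
   w_j = w_j^(0) + (-1)^j sum_i l_ji yhat_i x_i where alpha L_i <= l_ji <= L_i.
   A flipped example has margin 1 against its true label, so it outweighs
   f(sqrt gamma v) or f(- sqrt gamma v) by its noise alone, which moves f by at
   most sum_j |<w_j, n_i>|.  Averaging over the flipped examples gives, for
   w = sum_j (-1)^j w_j and P the projection orthogonal to v,
   sqrt gamma <w, v> = O(sqrt(1 - gamma) |P w| / sqrt(alpha k)).  Since
   f(x) - f(-x) = (1 + alpha) <w, x>, the test error is at least half of the
   error of the linear classifier w, a Gaussian tail at level
   O(sqrt(d / (alpha k))). *)
From HB Require Import structures.
Require Import Defs.
From mathcomp Require Import all_boot all_order all_algebra.
From mathcomp Require Import all_classical all_reals all_analysis.
From mathcomp Require Import measurable_realfun.
From mathcomp Require Import ring lra zify.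

Import Order.TTheory GRing.Theory Num.Theory.
Import numFieldNormedType.Exports.

Local Open Scope classical_set_scope.
Local Open Scope ring_scope.

Set Implicit Arguments.
Unset Strict Implicit.
Unset Printing Implicit Defensive.

(** * Independence *)

(** Independence is given as a product formula over sigma-algebras and normality as an almost sure
    factorization through i.i.d. normal variables; the noise has no density, its covariance being
    singular along [v]. Every Gaussian estimate therefore goes through expectations of products:
    moment generating functions for the tails, real characteristic functions for the small ball. The
    small ball probability must be exponentially small in [d] to beat a net of [exp (O(n))] points,
    and this fixes the constant in [d >= C2 n]. The good event has to be measurable for [(X, yhat)],
    whereas true labels and noise are not observed: they are read off [X] by projecting on [v],
    correctly only outside a null set. Flipped examples of both true labels are used because [f]
    itself is not linear: only the difference of its values at [sqrt gamma v] and [- sqrt gamma v]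
    is a multiple of [<w, v>]. *)

Section WeightedIntegral.
Import HBNNSimple.
Local Open Scope ereal_scope.

Lemma ge0_integral_weighted_lim {R : realType} d d' (T : measurableType d)
    (U : measurableType d') (mu : {measure set T -> \bar R}) (X : T -> U)
    (G : T -> R) (f : U -> \bar R) (mf : measurable_fun [set: U] f) :
  measurable_fun setT X -> measurable_fun setT G -> (forall x, 0 <= G x)%R ->
  (forall u, 0 <= f u) ->
  \int[mu]_x ((G x)%:E * f (X x)) =
  limn (fun n => \sum_(r \in range (nnsfun_approx measurableT mf n))
    r%:E * \int[mu]_x ((G x)%:E *
      (\1_(nnsfun_approx measurableT mf n @^-1` [set r]) (X x))%:E)).
Proof.
move=> mX mG G0 f0; set f_ := nnsfun_approx measurableT mf.
have mfX n : measurable_fun setT (fun x => (f_ n (X x))%:E).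
  by apply/measurable_EFinP; exact: measurableT_comp.
have mEG : measurable_fun setT (fun x => (G x)%:E) by apply/measurable_EFinP.
have cf x : EFin \o f_^~ x @ \oo --> f x by apply: cvg_nnsfun_approx.
transitivity (limn (fun n => \int[mu]_x ((G x)%:E * (f_ n (X x))%:E))).
  rewrite -monotone_convergence//.
  - apply: eq_integral => x _; apply/esym/cvg_lim => //.
    by apply: cvgeZl => //; exact: cf.
  - by move=> n; apply: emeasurable_funM.
  - by move=> n x _; rewrite mule_ge0// lee_fin.
  - move=> x _ m n mn; rewrite lee_wpmul2l ?lee_fin ?G0//.
    exact/lefP/nd_nnsfun_approx.
congr (limn _); apply/funext => n.
have mI r : measurable_fun setT
    (fun x => (\1_(f_ n @^-1` [set r]) (X x))%:E : \bar R).
  apply/measurable_EFinP.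
  apply: (@measurableT_comp _ _ _ _ _ _ (\1_(f_ n @^-1` [set r]) : U -> R)) => //.
transitivity (\int[mu]_x (\sum_(r \in range (f_ n))
    r%:E * ((G x)%:E * (\1_(f_ n @^-1` [set r]) (X x))%:E))).
  apply: eq_integral => x _; rewrite fimfunE -fsumEFin//.
  rewrite ge0_mule_fsumr; last first.
    by move=> r; exact: nnfun_muleindic_ge0.
  by apply: eq_fsbigr => r _; rewrite EFinM muleCA.
rewrite ge0_integral_fsum//.
- apply: eq_fsbigr => r; rewrite inE => -[u _ <-].
  rewrite ge0_integralZl//.
  + by apply: emeasurable_funM.
  + by move=> x _; rewrite mule_ge0// lee_fin.
  + by rewrite lee_fin.
- move=> r; apply: emeasurable_funM => //.
  by apply: emeasurable_funM.
- move=> r x _; rewrite muleCA mule_ge0 ?lee_fin ?G0//.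
  by rewrite -lee_fin nnfun_muleindic_ge0.
Qed.

(** By simple functions and monotone convergence, weighted image measures need only be compared on
    sets. With [mu1 = mu2 = P] this replaces one factor of a product by its mean; with Lebesgue
    measure weighted by a density it computes Gaussian expectations. *)
Lemma ge0_integral_weighted_eq {R : realType} d1 d2 d' (T1 : measurableType d1)
    (T2 : measurableType d2) (U : measurableType d')
    (mu1 : {measure set T1 -> \bar R}) (mu2 : {measure set T2 -> \bar R})
    (X1 : T1 -> U) (X2 : T2 -> U) (G1 : T1 -> R) (G2 : T2 -> R)
    (f : U -> \bar R) :
  measurable_fun setT X1 -> measurable_fun setT X2 ->
  measurable_fun setT G1 -> measurable_fun setT G2 ->
  (forall x, 0 <= G1 x)%R -> (forall x, 0 <= G2 x)%R ->
  (forall B, measurable B ->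
    \int[mu1]_x ((G1 x)%:E * (\1_B (X1 x))%:E) =
    \int[mu2]_x ((G2 x)%:E * (\1_B (X2 x))%:E)) ->
  measurable_fun setT f -> (forall u, 0 <= f u) ->
  \int[mu1]_x ((G1 x)%:E * f (X1 x)) = \int[mu2]_x ((G2 x)%:E * f (X2 x)).
Proof.
move=> mX1 mX2 mG1 mG2 G10 G20 GB mf f0.
rewrite !(ge0_integral_weighted_lim _ mf)//.
by congr (limn _); apply/funext => n; apply: eq_fsbigr => r _; rewrite GB.
Qed.

End WeightedIntegral.

Section Independence.
Context {R : realType} {disp : measure_display} {T : measurableType disp}.
Variable P : probability T R.

Definition independent_rvs (I : finType) (X : I -> T -> R) : Prop :=
  forall A : I -> set R, (forall i, measurable (A i)) ->
    P (\bigcap_(i in [set: I]) X i @^-1` A i) = (\prod_i P (X i @^-1` A i))%E.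

Local Open Scope ereal_scope.

Lemma indic_bigcap_prod (I : finType) (X : I -> T -> R) (A : I -> set R) w :
  (\prod_i (\1_(A i) (X i w) : R) =
   \1_(\bigcap_(i in [set: I]) X i @^-1` A i) w)%R.
Proof.
rewrite [RHS]indicE; case: (boolP (w \in _)) => [|/negP] wA.
  rewrite big1// => i _; rewrite indicE mem_set//.
  by move: wA; rewrite inE; apply.
have [i Ai] : exists i, ~ A i (X i w).
  by apply/existsNP => Aw; apply: wA; rewrite inE => i _; exact: Aw.
by rewrite (bigD1 i)//= indicE memNset// mul0r.
Qed.

Lemma measurable_indic_comp (X : T -> R) (B : set R) :
  measurable B -> measurable_fun setT X ->
  measurable_fun setT (fun w => \1_B (X w) : R).
Proof.
move=> mB mX.
have m1 : measurable_fun setT (\1_B : R -> R) by exact: measurable_indic.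
exact: (measurableT_comp m1 mX).
Qed.

(** The induction is on the list of indices whose [h i] is not yet an indicator. With the other
    factors frozen into a weight, [ge0_integral_weighted_eq] reduces a general [h a] to an
    indicator, and a product of indicators is the independence of events. *)
Lemma expectation_prod_ge0 (I : finType) (X : I -> T -> R) (h : I -> R -> R) :
  (forall i, measurable_fun setT (X i)) -> independent_rvs X ->
  (forall i, measurable_fun setT (h i)) -> (forall i x, (0 <= h i x)%R) ->
  (forall i, \int[P]_w (h i (X i w))%:E < +oo) ->
  \int[P]_w (\prod_i h i (X i w))%:E = \prod_i \int[P]_w (h i (X i w))%:E.
Proof.
move=> mX iX mh h0 hoo.
have mhX (h' : I -> R -> R) i : (forall i, measurable_fun setT (h' i)) ->
    measurable_fun setT (fun w => h' i (X i w)).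
  by move=> mh'; exact: (measurableT_comp (mh' i) (mX i)).
have : forall i, i \notin enum I -> exists2 A, measurable A & h i = \1_A.
  by move=> i; rewrite mem_enum.
elim: (enum I) h mh h0 hoo => [|a s IH] h mh h0 hoo hs.
  have /choice[A AP] : forall i, exists A, measurable A /\ h i = \1_A.
    by move=> i; have [A ? ?] := hs i isT; exists A.
  under eq_integral => w _.
    rewrite (eq_bigr (fun i => \1_(A i) (X i w))%R); last first.
      by move=> i _; rewrite (AP i).2.
    rewrite indic_bigcap_prod; over.
  have mA i : measurable (X i @^-1` A i).
    by rewrite -[X in measurable X]setTI; apply: mX => //; exact: (AP i).1.
  rewrite integral_indic//; last first.
    by apply: fin_bigcap_measurable => // i _; exact: mA.
  rewrite setIT; apply: etrans (iX A (fun i => (AP i).1)) _.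
  apply: eq_bigr => i _; rewrite -[X in P X]setIT -integral_indic//.
  by apply: eq_integral => w _; rewrite (AP i).2.
pose c := fine (\prod_(i | i != a) \int[P]_w (h i (X i w))%:E).
have hfin i : \int[P]_w (h i (X i w))%:E \is a fin_num.
  by rewrite ge0_fin_numE// integral_ge0// => w _; rewrite lee_fin.
have cE : c%:E = \prod_(i | i != a) \int[P]_w (h i (X i w))%:E.
  by rewrite fineK// prode_fin_num.
have c0 : (0 <= c)%R.
  by rewrite -lee_fin cE prode_ge0// => i _; apply: integral_ge0 => w _; rewrite lee_fin.
have mh1 i : measurable_fun setT (fun w => h i (X i w)) by exact: mhX.
have mprod : measurable_fun setT (fun w => \prod_(i | i != a) h i (X i w))%R.
  under eq_fun do rewrite -big_filter.
  by apply: measurable_prod => i _.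
have prod0 w : (0 <= \prod_(i | i != a) h i (X i w))%R by exact: prodr_ge0.
transitivity (\int[P]_w ((\prod_(i | i != a) h i (X i w))%:E * (h a (X a w))%:E)).
  by apply: eq_integral => w _; rewrite (bigD1 a)//= EFinM muleC.
rewrite (@ge0_integral_weighted_eq _ _ _ _ _ _ _ P P (X a) (X a) _ (cst c)
  (fun x => (h a x)%:E))//.
- rewrite /= ge0_integralZl//.
  + by rewrite cE [in RHS](bigD1 a)//= muleC.
  + exact/measurable_EFinP.
  + by move=> w _; rewrite lee_fin.
- move=> B mB; pose h' i := if i == a then \1_B else h i.
  have h'a i : i != a -> h' i = h i by rewrite /h' => /negbTE->.
  transitivity (\int[P]_w (\prod_i h' i (X i w))%:E).
    apply: eq_integral => w _; rewrite [in RHS](bigD1 a)//= {1}/h' eqxx.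
    rewrite EFinM muleC; congr (_ * _%:E).
    by apply: eq_bigr => i /h'a->.
  rewrite IH.
  + rewrite /= ge0_integralZl//; last first.
      by apply/measurable_EFinP; exact: measurable_indic_comp.
    rewrite [in LHS](bigD1 a)//= {1}/h' eqxx muleC cE; congr (_ * _).
    by apply: eq_bigr => i /h'a->.
  + by move=> i; rewrite /h'; case: ifP => // _; exact: measurable_indic.
  + by move=> i x; rewrite /h'; case: ifP => // _.
  + move=> i; rewrite /h'; case: ifP => // _.
    apply: (@le_lt_trans _ _ (\int[P]_w 1%:E)).
      apply: ge0_le_integral => //.
      * apply/measurable_EFinP.
        exact: measurable_indic_comp.
      * by move=> w _; rewrite lee_fin indicE; case: (_ \in _).
    by rewrite integral_cst//= mul1e (le_lt_trans (probability_le1 _ _))// ltry.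
  + move=> i si; rewrite /h'; case: ifPn => [_|ia]; first by exists B.
    by apply: hs; rewrite inE negb_or ia.
- exact/measurable_EFinP.
- by move=> u; rewrite lee_fin.
Qed.

Local Close Scope ereal_scope.

Definition bounded_by (U : Type) (M : R) (f : U -> R) := forall x, `|f x| <= M.

Lemma integrable_bounded_by (f : T -> R) M :
  measurable_fun setT f -> bounded_by M f -> P.-integrable setT (EFin \o f).
Proof.
move=> mf fM; apply: measurable_bounded_integrable => //.
  by rewrite (le_lt_trans (probability_le1 _ _))// ltry.
exists M; split => [|N MN x _] /=; first exact: num_real.
exact: le_trans (fM x) (ltW MN).
Qed.

Lemma bounded_by_prod (I : finType) (A : pred I) (X : I -> T -> R)
    (h : I -> R -> R) : (forall i, exists M, bounded_by M (h i)) ->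
  exists M, bounded_by M (fun w => \prod_(i | A i) h i (X i w)).
Proof.
move=> /choice[M hM]; exists (\prod_(i | A i) M i) => w.
by rewrite normr_prod; apply: ler_prod => i _; rewrite normr_ge0 hM.
Qed.

Lemma measurable_prod_comp (I : finType) (A : pred I) (X : I -> T -> R)
    (h : I -> R -> R) : (forall i, measurable_fun setT (X i)) ->
  (forall i, measurable_fun setT (h i)) ->
  measurable_fun setT (fun w => \prod_(i | A i) h i (X i w)).
Proof.
move=> mX mh; under eq_fun do rewrite -big_filter.
by apply: measurable_prod => i _; exact: (measurableT_comp (mh i) (mX i)).
Qed.

Lemma expectation_prod_bounded (I : finType) (X : I -> T -> R)
    (h : I -> R -> R) :
  (forall i, measurable_fun setT (X i)) -> independent_rvs X ->
  (forall i, measurable_fun setT (h i)) ->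
  (forall i, exists M, bounded_by M (h i)) ->
  \int[P]_w (\prod_i h i (X i w)) = \prod_i \int[P]_w h i (X i w).
Proof.
move=> mX iX mh hM.
have : forall i, i \notin enum I -> forall x, 0 <= h i x.
  by move=> i; rewrite mem_enum.
have ih h' i : measurable_fun setT (h' i) -> (exists M, bounded_by M (h' i)) ->
    P.-integrable setT (EFin \o (fun w => h' i (X i w))).
  move=> mh' [M h'M]; apply: (@integrable_bounded_by _ M) => //.
  exact: (measurableT_comp mh' (mX i)).
elim: (enum I) h mh hM => [|a s IH] h mh hM hs.
  rewrite /Rintegral expectation_prod_ge0//.
  - rewrite (eq_bigr (fun i => (\int[P]_w h i (X i w))%:E)) ?prodEFin//.
    by move=> i _; rewrite fineK// integrable_fin_num//; exact: ih.
  - by move=> i x; exact: hs.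
  - by move=> i; rewrite -ge0_fin_numE ?integrable_fin_num//;
      [exact: ih|apply: integral_ge0 => w _; rewrite lee_fin hs].
have D1 (F : I -> R) : \prod_i F i = F a * \prod_(i | i != a) F i.
  by rewrite (bigD1 a).
have [M haM] := hM a.
(* A signed [h a] is the difference of the nonnegative functions [h a + M] and [M]; the product is
   linear in this factor, so the induction hypothesis applies to each. *)
pose h1 i := if i == a then (fun x => h a x + M) else h i.
pose h2 i := if i == a then cst 1 else h i.
have h1aa : h1 a = (fun x => h a x + M) by rewrite /h1 eqxx.
have h2aa : h2 a = cst 1 by rewrite /h2 eqxx.
have h1a i : i != a -> h1 i = h i by rewrite /h1 => /negbTE->.
have h2a i : i != a -> h2 i = h i by rewrite /h2 => /negbTE->.
have mh1 i : measurable_fun setT (h1 i).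
  by rewrite /h1; case: ifP => // _; exact: measurable_funD.
have mh2 i : measurable_fun setT (h2 i) by rewrite /h2; case: ifP.
have bh1 i : exists M, bounded_by M (h1 i).
  rewrite /h1; case: ifP => // _; exists (M + `|M|) => x.
  by rewrite (le_trans (ler_normD _ _))// lerD2r.
have bh2 i : exists M, bounded_by M (h2 i).
  by rewrite /h2; case: ifP => // _; exists 1 => x; rewrite normr1.
have hs1 i : i \notin s -> forall x, 0 <= h1 i x.
  rewrite /h1; case: ifPn => [_ _ x|ia si]; last by apply: hs; rewrite inE negb_or ia.
  by rewrite -lerBlDr sub0r lerNl (le_trans (ler_norm _))// normrN.
have hs2 i : i \notin s -> forall x, 0 <= h2 i x.
  rewrite /h2; case: ifPn => [_ _ x|ia si]; first exact: ler01.
  by apply: hs; rewrite inE negb_or ia.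
have ip h' : (forall i, measurable_fun setT (h' i)) ->
    (forall i, exists M, bounded_by M (h' i)) ->
    P.-integrable setT (EFin \o (fun w => \prod_i h' i (X i w))).
  move=> mh' h'M; have [N hN] := bounded_by_prod predT X h'M.
  by apply: integrable_bounded_by hN; exact: measurable_prod_comp.
transitivity (\int[P]_w (\prod_i h1 i (X i w) - M * \prod_i h2 i (X i w))).
  apply: eq_Rintegral => w _; rewrite !D1 h1aa h2aa/=.
  rewrite [in X in X - _](eq_bigr (fun i => h i (X i w))); last by move=> i /h1a->.
  rewrite [in X in _ - X](eq_bigr (fun i => h i (X i w))); last by move=> i /h2a->.
  by rewrite mul1r mulrDl addrK.
rewrite RintegralB//; first last.
- have [N hN] := bounded_by_prod predT X bh2.
  apply: (@integrable_bounded_by _ (`|M| * N)) => [|w].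
    by apply: measurable_funM => //; exact: measurable_prod_comp.
  by rewrite normrM ler_wpM2l.
- exact: ip.
rewrite RintegralZl//; last exact: ip.
rewrite !IH// !D1 h1aa h2aa/=.
rewrite [in X in X - _](eq_bigr (fun i => \int[P]_w h i (X i w))); last by move=> i /h1a->.
rewrite [in X in _ - X](eq_bigr (fun i => \int[P]_w h i (X i w))); last first.
  by move=> i /h2a->.
rewrite RintegralD//; [|exact: ih|by apply: (@integrable_bounded_by _ `|M|)].
rewrite !Rintegral_cst//= probability_setT/= !mulr1.
by rewrite mul1r mulrDl addrK.
Qed.

(** A real form of the multiplicativity of characteristic functions: the sines have mean zero, so
    only the products of cosines survive. *)
Lemma expectation_cos_sum (I : finType) (X : I -> T -> R) (r : I -> R) theta :
  (forall i, measurable_fun setT (X i)) -> independent_rvs X ->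
  (forall i, \int[P]_w cos (X i w) = r i) ->
  (forall i, \int[P]_w sin (X i w) = 0) ->
  \int[P]_w cos (theta + \sum_i X i w) = cos theta * \prod_i r i.
Proof.
move=> mX iX cr s0.
have mcos : measurable_fun setT (cos : R -> R).
  by apply: continuous_measurable_fun; exact: continuous_cos.
have msin : measurable_fun setT (sin : R -> R).
  by apply: continuous_measurable_fun; exact: continuous_sin.
have bcos : bounded_by 1 (cos : R -> R).
  by move=> x; rewrite ler_norml cos_geN1 cos_le1.
have bsin : bounded_by 1 (sin : R -> R).
  by move=> x; rewrite ler_norml sin_geN1 sin_le1.
(* The list [s] holds the variables still inside the cosine; one that has left it appears as [cos]
   or [sin] among the [h i]. The term with [sin] carries a cosine of phase [t + pi / 2], so the
   general form is stable. *)
suff H : forall s : seq I, uniq s -> forall t (h : I -> R -> R),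
    (forall i, measurable_fun setT (h i)) ->
    (forall i, exists M, bounded_by M (h i)) ->
    (forall i, i \in s -> h i = cst 1) ->
    \int[P]_w (cos (t + \sum_(i <- s) X i w) * \prod_i h i (X i w)) =
    cos t * (\prod_(i <- s) r i) * \prod_i \int[P]_w h i (X i w).
  have := H (index_enum I) (index_enum_uniq I) theta (fun=> cst 1).
  under eq_Rintegral do rewrite [X in _ * X]big1// mulr1.
  move=> ->//; last by move=> i; exists 1 => x; rewrite normr1.
  rewrite [X in _ * X]big1 ?mulr1// => i _.
  by rewrite Rintegral_cst//= probability_setT mul1r.
elim=> [_|a s IH /= /andP[as_ us]] t h mh hM hs.
  under eq_Rintegral do rewrite big_nil addr0.
  rewrite RintegralZl//; last first.
    have [N hN] := bounded_by_prod predT X hM.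
    by apply: integrable_bounded_by hN; exact: measurable_prod_comp.
  by rewrite expectation_prod_bounded// big_nil mulr1.
have D1 (F : I -> R) : \prod_i F i = F a * \prod_(i | i != a) F i.
  by rewrite (bigD1 a).
pose h' (f : R -> R) i := if i == a then f else h i.
have h'a f i : i != a -> h' f i = h i by rewrite /h' => /negbTE->.
have h'aa f : h' f a = f by rewrite /h' eqxx.
have mh' f : measurable_fun setT f -> forall i, measurable_fun setT (h' f i).
  by move=> mf i; rewrite /h'; case: ifP.
have bh' f : bounded_by 1 f -> forall i, exists M, bounded_by M (h' f i).
  by move=> bf i; rewrite /h'; case: ifP => // _; exists 1.
have h's f i : i \in s -> h' f i = cst 1.
  move=> si; rewrite h'a; first by apply: hs; rewrite inE si orbT.
  by apply: contraNneq as_ => <-.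
have ip u f : measurable_fun setT f -> bounded_by 1 f -> P.-integrable setT
   (EFin \o (fun w => cos (u + \sum_(i <- s) X i w) * \prod_i h' f i (X i w))).
  move=> mf bf; have [N hN] := bounded_by_prod predT X (bh' f bf).
  apply: (@integrable_bounded_by _ (1 * N)) => [|w].
    apply: measurable_funM; last by apply: measurable_prod_comp => //; exact: mh'.
    apply: measurableT_comp => //; apply: measurable_funD => //.
    exact: measurable_sum.
  by rewrite normrM ler_pM//; exact: bcos.
transitivity (\int[P]_w
   (cos (t + \sum_(i <- s) X i w) * (\prod_i h' cos i (X i w)) +
    cos (t + pi / 2 + \sum_(i <- s) X i w) * (\prod_i h' sin i (X i w)))).
  apply: eq_Rintegral => w _; rewrite big_cons.
  rewrite !D1/= !h'aa hs ?mem_head// mul1r.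
  have hp f : \prod_(i | i != a) h' f i (X i w) = \prod_(i | i != a) h i (X i w).
    by apply: eq_bigr => i ia; rewrite h'a.
  rewrite !hp.
  rewrite !mulrA -mulrDl; congr (_ * _).
  by rewrite (addrAC t (pi / 2)) cosDpihalf mulNr -cosD addrA addrAC.
rewrite RintegralD//; [|exact: ip|exact: ip].
rewrite !IH//; [|exact: mh'|exact: bh'|exact: h's|exact: mh'|exact: bh'|exact: h's].
have hq f : \prod_(i | i != a) \int[P]_w h' f i (X i w) =
    \prod_(i | i != a) \int[P]_w h i (X i w).
  by apply: eq_bigr => i ia; rewrite h'a.
rewrite big_cons !D1/= !h'aa !hq cr s0 mul0r mulr0 addr0 hs ?mem_head//.
by rewrite Rintegral_cst//= probability_setT/=; ring.
Qed.

Lemma expectation_exp_sum (I : finType) (X : I -> T -> R) :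
  (forall i, measurable_fun setT (X i)) -> independent_rvs X ->
  (forall i, (\int[P]_w (expR (X i w))%:E < +oo)%E) ->
  (\int[P]_w (expR (\sum_i X i w))%:E =
   \prod_i \int[P]_w (expR (X i w))%:E)%E.
Proof.
move=> mX iX Xoo; under eq_integral do rewrite expR_sum.
by apply: (@expectation_prod_ge0 _ _ (fun=> expR)) => // i x; exact: expR_ge0.
Qed.

End Independence.

(** * Gaussian variables and vectors *)

Section StandardNormal.
Context {R : realType} {disp : measure_display} {T : measurableType disp}.
Variable P : probability T R.

Definition std_normal (g : T -> R) : Prop :=
  measurable_fun setT g /\
  forall B, measurable B -> P (g @^-1` B) = normal_prob 0 1 B.

Let phi : R -> R := normal_pdf 0 1.

Let phiE x : phi x = normal_peak 1 * expR (- x ^+ 2 / 2).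
Proof.
rewrite /phi normal_pdfE ?oner_neq0// /normal_fun subr0 expr1n.
by rewrite mulr2n.
Qed.

Let phi_ge0 x : 0 <= phi x. Proof. exact: normal_pdf_ge0. Qed.

Let mphi : measurable_fun setT phi. Proof. exact: measurable_normal_pdf. Qed.

Let cphi : continuous phi.
Proof. by apply: continuous_normal_pdf; exact: oner_neq0. Qed.

Lemma integral_std_normal (g : T -> R) (f : R -> R) : std_normal g ->
  measurable_fun setT f -> (forall x, 0 <= f x) ->
  (\int[P]_w (f (g w))%:E =
   \int[lebesgue_measure]_x (f x * phi x)%:E)%E.
Proof.
move=> [mg lg] mf f0.
transitivity (\int[P]_w ((cst 1 w)%:E * (f (g w))%:E))%E.
  by apply: eq_integral => w _; rewrite mul1e.
rewrite (@ge0_integral_weighted_eq _ _ _ _ _ _ _ P lebesgue_measure g id _ phi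
  (fun x => (f x)%:E))//.
- by apply: eq_integral => x _; rewrite -EFinM mulrC.
- move=> B mB; under eq_integral do rewrite mul1e.
  under [RHS]eq_integral do rewrite -EFinM.
  rewrite integral_indic//; last first.
    by rewrite -[X in measurable X]setTI; exact: mg.
  rewrite setIT; apply: etrans (lg _ mB) _.
  rewrite /normal_prob [LHS]integral_mkcond.
  by apply: eq_integral => x _; rewrite patchE indicE; case: ifPn => _;
    rewrite ?mulr1 ?mulr0.
- exact/measurable_EFinP.
Qed.

(** Completing the square: tilting by [expR (s * x)] translates the normal density by [s], at the
    price [expR (s ^+ 2 / 2)]. A constant [f] yields the moment generating function, and
    [f = 1 + sin] leads to the differential equation of the characteristic function. *)
Lemma integral_std_normal_shift (g : T -> R) (f : R -> R) (s : R) :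
  std_normal g -> continuous f -> (forall x, 0 <= f x) ->
  (\int[P]_w (f (g w) * expR (s * g w))%:E =
   (expR (s ^+ 2 / 2))%:E * \int[P]_w (f (g w + s))%:E)%E.
Proof.
move=> gN cf f0.
have cexp : continuous (fun x : R => expR (s * x)).
  move=> x; apply: continuous_comp; last exact: continuous_expR.
  exact: mulrl_continuous.
have cG : continuous (fun x => f x * expR (s * x)).
  by move=> x; apply: cvgM; [exact: cf|exact: cexp].
rewrite (integral_std_normal (f := fun x => f x * expR (s * x)))//; last 2 first.
- exact: continuous_measurable_fun.
- by move=> x; rewrite mulr_ge0// expR_ge0.
have mfs : measurable_fun setT (fun x : R => f (x + s)).
  apply: continuous_measurable_fun => x.
  by apply: continuous_comp; [apply: cvgD; [exact: cvg_id|exact: cvg_cst]|exact: cf].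
rewrite (integral_std_normal (f := fun x : R => f (x + s)))//.
have dF : (fun x : R => x + s)^`()%classic = cst 1.
  by apply/funext => x; rewrite derive1E deriveD// derive_id derive_cst addr0.
rewrite (@increasing_ge0_integration_by_substitutionT _ (fun x : R => x + s)).
- rewrite dF -ge0_integralZl//; first last.
  + by move=> x _; rewrite lee_fin mulr_ge0.
  + by apply/measurable_EFinP; exact: measurable_funM.
  apply: eq_integral => x _; rewrite !fctE/= mulr1 -EFinM; congr EFin.
  have E : expR (s * (x + s)) * expR (- (x + s) ^+ 2 / 2) =
           expR (s ^+ 2 / 2) * expR (- x ^+ 2 / 2).
    by rewrite -!expRD; congr expR; field.
  rewrite !phiE [LHS](_ : _ = f (x + s) * normal_peak 1 *
    (expR (s * (x + s)) * expR (- (x + s) ^+ 2 / 2))); last by ring.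
  by rewrite E; ring.
- by move=> x y; rewrite ltrD2r.
- by rewrite dF => ?; exact: cvg_cst.
- by rewrite dF; exact: is_cvg_cst.
- by rewrite dF; exact: is_cvg_cst.
- by move=> x; apply: derivableD.
- exact: cvg_addrr_Ny.
- exact: cvg_addrr.
- by move=> x; apply: cvgM; [exact: cG|exact: cphi].
- by move=> x; rewrite !mulr_ge0// expR_ge0.
Qed.

Lemma std_normal_mgf (g : T -> R) (s : R) : std_normal g ->
  (\int[P]_w (expR (s * g w))%:E = (expR (s ^+ 2 / 2))%:E)%E.
Proof.
move=> gN; have := @integral_std_normal_shift g (cst 1) s gN.
under eq_integral do rewrite mul1r.
move=> ->//; last by move=> x; exact: cvg_cst.
by rewrite [X in (_ * X)%E](integral_cst P measurableT 1%E)/= probability_setT mul1e mule1.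
Qed.

Lemma std_normalN (g : T -> R) : std_normal g -> std_normal (\- g).
Proof.
move=> [mg lg]; split=> [|B mB]; first exact: measurable_funN.
have mNB : measurable ((-%R : R -> R) @^-1` B).
  by rewrite -[X in measurable X]setTI; exact: oppr_measurable.
transitivity (normal_prob 0 1 ((-%R : R -> R) @^-1` B)); first exact: lg.
rewrite /normal_prob [LHS]integral_mkcond [RHS]integral_mkcond.
transitivity (\int[pushforward lebesgue_measure (-%R : R -> measurableTypeR R)]_x
  (((fun x => (normal_pdf 0 1 x)%:E) \_ B) x))%E.
  rewrite ge0_integral_pushforward//=.
  - apply: eq_integral => x _; rewrite /= !patchE.
    have -> : normal_pdf 0 1 (- x) = normal_pdf 0 1 x by rewrite -/phi !phiE sqrrN.
    by congr (if _ then _ else _).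
  - apply/(measurable_restrictT _ _).1 => //.
    by apply/measurable_EFinP; exact: measurable_funTS.
  - by move=> x _; rewrite patchE; case: ifP => // _; rewrite lee_fin.
by apply: eq_measure_integral => A mA _; exact: lebesgue_measureN.
Qed.

End StandardNormal.

(** * The characteristic function of the normal law *)

Section NormalCharacteristic.
Context {R : realType} {disp : measure_display} {T : measurableType disp}.
Variable P : probability T R.
Variable g : T -> R.
Hypothesis gN : std_normal P g.

Let mg : measurable_fun setT g. Proof. exact: gN.1. Qed.

Let mexp s : measurable_fun setT (fun w => expR (s * g w)).
Proof. by apply: measurableT_comp => //; exact: measurable_funM. Qed.

Let msin t : measurable_fun setT (fun w => sin (t * g w)).
Proof.
apply: measurableT_comp; last exact: measurable_funM.
by apply: continuous_measurable_fun; exact: continuous_sin.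
Qed.

Let mcos t : measurable_fun setT (fun w => cos (t * g w)).
Proof.
apply: measurableT_comp; last exact: measurable_funM.
by apply: continuous_measurable_fun; exact: continuous_cos.
Qed.

Let bsin (x : R) : `|sin x| <= 1.
Proof. by rewrite ler_norml sin_geN1 sin_le1. Qed.

Let bcos (x : R) : `|cos x| <= 1.
Proof. by rewrite ler_norml cos_geN1 cos_le1. Qed.

Lemma integrable_exp_normal s :
  P.-integrable setT (EFin \o (fun w => expR (s * g w))).
Proof.
apply/integrableP; split; first by apply/measurable_EFinP; exact: mexp.
under eq_integral do rewrite /= ger0_norm ?expR_ge0//.
by rewrite std_normal_mgf// ltry.
Qed.

Let isin t : P.-integrable setT (EFin \o (fun w => sin (t * g w))).
Proof. by apply: (@integrable_bounded_by _ _ _ _ _ 1) => // w; exact: bsin. Qed.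

Let icos t : P.-integrable setT (EFin \o (fun w => cos (t * g w))).
Proof. by apply: (@integrable_bounded_by _ _ _ _ _ 1) => // w; exact: bcos. Qed.

Let icst : P.-integrable setT (EFin \o (fun _ : T => 1 : R)).
Proof. by apply: (@integrable_bounded_by _ _ _ _ _ 1) => // w; rewrite normr1. Qed.

Let isinexp t s :
  P.-integrable setT (EFin \o (fun w => sin (t * g w) * expR (s * g w))).
Proof.
apply: le_integrable (integrable_exp_normal s) => //.
  by apply/measurable_EFinP; exact: measurable_funM.
move=> w _; rewrite lee_fin normrM [leRHS]ger0_norm ?expR_ge0//.
by rewrite [X in _ * X]ger0_norm ?expR_ge0// ler_piMl ?expR_ge0.
Qed.

Let E1 : \int[P]_w (1 : R) = 1.
Proof. by rewrite Rintegral_cst//= probability_setT/= mul1r. Qed.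

(** [g] and [- g] have the same law; adding 1 makes the sine nonnegative, as [integral_std_normal]
    demands. *)
Lemma expectation_sin_normal t : \int[P]_w sin (t * g w) = 0.
Proof.
have cf : continuous (fun x : R => 1 + sin (t * x)).
  move=> x; apply: cvgD; first exact: cvg_cst.
  apply: continuous_comp; last exact: continuous_sin.
  exact: mulrl_continuous.
have f0 (x : R) : 0 <= 1 + sin (t * x).
  by rewrite -lerBlDl sub0r sin_geN1.
have mf := continuous_measurable_fun cf.
have := integral_std_normal gN mf f0.
rewrite -(integral_std_normal (std_normalN gN) mf f0) => /(congr1 fine).
have D h : P.-integrable setT (EFin \o h) ->
    fine (\int[P]_w (1 + h w)%:E)%E = 1 + \int[P]_w h w.
  move=> ih; rewrite -[LHS]/(\int[P]_w (1 + h w)) RintegralD//.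
  by rewrite E1.
rewrite (D (fun w => sin (t * g w))); last exact: isin.
rewrite [X in _ = fine X](_ : _ = \int[P]_w (1 + sin (- t * g w))%:E)%E; last first.
  by apply: eq_integral => w _; rewrite /= mulrN mulNr.
rewrite (D (fun w => sin (- t * g w))); last exact: isin.
under [in RHS]eq_Rintegral do rewrite mulNr sinN -mulN1r.
rewrite RintegralZl//.
by move=> /addrI; lra.
Qed.

Let F t := \int[P]_w cos (t * g w).

Let sin_exp t s : \int[P]_w (sin (t * g w) * expR (s * g w)) =
  expR (s ^+ 2 / 2) * (sin (t * s) * F t).
Proof.
have cf : continuous (fun x : R => 1 + sin (t * x)).
  move=> x; apply: cvgD; first exact: cvg_cst.
  apply: continuous_comp; last exact: continuous_sin.
  exact: mulrl_continuous.
have f0 (x : R) : 0 <= 1 + sin (t * x).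
  by rewrite -lerBlDl sub0r sin_geN1.
have := integral_std_normal_shift s gN cf f0.
under eq_integral do rewrite mulrDl mul1r.
move=> /(congr1 fine).
rewrite -[LHS]/(\int[P]_w (expR (s * g w) + sin (t * g w) * expR (s * g w))).
rewrite RintegralD//; last exact: integrable_exp_normal.
rewrite -[X in X + _ = _]/(fine (\int[P]_w (expR (s * g w))%:E)%E) std_normal_mgf//=.
have is' : P.-integrable setT
    (EFin \o (fun w => sin (t * g w) * cos (t * s) + cos (t * g w) * sin (t * s))).
  apply: (@integrable_bounded_by _ _ _ _ _ 2) => [|w].
    by apply: measurable_funD; apply: measurable_funM.
  rewrite (le_trans (ler_normD _ _))// -[leRHS]/(1 + 1 : R) lerD// normrM.
    by rewrite mulr_ile1.
  by rewrite mulr_ile1.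
under eq_integral do rewrite mulrDr sinD EFinD.
rewrite integralD//=.
rewrite integral_cst//= probability_setT mul1e.
have : (\int[P]_w (sin (t * g w) * cos (t * s) + cos (t * g w) * sin (t * s))%:E)%E =
   (sin (t * s) * F t)%:E.
  rewrite -[LHS]fineK ?integrable_fin_num//; congr EFin.
  rewrite -[LHS]/(\int[P]_w (sin (t * g w) * cos (t * s) + cos (t * g w) * sin (t * s))).
  rewrite RintegralD//.
  - rewrite !RintegralZr//.
    by rewrite expectation_sin_normal mul0r add0r mulrC.
  - apply: (@integrable_bounded_by _ _ _ _ _ 1) => [|w].
      exact: measurable_funM.
    by rewrite normrM mulr_ile1.
  - apply: (@integrable_bounded_by _ _ _ _ _ 1) => [|w].
      exact: measurable_funM.
    by rewrite normrM mulr_ile1.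
move=> ->; rewrite -EFinD -EFinM/= mulrDr mulr1.
by move=> /addrI.
Qed.

(** An integrable majorant of [|g| expR |g|], hence of the derivatives of both integrands that are
    differentiated under the integral below. *)
Let G w : R := expR (2 * g w) + expR (- 2 * g w).

Let G0 w : 0 <= G w. Proof. by rewrite addr_ge0// expR_ge0. Qed.

Let iG : P.-integrable setT (EFin \o G).
Proof.
rewrite /comp /G; under eq_fun do rewrite EFinD.
by apply: integrableD => //; exact: integrable_exp_normal.
Qed.

Let Gub w : `|g w| * expR `|g w| <= G w.
Proof.
have h (x : R) : 0 <= x -> x * expR x <= expR (2 * x).
  move=> x0; rewrite mulr_natl mulr2n expRD ler_wpM2r ?expR_ge0//.
  by rewrite (le_trans _ (expR_ge1Dx x))// lerDr.
rewrite /G; have [g0|g0] := leP 0 (g w).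
  rewrite ger0_norm//; apply: (le_trans (h _ g0)).
  by rewrite lerDl expR_ge0.
rewrite ltr0_norm//; apply: (le_trans (h _ _)); first by rewrite oppr_ge0 ltW.
by rewrite mulrN -mulNr lerDr expR_ge0.
Qed.

(** Stein's identity for the sine, obtained without integration by parts: it is the derivative at
    [s = 0] of the identity [sin_exp], which comes from translating the density. *)
Let Egsin t : \int[P]_w (g w * sin (t * g w)) = t * F t.
Proof.
pose f (s : R) w := sin (t * g w) * expR (s * g w).
have df (s : R) w : is_derive s 1 (f ^~ w) (sin (t * g w) * (g w * expR (s * g w))).
  rewrite /f; apply: is_derive_eq.
  by rewrite /GRing.scale/=; ring.
have d1 (s : R) w : partial1of2 f s w = sin (t * g w) * (g w * expR (s * g w)).
  by rewrite partial1of2E; have := df s w => /@derive_val.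
have I0 : (0 : R) \in `](-1), 1[ by rewrite in_itv/= ltrN10 ltr01.
have ub (s : R) w : `](-1)%R, 1%R[%classic s -> setT w -> `|partial1of2 f s w| <= G w.
  rewrite /= in_itv/= => /andP[s1 s2] _; rewrite d1 normrM.
  rewrite (le_trans _ (Gub w))// normrM.
  rewrite (le_trans (ler_piMl _ (bsin _)))// ?mulr_ge0//.
  rewrite ler_wpM2l// ger0_norm ?expR_ge0// ler_expR (le_trans (ler_norm _))//.
  by rewrite normrM ler_piMl// ler_norml ltW//= ltW.
have dv (s : R) w : `](-1)%R, 1%R[%classic s -> setT w -> derivable (f ^~ w) s 1.
  by move=> _ _; have := df s w => /@ex_derive.
have ii (s : R) : `](-1)%R, 1%R[%classic s -> P.-integrable setT (EFin \o f s).
  by move=> _; exact: isinexp.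
have := differentiation_under_integral measurableT I0 ii dv G0 iG ub.
under [RHS]eq_Rintegral do rewrite d1 mul0r expR0 mulr1 mulrC.
move=> <-.
pose h (s : R) := expR (s ^+ 2 / 2) * (sin (t * s) * F t).
rewrite (_ : (fun _ => _) = h); last by apply/funext => s; rewrite /h -sin_exp.
suff D : is_derive (0 : R) 1 h (t * F t) by rewrite derive1E derive_val.
rewrite /h; apply: is_derive_eq.
rewrite /GRing.scale/= !(expr0n, mul0r, mulr0, sin0)/= ?(mul0r, mulr0) ?expR0 ?sin0 ?cos0.
by ring.
Qed.

Let dF (t : R) : is_derive t 1 F (- t * F t).
Proof.
pose f (s : R) w := cos (s * g w).
have df (s : R) w : is_derive s 1 (f ^~ w) (- (g w * sin (s * g w))).
  rewrite /f; apply: is_derive_eq.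
  by rewrite /GRing.scale/=; ring.
have d1 (s : R) w : partial1of2 f s w = - (g w * sin (s * g w)).
  by rewrite partial1of2E; have := df s w => /@derive_val.
have It : t \in `](t - 1), (t + 1)[ by rewrite in_itv/= gtrBl ltrDl ltr01.
have ub (s : R) w : `](t - 1)%R, (t + 1)%R[%classic s -> setT w ->
    `|partial1of2 f s w| <= G w.
  move=> _ _; rewrite d1 normrN normrM (le_trans _ (Gub w))// ler_wpM2l//.
  by rewrite (le_trans (bsin _))// -[leLHS]expR0 ler_expR.
have dv (s : R) w : `](t - 1)%R, (t + 1)%R[%classic s -> setT w ->
    derivable (f ^~ w) s 1.
  by move=> _ _; have := df s w => /@ex_derive.
have ii (s : R) : `](t - 1)%R, (t + 1)%R[%classic s ->
    P.-integrable setT (EFin \o f s).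
  by move=> _; exact: icos.
have D := derivable_under_integral measurableT It ii dv G0 iG ub.
have := differentiation_under_integral measurableT It ii dv G0 iG ub.
rewrite derive1E => DE; apply: DeriveDef; first exact: D.
rewrite [LHS]DE mulNr -Egsin -mulN1r -RintegralZl//.
  by apply: eq_Rintegral => w _; rewrite d1 mulN1r.
apply: le_integrable iG => //; first exact/measurable_EFinP/measurable_funM.
move=> w _; rewrite lee_fin [leRHS]ger0_norm// normrM (le_trans _ (Gub w))//.
by rewrite ler_wpM2l// (le_trans (bsin _))// -[leLHS]expR0 ler_expR.
Qed.

(** [dF] is the equation [F' = - t F], so [F t * expR (t ^+ 2 / 2)] is constant. *)
Lemma expectation_cos_normal t :
  \int[P]_w cos (t * g w) = expR (- t ^+ 2 / 2).
Proof.
pose H t := F t * expR (t ^+ 2 / 2).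
have dH (x : R) : is_derive x 1 H 0.
  have dFx := dF x; rewrite /H; apply: is_derive_eq.
  by rewrite /GRing.scale/=; field.
have := @is_derive_0_is_cst _ H t 0 dH; rewrite /H expr0n/= mul0r expR0 mulr1.
have -> : F 0 = 1.
  by rewrite /F; under eq_Rintegral do rewrite mul0r cos0; rewrite E1.
rewrite mulNr expRN => /(canRL (mulfK (lt0r_neq0 (expR_gt0 _)))).
by rewrite mul1r.
Qed.

End NormalCharacteristic.

Section GeneratedSigmaAlgebra.
Context {R : realType} {disp : measure_display} {T : measurableType disp}.

(** [T] with the generated sigma-algebra as its measurable structure: membership in [sigma_rv F]
    becomes measurability on this type, to which the usual closure lemmas apply. *)
Definition sigma_rv_type (J : Type) (F : J -> T -> R) :=
  g_sigma_algebraType (\bigcup_j preimage_set_system setT (F j) measurable).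

Lemma measurable_sigma_rv_type (J : Type) (F : J -> T -> R) j :
  measurable_fun [set: sigma_rv_type F] (F j : sigma_rv_type F -> R).
Proof.
move=> _ B mB; rewrite setTI; apply: sub_sigma_algebra.
by exists j => //; exists B => //; rewrite setTI.
Qed.

Lemma sigma_rv_preimage (J : Type) (F : J -> T -> R) (X : T -> R) (B : set R) :
  measurable_fun [set: sigma_rv_type F] (X : sigma_rv_type F -> R) ->
  measurable B -> sigma_rv F (X @^-1` B).
Proof. by move=> mX mB; rewrite -[X @^-1` B]setTI; exact: (mX measurableT). Qed.

Lemma sigma_rv_measurable (J : Type) (F : J -> T -> R) (A : set T) :
  (forall j, measurable_fun setT (F j)) -> sigma_rv F A -> measurable A.
Proof.
move=> mF; apply: smallest_sub; first exact: sigma_algebra_measurable.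
by move=> _ [j _ [B mB <-]]; exact: mF.
Qed.

Lemma mutually_independent_rvs (P : probability T R) (I : finType)
    (G : I -> set (set T)) (X : I -> T -> R) :
  mutually_independent P G ->
  (forall i (B : set R), measurable B -> G i (X i @^-1` B)) ->
  independent_rvs P X.
Proof.
move=> iG GX A mA.
have := iG [set: I]%SET (fun i => X i @^-1` A i) (fun i _ => GX i _ (mA i)).
rewrite (_ : [set` [set: I]%SET] = [set: I]); last first.
  by apply/seteqP; split => // i _ /=; rewrite inE.
by move=> ->; apply: eq_bigl => i; rewrite inE.
Qed.

End GeneratedSigmaAlgebra.

Section GaussianTail.
Context {R : realType} {disp : measure_display} {T : measurableType disp}.
Variable P : probability T R.

(* Cramer's change of measure: tilting by [exp (2 t X)] puts the mass of [X]
   near [2 t], and the moment generating function at [t] and [3 t] bounds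
   the contributions of [X < t] and [X > 3 t]. *)
Lemma mgf_lower_tail (X : T -> R) (t : R) : measurable_fun setT X ->
  (forall s, (\int[P]_w (expR (s * X w))%:E = (expR (s ^+ 2 / 2))%:E)%E) ->
  2 <= t -> ((expR (- (4 * t ^+ 2)) / 2)%:E <= P [set w | (t <= X w)%R])%E.
Proof.
move=> mX mgf t2; have t0 : 0 <= t by rewrite (le_trans _ t2).
set A := [set w | t <= X w].
have mexp s : measurable_fun setT (fun w => (expR (s * X w))%:E).
  by apply/measurable_EFinP; apply: measurableT_comp => //; exact: measurable_funM.
have mA : measurable A.
  rewrite (_ : A = X @^-1` `[t, +oo[); last first.
    by apply/seteqP; split => w /=; rewrite in_itv/= andbT.
  by rewrite -[X in measurable X]setTI; exact: mX.
(* Each of the ranges [X < t], [t <= X <= 3 t] and [X > 3 t] is served by one term. Both tail terms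
   have mean [expR (3 / 2 * t ^+ 2)]. *)
have pt (w : T) : expR (2 * t * X w) <=
    expR (6 * t ^+ 2) * \1_A w +
    (expR (t ^+ 2) * expR (t * X w) +
     expR (- (3 * t ^+ 2)) * expR (3 * t * X w)).
  have e0 (x : R) := expR_ge0 x.
  rewrite indicE -!expRD; have [Xt|tX] := ltP (X w) t.
    rewrite ler_wpDl// ?mulr_ge0// ler_wpDr// ler_expR.
    by rewrite -subr_ge0 (_ : _ - _ = t * (t - X w)); [rewrite mulr_ge0// subr_ge0 ltW|ring].
  rewrite mem_set//= mulr1; have [Xt|tX'] := leP (X w) (3 * t).
    rewrite ler_wpDr// ?addr_ge0// ler_expR.
    by rewrite -subr_ge0 (_ : _ - _ = 2 * t * (3 * t - X w)); [rewrite !mulr_ge0// subr_ge0|ring].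
  rewrite ler_wpDl// ler_wpDl// ler_expR.
  by rewrite -subr_ge0 (_ : _ - _ = t * (X w - 3 * t)); [rewrite !mulr_ge0// subr_ge0 ltW|ring].
have : (\int[P]_w (expR (2 * t * X w))%:E <=
  \int[P]_w (((expR (6 * t ^+ 2))%:E * (\1_A w)%:E) +
    (((expR (t ^+ 2))%:E * (expR (t * X w))%:E) +
     ((expR (- (3 * t ^+ 2)))%:E * (expR (3 * t * X w))%:E))))%E.
  apply: ge0_le_integral => //.
  - apply: emeasurable_funD; first by apply/measurable_EFinP/measurable_funM.
    by apply: emeasurable_funD; apply: emeasurable_funM.
  - by move=> w _; rewrite -!EFinM -!EFinD lee_fin.
have posI w : 0 <= (\1_A w : R) by rewrite indicE.
have mI : measurable_fun setT (fun w => (\1_A w : R)%:E).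
  exact/measurable_EFinP.
rewrite ge0_integralD//; try first [exact: emeasurable_funM
  | by apply: emeasurable_funD; apply: emeasurable_funM
  | by move=> w _; rewrite ?adde_ge0 ?mule_ge0// lee_fin expR_ge0].
rewrite ge0_integralD//; try first [exact: emeasurable_funM
  | by move=> w _; rewrite mule_ge0// lee_fin expR_ge0].
rewrite !ge0_integralZl//; try by [rewrite lee_fin expR_ge0|move=> w _; rewrite lee_fin expR_ge0].
rewrite integral_indic// setIT !mgf -!EFinM -EFinD.
have Pf : P A = (fine (P A))%:E.
  by rewrite fineK// fin_num_measure.
rewrite -[X in (_ * X + _)%E]/(P A) Pf -EFinM -EFinD !lee_fin.
set p := fine _; rewrite -!expRD.
rewrite (_ : (2 * t) ^+ 2 / 2 = 2 * t ^+ 2); last by field.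
rewrite (_ : t ^+ 2 + t ^+ 2 / 2 = 3 / 2 * t ^+ 2); last by field.
rewrite (_ : - (3 * t ^+ 2) + (3 * t) ^+ 2 / 2 = 3 / 2 * t ^+ 2); last by field.
move=> H.
(* The two tails together take at most half of the tilted mass; [2 <= t] enters here, through
   [4 <= expR 2]. *)
have E1 : 4 * expR (3 / 2 * t ^+ 2) <= expR (2 * t ^+ 2).
  rewrite (_ : 2 * t ^+ 2 = t ^+ 2 / 2 + 3 / 2 * t ^+ 2); last by field.
  rewrite expRD ler_wpM2r ?expR_ge0//.
  have t4 : 2 <= t ^+ 2 / 2 by nra.
  apply: (@le_trans _ _ (expR (1 + 1))); last by rewrite ler_expR (le_trans _ t4).
  have e2 : (2 : R) <= expR 1 by apply: (le_trans _ (expR_ge1Dx 1)); lra.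
  by rewrite expRD; nra.
have E2 : expR (2 * t ^+ 2) / 2 <= expR (6 * t ^+ 2) * p by lra.
rewrite -(ler_pM2l (expR_gt0 (6 * t ^+ 2))) (le_trans _ E2)//.
rewrite mulrA -expRD (_ : 6 * t ^+ 2 - 4 * t ^+ 2 = 2 * t ^+ 2)//.
by ring.
Qed.

End GaussianTail.

(** * Euclidean norm and Gaussian vectors *)

Section Euclidean.
Context {R : realType}.

Lemma dotp_mxE d (u w : 'rV[R]_d) : dotp u w = (u *m w^T) 0 0.
Proof. by rewrite /dotp !mxE; apply: eq_bigr => l _; rewrite !mxE. Qed.

Lemma dotpC d (u w : 'rV[R]_d) : dotp u w = dotp w u.
Proof. by apply: eq_bigr => l _; rewrite mulrC. Qed.

Lemma dotpDl d (u1 u2 w : 'rV[R]_d) : dotp (u1 + u2) w = dotp u1 w + dotp u2 w.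
Proof. by rewrite !dotp_mxE mulmxDl mxE. Qed.

Lemma dotpZl d a (u w : 'rV[R]_d) : dotp (a *: u) w = a * dotp u w.
Proof. by rewrite !dotp_mxE -scalemxAl mxE. Qed.

Lemma dotpNl d (u w : 'rV[R]_d) : dotp (- u) w = - dotp u w.
Proof. by rewrite -scaleN1r dotpZl mulN1r. Qed.

Lemma dotpBl d (u1 u2 w : 'rV[R]_d) : dotp (u1 - u2) w = dotp u1 w - dotp u2 w.
Proof. by rewrite dotpDl dotpNl. Qed.

Lemma dotp0l d (w : 'rV[R]_d) : dotp 0 w = 0.
Proof. by rewrite -[X in dotp X](scale0r 0) dotpZl mul0r. Qed.

Lemma dotpDr d (u1 u2 w : 'rV[R]_d) : dotp w (u1 + u2) = dotp w u1 + dotp w u2.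
Proof. by rewrite dotpC dotpDl !(dotpC w). Qed.

Lemma dotpZr d a (u w : 'rV[R]_d) : dotp w (a *: u) = a * dotp w u.
Proof. by rewrite dotpC dotpZl (dotpC w). Qed.

Lemma dotpNr d (u w : 'rV[R]_d) : dotp w (- u) = - dotp w u.
Proof. by rewrite dotpC dotpNl (dotpC w). Qed.

Lemma dotpBr d (u1 u2 w : 'rV[R]_d) : dotp w (u1 - u2) = dotp w u1 - dotp w u2.
Proof. by rewrite dotpDr dotpNr. Qed.

Lemma dotp0r d (w : 'rV[R]_d) : dotp w 0 = 0.
Proof. by rewrite dotpC dotp0l. Qed.

Lemma dotp_suml d (I : Type) (s : seq I) (A : pred I) (u : I -> 'rV[R]_d) w :
  dotp (\sum_(i <- s | A i) u i) w = \sum_(i <- s | A i) dotp (u i) w.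
Proof.
by apply: (big_morph (fun u => dotp u w)) => [x y|]; [exact: dotpDl|exact: dotp0l].
Qed.

Lemma dotp_sumr d (I : Type) (s : seq I) (A : pred I) (u : I -> 'rV[R]_d) w :
  dotp w (\sum_(i <- s | A i) u i) = \sum_(i <- s | A i) dotp w (u i).
Proof. by rewrite dotpC dotp_suml; apply: eq_bigr => i _; rewrite dotpC. Qed.

Lemma dotp_mulmx d r (z : 'rV[R]_r) (A : 'M[R]_(r, d)) w :
  dotp (z *m A) w = dotp z (w *m A^T).
Proof. by rewrite !dotp_mxE trmx_mul trmxK mulmxA. Qed.

Lemma dotp_ge0 d (u : 'rV[R]_d) : 0 <= dotp u u.
Proof. by apply: sumr_ge0 => l _; rewrite -expr2 sqr_ge0. Qed.

Lemma dotp_eq0 d (u : 'rV[R]_d) : dotp u u = 0 -> u = 0.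
Proof.
move/psumr_eq0P => u0; apply/rowP => l; rewrite mxE; apply/eqP.
by rewrite -sqrf_eq0 expr2 u0// => i _; rewrite -expr2 sqr_ge0.
Qed.

Lemma enorm_ge0 d (u : 'rV[R]_d) : 0 <= enorm u.
Proof. exact: sqrtr_ge0. Qed.

Lemma sqr_enorm d (u : 'rV[R]_d) : enorm u ^+ 2 = dotp u u.
Proof. by rewrite /enorm sqr_sqrtr// dotp_ge0. Qed.

Lemma cauchy_schwarz_sqr d (u w : 'rV[R]_d) :
  dotp u w ^+ 2 <= dotp u u * dotp w w.
Proof.
have [w0|wn0] := eqVneq (dotp w w) 0.
  by rewrite (dotp_eq0 w0) !dotp0r mulr0 expr0n.
have wpos : 0 < dotp w w by rewrite lt_neqAle eq_sym wn0 dotp_ge0.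
have := dotp_ge0 (u - (dotp u w / dotp w w) *: w).
rewrite dotpBl !dotpBr !dotpZl !dotpZr (dotpC w u) => H.
have : 0 <= (dotp u u - dotp u w ^+ 2 / dotp w w) * dotp w w.
  apply: mulr_ge0; last exact: ltW.
  by apply: le_trans H _; rewrite le_eqVlt; apply/orP; left; apply/eqP; field.
by rewrite mulrBl divfK// subr_ge0.
Qed.

Lemma cauchy_schwarz d (u w : 'rV[R]_d) : `|dotp u w| <= enorm u * enorm w.
Proof.
rewrite -[leLHS]sqrtr_sqr /enorm -sqrtrM ?dotp_ge0// ler_sqrt; last first.
  by rewrite mulr_ge0 ?dotp_ge0.
exact: cauchy_schwarz_sqr.
Qed.

Lemma ler_enormD d (u w : 'rV[R]_d) : enorm (u + w) <= enorm u + enorm w.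
Proof.
rewrite -(ler_pXn2r (ltn0Sn 1)) ?nnegrE ?addr_ge0 ?enorm_ge0//.
rewrite sqr_enorm dotpDl !dotpDr (dotpC w u) sqrrD !sqr_enorm.
have := le_trans (ler_norm _) (cauchy_schwarz u w); lra.
Qed.

Lemma enormZ d a (u : 'rV[R]_d) : enorm (a *: u) = `|a| * enorm u.
Proof.
by rewrite /enorm dotpZl dotpZr mulrA -expr2 sqrtrM ?sqr_ge0// sqrtr_sqr.
Qed.

Lemma enormN d (u : 'rV[R]_d) : enorm (- u) = enorm u.
Proof. by rewrite -scaleN1r enormZ normrN1 mul1r. Qed.

Lemma enorm0 d : enorm (0 : 'rV[R]_d) = 0.
Proof. by rewrite /enorm dotp0l sqrtr0. Qed.

Lemma enorm_eq0 d (u : 'rV[R]_d) : enorm u = 0 -> u = 0.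
Proof. by move=> u0; apply: dotp_eq0; rewrite -sqr_enorm u0 expr0n. Qed.

Lemma ler_enorm_sum d (I : Type) (s : seq I) (A : pred I) (u : I -> 'rV[R]_d) :
  enorm (\sum_(i <- s | A i) u i) <= \sum_(i <- s | A i) enorm (u i).
Proof.
elim/big_ind2 : _ => [|x a y b xa yb|//]; first by rewrite enorm0.
by rewrite (le_trans (ler_enormD _ _))// lerD.
Qed.

End Euclidean.

Section BoxSigmaAlgebra.
Context {R : realType}.

(** Generators of the product sigma-algebra on row vectors. Being closed under intersection they
    determine a law, and on them independence gives it as a product. They serve to compare a
    Gaussian vector with its opposite on the nonlinear events that a network defines. *)
Definition boxes (r : nat) : set (set 'rV[R]_r) :=
  [set E | exists2 A : 'I_r -> set R, (forall l, measurable (A l)) &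
    E = [set z : 'rV[R]_r | forall l, A l (z 0 l)]].

Definition box_type (r : nat) := g_sigma_algebraType (@boxes r).

Lemma boxes_setI_closed r : setI_closed (@boxes r).
Proof.
move=> _ _ [A mA ->] [B mB ->]; exists (fun l => A l `&` B l).
  by move=> l; exact: measurableI.
by apply/seteqP; split => z /= => [[Az Bz] l|ABz]; [|split => l; have [] := ABz l].
Qed.

Lemma measurable_box_coord r (l : 'I_r) :
  measurable_fun [set: box_type r] (fun z : box_type r => (z : 'rV[R]_r) 0 l).
Proof.
move=> _ B mB; rewrite setTI; apply: sub_sigma_algebra.
exists (fun i => if i == l then B else setT) => [i|].
  by case: ifP.
apply/seteqP; split => z /=; last by move=> /(_ l); rewrite eqxx.
by move=> Bz i; case: ifPn => // /eqP->.
Qed.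

Lemma measurable_to_box d (T : measurableType d) r (F : T -> 'rV[R]_r) :
  (forall l, measurable_fun setT (fun w => F w 0 l)) ->
  measurable_fun setT (F : T -> box_type r).
Proof.
move=> mF; apply: (@measurability _ _ T (box_type r) setT F (@boxes r)) => [//|].
move=> _ [_ [A mA ->] <-]; rewrite setTI.
rewrite (_ : _ @^-1` _ = \bigcap_(l in [set: 'I_r]) (fun w => F w 0 l) @^-1` A l).
  apply: fin_bigcap_measurable => // l _.
  by rewrite -[X in measurable X]setTI; exact: mF.
by apply/seteqP; split => w /= h l => [_|]; exact: h.
Qed.

End BoxSigmaAlgebra.

Section AlmostEverywhere.
Context {R : realType} {disp : measure_display} {T : measurableType disp}.
Variable P : probability T R.

Lemma ae_eq_probability (A B : set T) : measurable A -> measurable B ->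
  {ae P, forall w, A w <-> B w} -> P A = P B.
Proof.
move=> mA mB AB; rewrite -[A]setIT -[B]setIT -!integral_indic//.
apply: ge0_ae_eq_integral => //; try exact/measurable_EFinP/measurable_indic.
apply: filterS AB => w AB _; congr EFin; rewrite !indicE.
by congr (nat_of_bool _)%:R; apply/idP/idP; rewrite !inE => /AB.
Qed.

Lemma ae_le_probability (A B : set T) : measurable A -> measurable B ->
  {ae P, forall w, A w -> B w} -> (P A <= P B)%E.
Proof.
move=> mA mB AB; have mAB : measurable (A `&` B) by exact: measurableI.
rewrite (@ae_eq_probability A (A `&` B))//.
  by apply: le_measure; rewrite ?inE//; exact: subIsetr.
by apply: filterS AB => w AB; split => [Aw|[]//]; split => //; exact: AB.
Qed.

End AlmostEverywhere.

Section NormalVector.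
Context {R : realType} {disp : measure_display} {T : measurableType disp}.
Variable P : probability T R.
Variables (d : nat) (S : 'M[R]_d) (Z : T -> 'rV[R]_d).
Hypothesis ZS : normal_vec P S Z.

Lemma measurable_normal_vec_dotp (z : 'rV[R]_d) :
  measurable_fun setT (fun w => dotp z (Z w)).
Proof.
by apply: measurable_sum => l; apply: measurable_funM => //; exact: ZS.1.
Qed.

(** With [c = z *m A^T] the squared norm of [c] is the variance in direction [z]; no inverse of [S]
    appears, so a singular covariance causes no trouble. *)
Lemma normal_vec_dotp (z : 'rV[R]_d) : exists r (c : 'rV[R]_r) (g : 'I_r -> T -> R),
  [/\ dotp c c = dotp (z *m S) z, forall l, std_normal P (g l),
      independent_rvs P g,
      independent_rvs P (fun l w => c 0 l * g l w) &
      {ae P, forall w, dotp z (Z w) = \sum_l c 0 l * g l w}].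
Proof.
case: ZS => _ [r [A [g [AS mg lg ig Zg]]]].
exists r, (z *m A^T), (coords g); split.
- by rewrite dotp_mulmx trmxK -mulmxA AS dotpC.
- by move=> l; split; [exact: mg|exact: lg].
- apply: mutually_independent_rvs ig _ => l B mB.
  by apply: sigma_rv_preimage mB; exact: measurable_sigma_rv_type tt.
- apply: mutually_independent_rvs ig _ => l B mB.
  apply: (@sigma_rv_preimage _ _ _ _ _ (fun w => (z *m A^T) 0 l * coords g l w) _ _ mB).
  apply: measurable_funM => //.
  exact: (@measurable_sigma_rv_type _ _ _ _ (fun _ : unit => coords g l) tt).
- by apply: filterS Zg => w ->; rewrite dotpC dotp_mulmx dotpC.
Qed.

(** The phase covers the sine as well: at [theta = - (pi / 2)] the right-hand side vanishes. *)
Lemma normal_vec_cos (z : 'rV[R]_d) theta :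
  \int[P]_w cos (theta + dotp z (Z w)) =
  cos theta * expR (- dotp (z *m S) z / 2).
Proof.
have [r [c [g [cE gN ig icg Zg]]]] := normal_vec_dotp z.
have mcos : measurable_fun setT (cos : R -> R).
  by apply: continuous_measurable_fun; exact: continuous_cos.
have mcg l : measurable_fun setT (fun w => c 0 l * g l w).
  by apply: measurable_funM => //; exact: (gN l).1.
transitivity (\int[P]_w cos (theta + \sum_l c 0 l * g l w)).
  congr fine; apply: ae_eq_integral => //.
  - apply/measurable_EFinP; apply: measurableT_comp => //.
    by apply: measurable_funD => //; exact: measurable_normal_vec_dotp.
  - apply/measurable_EFinP; apply: measurableT_comp => //.
    by apply: measurable_funD => //; exact: measurable_sum.
  - by apply: filterS Zg => w -> _.
rewrite (expectation_cos_sum (r := fun l => expR (- (c 0 l) ^+ 2 / 2)))//.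
- rewrite -expR_sum; congr (_ * expR _).
  rewrite -mulr_suml -cE sumrN; congr (- _ / _).
- by move=> l; exact: expectation_cos_normal.
- by move=> l; exact: expectation_sin_normal.
Qed.

Lemma normal_vec_mgf (z : 'rV[R]_d) :
  (\int[P]_w (expR (dotp z (Z w)))%:E = (expR (dotp (z *m S) z / 2))%:E)%E.
Proof.
have [r [c [g [cE gN ig icg Zg]]]] := normal_vec_dotp z.
have mcg l : measurable_fun setT (fun w => c 0 l * g l w).
  by apply: measurable_funM => //; exact: (gN l).1.
transitivity (\int[P]_w (expR (\sum_l c 0 l * g l w))%:E)%E.
  apply: ae_eq_integral => //.
  - apply/measurable_EFinP; apply: measurableT_comp => //.
    exact: measurable_normal_vec_dotp.
  - apply/measurable_EFinP; apply: measurableT_comp => //.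
    exact: measurable_sum.
  - by apply: filterS Zg => w -> _.
rewrite expectation_exp_sum//; last first.
  by move=> l; rewrite std_normal_mgf// ltry.
under eq_bigr do rewrite std_normal_mgf//.
rewrite prodEFin -expR_sum -mulr_suml -cE; congr (expR (_ / _))%:E.
Qed.

(** Scaling by [- (Num.sqrt q)^-1] gives a variable with the standard moment generating function, to
    which [mgf_lower_tail] applies. For the noise covariance the case [q = 0] occurs when [z] is
    parallel to [v]; the variable is then almost surely 0 and the event almost sure. *)
Lemma normal_vec_lower_tail (z : 'rV[R]_d) t : 2 <= t ->
  ((expR (- (4 * t ^+ 2)) / 2)%:E <=
   P [set w | (dotp z (Z w) <= - (t * Num.sqrt (dotp (z *m S) z)))%R])%E.
Proof.
move=> t2; set q := dotp (z *m S) z.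
have mz := measurable_normal_vec_dotp z.
have mA x : measurable [set w | dotp z (Z w) <= x].
  rewrite (_ : [set w | _] = (fun w => dotp z (Z w)) @^-1` `]-oo, x]); last first.
    by apply/seteqP; split => w /=; rewrite in_itv.
  by rewrite -[X in measurable X]setTI; exact: mz.
have q0 : 0 <= q.
  have [r [c [g [cE _ _ _ _]]]] := normal_vec_dotp z.
  by rewrite /q -cE dotp_ge0.
have [q1|q1] := eqVneq q 0.
  rewrite q1 sqrtr0 mulr0 oppr0.
  have [r [c [g [cE _ _ _ Zg]]]] := normal_vec_dotp z.
  have c0 : c = 0 by apply: dotp_eq0; rewrite cE.
  rewrite (@ae_eq_probability _ _ _ P _ setT)//.
    rewrite probability_setT lee_fin.
    have : expR (- (4 * t ^+ 2)) <= 1 by rewrite -[leRHS]expR0 ler_expR; nra.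
    by lra.
  apply: filterS Zg => w /= ->; split => // _.
  by rewrite big1// => l _; rewrite c0 mxE mul0r.
have sq0 : 0 < Num.sqrt q by rewrite sqrtr_gt0 lt_neqAle eq_sym q1.
pose X w := dotp (- (Num.sqrt q)^-1 *: z) (Z w).
have := @mgf_lower_tail _ _ _ P X t (measurable_normal_vec_dotp _).
rewrite (_ : [set w | t <= X w] = [set w | dotp z (Z w) <= - (t * Num.sqrt q)]); last first.
  apply: eq_set => w; rewrite /X dotpZl mulNr lerNr mulrC ler_pdivrMr//.
  by rewrite mulNr.
apply => //.
move=> s; rewrite /X; under eq_integral do rewrite -dotpZl scalerA.
rewrite normal_vec_mgf -scalemxAl dotpZl dotpZr -/q; congr (expR _)%:E.
have -> : s * - (Num.sqrt q)^-1 * (s * - (Num.sqrt q)^-1 * q) =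
    s ^+ 2 * ((Num.sqrt q) ^- 2 * q) by field; rewrite gt_eqF.
by rewrite sqr_sqrtr// mulVf// mulr1.
Qed.

(** On boxes the laws of [g] and [- g] are products of symmetric laws, and boxes determine them; [Z]
    is almost surely a linear image of [g]. *)
Lemma normal_vec_symmetric (B : set (@box_type R d)) : measurable B ->
  P (Z @^-1` B) = P ((fun w => - Z w) @^-1` B).
Proof.
move=> mB; have [mZ [r [A [g [AS mg lg ig Zg]]]]] := ZS.
have mg1 : measurable_fun setT (g : T -> @box_type R r) by exact: measurable_to_box.
have mg2 : measurable_fun setT ((fun w => - g w) : T -> @box_type R r).
  apply: measurable_to_box => l; rewrite (_ : (fun w => _) = \- coords g l).
    exact: measurable_funN.
  by apply/funext => w; rewrite mxE.
have gN l : std_normal P (coords g l) by split; [exact: mg|exact: lg].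
have ind (s : R) : independent_rvs P (fun l w => s * coords g l w).
  apply: mutually_independent_rvs ig _ => l C mC.
  apply: (@sigma_rv_preimage _ _ _ _ _ (fun w => s * coords g l w) _ _ mC).
  apply: measurable_funM => //.
  exact: (@measurable_sigma_rv_type _ _ _ _ (fun _ : unit => coords g l) tt).
have eqg (C : set (@box_type R r)) : measurable C ->
    P (g @^-1` C) = P ((fun w => - g w) @^-1` C).
  move=> mC.
  pose G1 : {mfun T >-> @box_type R r} :=
    HB.pack (g : T -> @box_type R r) (isMeasurableFun.Build _ _ _ _ _ mg1).
  pose G2 : {mfun T >-> @box_type R r} :=
    HB.pack ((fun w => - g w) : T -> @box_type R r)
      (isMeasurableFun.Build _ _ _ _ _ mg2).
  rewrite -[LHS]/(distribution P G1 C) -[RHS]/(distribution P G2 C).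
  apply: (@measure_unique _ R (@box_type R r) (@boxes R r) (fun=> setT) erefl
    (@boxes_setI_closed R r) _ _ (distribution P G1) (distribution P G2) _ _ C mC).
  - by move=> _; exists (fun=> setT) => //; apply/seteqP.
  - by rewrite bigcup_const.
  - move=> _ [D mD ->]; pose E := [set z : 'rV[R]_r | forall l, D l (z 0 l)].
    rewrite -[LHS]/(P (g @^-1` E)) -[RHS]/(P ((fun w => - g w) @^-1` E)).
    rewrite (_ : g @^-1` E =
        \bigcap_(l in [set: 'I_r]) (fun w => 1 * coords g l w) @^-1` D l).
      rewrite (_ : (fun w => - g w) @^-1` E =
          \bigcap_(l in [set: 'I_r]) (fun w => -1 * coords g l w) @^-1` D l).
        rewrite !ind//; apply: eq_bigr => l _.
        have [_ lN] := std_normalN (gN l).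
        under [X in P (X @^-1` _)]eq_fun do rewrite mul1r.
        under [X in _ = P (X @^-1` _)]eq_fun do rewrite mulN1r.
        by rewrite (gN l).2// -lN.
      apply/seteqP; split => w /= h l => [_|].
        by rewrite /= mulN1r; have := h l; rewrite mxE.
      by have := h l I; rewrite /= mulN1r mxE.
    apply/seteqP; split => w /= h l => [_|].
      by rewrite /= mul1r; exact: h.
    by have := h l I; rewrite /= mul1r.
  - by move=> _; rewrite (le_lt_trans (probability_le1 _ _))// ltry.
have mA : measurable_fun setT ((fun z => z *m A) : @box_type R r -> @box_type R d).
  apply: measurable_to_box => l.
  rewrite (_ : (fun w => _) = fun w : @box_type R r =>
    \sum_i (w : 'rV[R]_r) 0 i * A i l); last by apply/funext => w; rewrite mxE.
  by apply: measurable_sum => i; apply: measurable_funM => //; exact: measurable_box_coord.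
have mZ1 : measurable_fun setT (Z : T -> @box_type R d) by exact: measurable_to_box.
have mZ2 : measurable_fun setT ((fun w => - Z w) : T -> @box_type R d).
  apply: measurable_to_box => l; rewrite (_ : (fun w => _) = \- coords Z l).
    by apply: measurable_funN; exact: mZ.
  by apply/funext => w; rewrite mxE.
pose C := (fun z : @box_type R r => z *m A) @^-1` B.
have mC : measurable C by rewrite /C -[X in measurable X]setTI; exact: mA.
transitivity (P (g @^-1` C)).
  apply: ae_eq_probability.
  - by rewrite -[X in measurable X]setTI; exact: mZ1.
  - by rewrite -[X in measurable X]setTI; exact: mg1.
  - by apply: filterS Zg => w; rewrite /C /= => ->.
rewrite eqg//; apply: ae_eq_probability.
- by rewrite -[X in measurable X]setTI; exact: mg2.
- by rewrite -[X in measurable X]setTI; exact: mZ2.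
- by apply: filterS Zg => w; rewrite /C /= mulNmx => ->.
Qed.

End NormalVector.

(** * Comparison of exp and cos with polynomials *)

Section ElementaryBounds.
Context {R : realType}.

(** [expR y] is at least [(1 + y / 2) ^+ 2], and [3 / 4] is the coefficient that cancels the
    quadratic term in the product of this bound with the right-hand side, leaving 1 plus nonnegative
    terms. *)
Lemma expRN_le (y : R) : 0 <= y -> expR (- y) <= 1 - y + 3 / 4 * y ^+ 2.
Proof.
move=> y0; have e1 : 1 + y + y ^+ 2 / 4 <= expR y.
  rewrite (_ : y = y / 2 + y / 2); last by field.
  rewrite expRD; have h := expR_ge1Dx (y / 2).
  have p : 0 <= 1 + y / 2 by rewrite addr_ge0// divr_ge0.
  by apply: le_trans (ler_pM p p h h); rewrite le_eqVlt; apply/orP; left; apply/eqP; field.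
rewrite expRN -div1r ler_pdivrMr ?expR_gt0//.
have p : 0 <= 1 - y + 3 / 4 * y ^+ 2 by nra.
apply: le_trans (ler_wpM2l p e1); nra.
Qed.

Lemma norm_sin_le (x : R) : `|sin x| <= `|x|.
Proof.
have h (y : R) : 0 < y -> `|sin y| <= y.
  move=> y0; have [c _] := @MVT R sin cos 0 y y0 (fun z _ => is_derive_sin z)
    (continuous_subspaceT (@continuous_sin R)).
  rewrite sin0 !subr0 => ->; rewrite normrM (gtr0_norm y0).
  apply: ler_piMl; first exact: ltW.
  by rewrite ler_norml cos_geN1 cos_le1.
have [x0|x0|->] := ltrgt0P x; first exact: h.
  by rewrite -normrN -sinN h// oppr_gt0.
by rewrite sin0 normr0.
Qed.

Lemma cos_ge1BX2 (x : R) : 1 - x ^+ 2 / 2 <= cos x.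
Proof.
rewrite [in leRHS](_ : x = x / 2 + x / 2); last by field.
rewrite cosD -!expr2 cos2sin2.
have := norm_sin_le (x / 2); rewrite -(ler_pXn2r (ltn0Sn 1)) ?nnegrE//.
rewrite !real_normK ?num_real// => h.
have -> : x ^+ 2 / 2 = 2 * (x / 2) ^+ 2 by field.
lra.
Qed.

(** With [p = x ^+ 2], the bound [1 - p + 3 / 4 * p ^+ 2] is below [1 - p / 2] as long as
    [p <= 2 / 3]. *)
Lemma cos_ge_gauss (x : R) : x ^+ 2 <= 2 / 3 -> expR (- x ^+ 2) <= cos x.
Proof.
move=> x1; apply: le_trans (cos_ge1BX2 x).
have p := sqr_ge0 x; have := expRN_le p; nra.
Qed.

End ElementaryBounds.

(** * Conditioning of the noise matrix *)

Section RandomWalkAverage.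
Context {R : realType}.
Variable b : R.

(** The mean of [f] at the end of a symmetric [M]-step walk from [x]. It stands in for a Gaussian
    average: being a finite sum it commutes with the expectation over the data by linearity, and it
    maps cosines to multiples of themselves. *)
Fixpoint walk_mean (M : nat) (f : R -> R) (x : R) : R :=
  if M is M'.+1 then (walk_mean M' f (x + b) + walk_mean M' f (x - b)) / 2
  else f x.

Lemma walk_mean_le M f g x :
  (forall y, f y <= g y) -> walk_mean M f x <= walk_mean M g x.
Proof.
by move=> fg; elim: M x => //= M IH x; rewrite ler_pM2r ?invr_gt0// lerD.
Qed.

Lemma walk_meanZ M c f x : walk_mean M (fun y => c * f y) x = c * walk_mean M f x.
Proof. by elim: M x => //= M IH x; rewrite !IH; field. Qed.

Lemma walk_mean_cos M c a z x :
  walk_mean M (fun y => c * cos (a + y * z)) x =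
  c * cos (b * z) ^+ M * cos (a + x * z).
Proof.
elim: M x => [|M IH] x /=; first by rewrite expr0 mulr1.
rewrite !IH (mulrDl x b z) (mulrBl z x b) !addrA; set u := a + x * z.
by rewrite (cosB u) (cosD u) exprS; field.
Qed.

(** The second and fourth moments of the end point of the walk appear on the right; [x] is arbitrary
    for the sake of the induction. *)
Lemma walk_mean_quartic M (B x : R) :
  walk_mean M (fun y => 1 - B * y ^+ 2 + 3 / 4 * (B * y ^+ 2) ^+ 2) x =
  1 - B * (x ^+ 2 + M%:R * b ^+ 2) + 3 / 4 * B ^+ 2 *
  (x ^+ 4 + 6 * M%:R * b ^+ 2 * x ^+ 2 + (3 * M%:R ^+ 2 - 2 * M%:R) * b ^+ 4).
Proof.
elim: M x => [|M IH] x /=; first by field.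
by rewrite !IH -natr1; field.
Qed.

(** With [s = B * (M%:R * b ^+ 2)] the quartic estimate is at most [1 - s + 9 / 4 * s ^+ 2], which
    is minimal at [s = 2 / 9], with value [8 / 9]. *)
Lemma walk_mean_gauss M (B : R) : 0 <= B -> B * (M%:R * b ^+ 2) = 2 / 9 ->
  walk_mean M (fun y => expR (- (B * y ^+ 2))) 0 <= 8 / 9.
Proof.
move=> B0 BM; apply: (@le_trans _ _ (walk_mean M
    (fun y => 1 - B * y ^+ 2 + 3 / 4 * (B * y ^+ 2) ^+ 2) 0)).
  by apply: walk_mean_le => y; apply: expRN_le; rewrite mulr_ge0 ?sqr_ge0.
rewrite walk_mean_quartic !expr0n/= !mulr0 !add0r BM.
have h : 0 <= B ^+ 2 * (2 * M%:R * b ^+ 4).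
  by rewrite mulr_ge0 ?sqr_ge0// mulr_ge0 ?exprn_even_ge0// mulr_ge0.
have -> : 3 / 4 * B ^+ 2 * ((3 * M%:R ^+ 2 - 2 * M%:R) * b ^+ 4) =
  3 / 4 * (3 * (B * (M%:R * b ^+ 2)) ^+ 2 - B ^+ 2 * (2 * M%:R * b ^+ 4)) by ring.
rewrite BM; lra.
Qed.

Definition coord_mean d M (l : 'I_d) (F : 'rV[R]_d -> R) (h : 'rV[R]_d) : R :=
  walk_mean M (fun y => F (h + y *: delta_mx 0 l)) 0.

Definition coords_mean d M (s : seq 'I_d) (F : 'rV[R]_d -> R) : 'rV[R]_d -> R :=
  foldr (coord_mean M) F s.

Lemma dotp_delta d (l : 'I_d) (z : 'rV[R]_d) : dotp (delta_mx 0 l) z = z 0 l.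
Proof.
rewrite /dotp (bigD1 l)//= mxE !eqxx mul1r big1 ?addr0// => i il.
by rewrite mxE (negbTE il) andbF mul0r.
Qed.

Lemma coords_mean_cos d M (s : seq 'I_d) (z h : 'rV[R]_d) :
  coords_mean M s (fun h => cos (dotp h z)) h =
  (\prod_(l <- s) cos (b * z 0 l) ^+ M) * cos (dotp h z).
Proof.
elim: s h => [|l s IH] h /=; first by rewrite big_nil mul1r.
rewrite /coord_mean.
under [X in walk_mean _ X]eq_fun do rewrite IH dotpDl dotpZl dotp_delta.
by rewrite walk_mean_cos mul0r addr0 big_cons (mulrC (cos _ ^+ M)).
Qed.

(** Since [h] vanishes at the coordinates still to be averaged, moving coordinate [l] by [y] adds
    exactly [y ^+ 2] to the squared norm. The Gaussian bound thus factors, and each coordinate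
    contributes one factor [8 / 9]. *)
Lemma coords_mean_gauss d M (I : {set 'I_d}) (B : R) (G : 'rV[R]_d -> R)
    (s : seq 'I_d) (h : 'rV[R]_d) :
  0 <= B -> B * (M%:R * b ^+ 2) = 2 / 9 ->
  (forall h : 'rV[R]_d, (forall l, l \notin I -> h 0 l = 0) ->
    G h <= expR (- (B * dotp h h))) ->
  uniq s -> {subset s <= I} ->
  (forall l, l \notin I -> h 0 l = 0) -> (forall l, l \in s -> h 0 l = 0) ->
  coords_mean M s G h <= (8 / 9) ^+ size s * expR (- (B * dotp h h)).
Proof.
move=> B0 BM GI; elim: s h => [|l s IH] h /=.
  by move=> _ _ hI _; rewrite expr0 mul1r; exact: GI.
move=> /andP[ls us] sI hI hs.
have hl : h 0 l = 0 by apply: hs; rewrite mem_head.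
rewrite /coord_mean.
apply: (@le_trans _ _ (walk_mean M (fun y =>
  ((8 / 9) ^+ size s * expR (- (B * dotp h h))) * expR (- (B * y ^+ 2))) 0)).
  apply: walk_mean_le => y; rewrite -mulrA -expRD.
  have hE i : (h + y *: delta_mx 0 l) 0 i = h 0 i + y * (i == l)%:R.
    by rewrite !mxE eqxx.
  have -> : - (B * dotp h h) - B * y ^+ 2 =
      - (B * dotp (h + y *: delta_mx 0 l) (h + y *: delta_mx 0 l)).
    rewrite dotpDl !dotpDr !dotpZl !dotpZr (dotpC h) !dotp_delta hl mxE !eqxx/=.
    by ring.
  apply: IH => // [i si|i iI|i si].
  - by apply: sI; rewrite inE si orbT.
  - rewrite hE hI// (_ : i == l = false) ?mulr0 ?addr0//.
    by apply: contraNF iI => /eqP->; apply: sI; rewrite mem_head.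
  - rewrite hE hs ?inE ?si ?orbT// (_ : i == l = false) ?mulr0 ?addr0//.
    by apply: contraNF ls => /eqP<-.
rewrite walk_meanZ exprS -mulrA [leRHS]mulrC.
by rewrite ler_wpM2l ?walk_mean_gauss// mulr_ge0 ?expR_ge0// exprn_ge0.
Qed.

End RandomWalkAverage.

Section MeanExpectation.
Context {R : realType} {disp : measure_display} {T : measurableType disp}.
Variable P : probability T R.
Variable b : R.

Definition bounded_process (V : Type) (F : T -> V -> R) :=
  (forall h, measurable_fun setT (F ^~ h)) /\ (forall w h, `|F w h| <= 1).

Lemma walk_mean_expectation M (F : T -> R -> R) : bounded_process F ->
  bounded_process (fun w => walk_mean b M (F w)) /\
  forall x, \int[P]_w walk_mean b M (F w) x =
            walk_mean b M (fun y => \int[P]_w F w y) x.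
Proof.
move=> [mF bF]; elim: M => [|M [[mW bW] IH]] //=; split; first split.
- by move=> x; apply: measurable_funM => //; apply: measurable_funD.
- move=> w x; rewrite normrM (@ger0_norm _ 2^-1)// ler_pdivrMr// mul1r.
  by rewrite (le_trans (ler_normD _ _))// -[leRHS]/(1 + 1 : R) lerD.
- have iW x : P.-integrable setT (EFin \o (fun w => walk_mean b M (F w) x)).
    by apply: (@integrable_bounded_by _ _ _ _ _ 1) => // w.
  move=> x; rewrite RintegralZr//; last first.
    apply: (@integrable_bounded_by _ _ _ _ _ 2) => [|w].
      exact: measurable_funD.
    by rewrite (le_trans (ler_normD _ _))// -[leRHS]/(1 + 1 : R) lerD.
  by rewrite RintegralD// !IH.
Qed.

Lemma coords_mean_expectation d M (s : seq 'I_d) (F : T -> 'rV[R]_d -> R) :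
  bounded_process F ->
  bounded_process (fun w => coords_mean b M s (F w)) /\
  forall h, \int[P]_w coords_mean b M s (F w) h =
            coords_mean b M s (fun h => \int[P]_w F w h) h.
Proof.
move=> bF; elim: s => [|l s [[mC bC] IH]] //=.
have H h := @walk_mean_expectation M
  (fun w y => coords_mean b M s (F w) (h + y *: delta_mx 0 l))
  (conj (fun y => mC _) (fun w y => bC w _)).
split; first split.
- by move=> h; have [[mW _] _] := H h; exact: mW.
- by move=> w h; have [[_ bW] _] := H h; exact: bW.
- move=> h; rewrite /coord_mean; have [_ ->] := H h.
  by congr walk_mean; apply/funext => y; exact: IH.
Qed.

End MeanExpectation.

Section Restriction.
Context {R : realType} {disp : measure_display} {T : measurableType disp}.
Variable P : probability T R.

Lemma mutually_independent_inr (I J : finType) (G : I + J -> set (set T)) :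
  mutually_independent P G -> mutually_independent P (fun j => G (inr j)).
Proof.
move=> iG K A GA; pose A' (s : I + J) := if s is inr j then A j else setT.
have := iG (inr @: K) A'; rewrite big_imset/=; last by move=> ? ? _ _ [].
rewrite (_ : \bigcap_(i in _) A' i = \bigcap_(i in [set` K]) A i).
  by apply => _ /imsetP[j jK ->]; exact: GA.
apply/seteqP; split => w /= h s; last by move=> /imsetP[j jK ->]; exact: h.
by move=> sK; apply: (h (inr s)); rewrite /= imset_f.
Qed.

Lemma mutually_independent_inl (I J : finType) (G : I + J -> set (set T)) :
  mutually_independent P G -> mutually_independent P (fun i => G (inl i)).
Proof.
move=> iG K A GA; pose A' (s : I + J) := if s is inl j then A j else setT.
have := iG (inl @: K) A'; rewrite big_imset/=; last by move=> ? ? _ _ [].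
rewrite (_ : \bigcap_(i in _) A' i = \bigcap_(i in [set` K]) A i).
  by apply => _ /imsetP[j jK ->]; exact: GA.
apply/seteqP; split => w /= h s; last by move=> /imsetP[j jK ->]; exact: h.
by move=> sK; apply: (h (inl s)); rewrite /= imset_f.
Qed.

End Restriction.

Section HalfMass.
Context {R : realType}.

(** Of two complementary halves of the coordinates, one carries at most half of the mass of [v]. For
    [h] supported there, [<h, v>^2 <= |h|^2 / 2], so the noise covariance, degenerate along [v], is
    bounded below on such [h]. The factor 3 is what rounding [d / 2] down costs when [d >= 2]. *)
Lemma half_mass_coords d (v : 'rV[R]_d) : (1 < d)%N -> dotp v v = 1 ->
  exists I : {set 'I_d}, (d <= 3 * #|I|)%N /\ \sum_(l in I) v 0 l ^+ 2 <= 2^-1.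
Proof.
move=> d1 v1; have hd : (d./2 <= d)%N by lia.
pose J := [set widen_ord hd i | i in [set: 'I_(d./2)]]%SET.
have cJ : #|J| = d./2.
  by rewrite card_imset ?cardsT ?card_ord// => i j /(congr1 val) /= /val_inj.
have cJC : #|~: J| = (d - d./2)%N by have := cardsC J; rewrite cJ card_ord; lia.
have JJC : \sum_(l in J) v 0 l ^+ 2 + \sum_(l in ~: J) v 0 l ^+ 2 = 1.
  rewrite -v1 /dotp [RHS](bigID (mem J))/=; congr (_ + _).
  by apply: eq_bigl => l; rewrite inE.
have [h|h] := leP (\sum_(l in J) v 0 l ^+ 2) 2^-1.
  by exists J; split => //; rewrite cJ; lia.
by exists (~: J); split; [rewrite cJC; lia|lra].
Qed.

Lemma noise_cov_quad d (v z : 'rV[R]_d) :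
  dotp (z *m noise_cov v) z = d%:R^-1 * (dotp z z - dotp z v ^+ 2).
Proof.
rewrite /noise_cov -scalemxAr dotpZl mulmxBr mulmx1 dotpBl; congr (_ * (_ - _)).
by rewrite mulmxA [z *m v^T]mx11_scalar mul_scalar_mx dotpZl -dotp_mxE (dotpC v) expr2.
Qed.

End HalfMass.

Section NoiseMatrix.
Context {R : realType} {disp : measure_display} {T : measurableType disp}.
Variable P : probability T R.
Variables (d n : nat) (v : 'rV[R]_d) (N : 'I_n -> T -> 'rV[R]_d).
Hypothesis v1 : dotp v v = 1.
Hypothesis NN : forall i, normal_vec P (noise_cov v) (N i).
Hypothesis iN : mutually_independent P (fun i => sigma_rv (coords (N i))).

Let mN i l : measurable_fun setT (fun w => N i w 0 l).
Proof. exact: (NN i).1. Qed.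

Lemma independent_noise_dotp (z : 'I_n -> 'rV[R]_d) :
  independent_rvs P (fun i w => dotp (z i) (N i w)).
Proof.
apply: mutually_independent_rvs iN _ => i B mB.
apply: (@sigma_rv_preimage _ _ _ _ _ (fun w => dotp (z i) (N i w)) _ _ mB).
apply: measurable_sum => l; apply: measurable_funM => //.
exact: (@measurable_sigma_rv_type _ _ _ _ (coords (N i)) l).
Qed.

Definition noise_comb (c : 'rV[R]_n) w := \sum_i c 0 i *: N i w.

Lemma dotp_noise_comb z c w :
  dotp z (noise_comb c w) = \sum_i dotp (c 0 i *: z) (N i w).
Proof.
by rewrite dotp_sumr; apply: eq_bigr => i _; rewrite dotpZr dotpZl.
Qed.

Lemma measurable_noise_comb_dotp z c :
  measurable_fun setT (fun w => dotp z (noise_comb c w)).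
Proof.
under eq_fun do rewrite dotp_noise_comb.
by apply: measurable_sum => i; exact: (measurable_normal_vec_dotp (NN i)).
Qed.

Let sum_noise_cov_quad (z : 'rV[R]_d) (c : 'rV[R]_n) :
  \sum_i dotp ((c 0 i *: z) *m noise_cov v) (c 0 i *: z) =
  dotp c c * (d%:R^-1 * (dotp z z - dotp z v ^+ 2)).
Proof.
rewrite -noise_cov_quad {2}/dotp mulr_suml; apply: eq_bigr => i _.
by rewrite -scalemxAl dotpZl dotpZr mulrA.
Qed.

Lemma noise_comb_cos (z : 'rV[R]_d) (c : 'rV[R]_n) :
  \int[P]_w cos (dotp z (noise_comb c w)) =
  expR (- (dotp c c * (d%:R^-1 * (dotp z z - dotp z v ^+ 2)) / 2)).
Proof.
under eq_Rintegral do rewrite dotp_noise_comb -[X in cos X]add0r.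
rewrite (expectation_cos_sum (r := fun i =>
   expR (- dotp ((c 0 i *: z) *m noise_cov v) (c 0 i *: z) / 2))).
- rewrite cos0 mul1r -expR_sum; congr expR.
  by rewrite -mulr_suml sumrN mulNr sum_noise_cov_quad.
- by move=> i; exact: (measurable_normal_vec_dotp (NN i)).
- exact: independent_noise_dotp.
- move=> i; have := normal_vec_cos (NN i) (c 0 i *: z) 0.
  rewrite cos0 mul1r => <-; apply: eq_Rintegral => w _.
  by rewrite add0r.
- move=> i; have := normal_vec_cos (NN i) (c 0 i *: z) (- (pi / 2)).
  rewrite cosN cos_pihalf mul0r => <-; apply: eq_Rintegral => w _.
  by rewrite addrC cosBpihalf.
Qed.

Lemma noise_comb_mgf (z : 'rV[R]_d) (c : 'rV[R]_n) :
  (\int[P]_w (expR (dotp z (noise_comb c w)))%:E =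
  (expR (dotp c c * (d%:R^-1 * (dotp z z - dotp z v ^+ 2)) / 2))%:E)%E.
Proof.
under eq_integral do rewrite dotp_noise_comb.
rewrite expectation_exp_sum.
- under eq_bigr do rewrite (normal_vec_mgf (NN _)).
  rewrite prodEFin -expR_sum; congr (expR _)%:E.
  by rewrite -mulr_suml sum_noise_cov_quad.
- by move=> i; exact: (measurable_normal_vec_dotp (NN i)).
- exact: independent_noise_dotp.
- by move=> i; rewrite (normal_vec_mgf (NN i)) ltry.
Qed.

(** Chernoff's bound: the variance of the bilinear form is at most [1 / d], for which the tilt
    [d%:R * t] is optimal. *)
Lemma noise_bilinear_tail (z : 'rV[R]_d) (c : 'rV[R]_n) (t : R) : (0 < d)%N ->
  0 <= t -> dotp c c <= 1 -> dotp z z <= 1 ->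
  (P [set w | (t <= dotp z (noise_comb c w))%R] <=
   (expR (- (d%:R * t ^+ 2 / 2)))%:E)%E.
Proof.
move=> d0 t0 c1 z1; set A := [set w | _].
have dpos : 0 < d%:R :> R by rewrite ltr0n.
have mz z' := measurable_noise_comb_dotp z' c.
have mA : measurable A.
  rewrite (_ : A = (fun w => dotp z (noise_comb c w)) @^-1` `[t, +oo[); last first.
    by apply/seteqP; split => w /=; rewrite in_itv/= andbT.
  by rewrite -[X in measurable X]setTI; exact: mz.
rewrite -[A]setIT -integral_indic//.
apply: (@le_trans _ _ (\int[P]_w ((expR (- (d%:R * t ^+ 2)))%:E *
    (expR (dotp ((d%:R * t) *: z) (noise_comb c w)))%:E))%E).
  have mE : measurable_fun setT
      (fun w => (expR (dotp ((d%:R * t) *: z) (noise_comb c w)))%:E).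
    by apply/measurable_EFinP; apply: measurableT_comp => //; exact: mz.
  apply: ge0_le_integral => //.
  - exact/measurable_EFinP.
  - exact: emeasurable_funM.
  - move=> w _; rewrite -EFinM lee_fin -expRD dotpZl indicE.
    case: (boolP (w \in A)) => [|_]; last exact: expR_ge0.
    rewrite inE /A /= => tz; rewrite -[leLHS]expR0 ler_expR.
    have : 0 <= d%:R * t * (dotp z (noise_comb c w) - t).
      by rewrite mulr_ge0 ?subr_ge0// mulr_ge0.
    by rewrite mulrBr; lra.
rewrite ge0_integralZl//; try first [by rewrite lee_fin expR_ge0
  | by apply/measurable_EFinP; apply: measurableT_comp => //; exact: mz].
rewrite noise_comb_mgf -EFinM lee_fin -expRD ler_expR !(dotpZl, dotpZr).
have : dotp c c * (dotp z z - dotp z v ^+ 2) <= 1.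
  rewrite mulr_ile1 ?dotp_ge0//.
    by rewrite subr_ge0 (le_trans (cauchy_schwarz_sqr _ _))// v1 mulr1.
  by rewrite lerBlDr (le_trans z1)// lerDl sqr_ge0.
have p : 0 <= d%:R * t ^+ 2 / 2 by rewrite divr_ge0// mulr_ge0 ?sqr_ge0// ltW.
move=> h; have := ler_wpM2l p h; rewrite mulr1.
have -> : dotp c c * (d%:R^-1 *
   (d%:R * t * (d%:R * t * dotp z z) - (d%:R * t * dotp z v) ^+ 2)) / 2 =
   d%:R * t ^+ 2 / 2 * (dotp c c * (dotp z z - dotp z v ^+ 2)).
  by field; rewrite gt_eqF.
lra.
Qed.

End NoiseMatrix.

Section SmallBall.
Context {R : realType} {disp : measure_display} {T : measurableType disp}.
Variable P : probability T R.
Variables (d n : nat) (v : 'rV[R]_d) (N : 'I_n -> T -> 'rV[R]_d).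
Hypothesis v1 : dotp v v = 1.
Hypothesis NN : forall i, normal_vec P (noise_cov v) (N i).
Hypothesis iN : mutually_independent P (fun i => sigma_rv (coords (N i))).

Lemma measurable_noise_comb_sqr (c : 'rV[R]_n) :
  measurable_fun setT (fun w => dotp (noise_comb N c w) (noise_comb N c w)).
Proof.
rewrite /dotp; apply: measurable_sum => l.
have mZ : measurable_fun setT (fun w => noise_comb N c w 0 l).
  under eq_fun do rewrite -dotp_delta.
  exact: (measurable_noise_comb_dotp NN).
exact: measurable_funM.
Qed.

(* The characteristic function of the Gaussian vector [Z] is averaged over
   lattice walks [h] in the coordinates of [I]: the average of [cos <h, Z>] is
   a product of powers of cosines, bounded below when [Z] is small, whereas the
   average of [E cos <h, Z> = exp(- c |P h|^2)] is exponentially small. *)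
Lemma noise_small_ball (c : 'rV[R]_n) : (1 < d)%N -> 4^-1 <= dotp c c ->
  (P [set w | (dotp (noise_comb N c w) (noise_comb N c w) <= 256^-1)%R] <=
   (expR (- (d%:R / 48)))%:E)%E.
Proof.
move=> d1 c4; have [I [dI vI]] := half_mass_coords d1 v1.
have dpos : 0 < d%:R :> R by rewrite ltr0n ltnW.
(* For [h] supported in [I], [E cos <h, Z>] is at most [exp (- |h|^2 / (16 d))]; these [M] and [b]
   make [M b^2 / (16 d) = 2 / 9], as [walk_mean_gauss] asks. The average is then at most
   [exp (- d / 27)], against [exp (- d / 72)] on the small ball, and [1 / 27 - 1 / 72 >= 1 / 48]. *)
pose Z := noise_comb N c; pose M := (2 * d)%N; pose b : R := 4 / 3.
pose s := enum I.
pose F w (h : 'rV[R]_d) := cos (dotp h (Z w)).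
have bF : bounded_process F.
  split=> [h|w h]; last by rewrite ler_norml cos_geN1 cos_le1.
  apply: (@measurableT_comp _ _ _ _ _ _ cos).
    by apply: continuous_measurable_fun; exact: continuous_cos.
  exact: (measurable_noise_comb_dotp NN).
have [[mPsi bPsi] EPsi] := coords_mean_expectation P b M s bF.
pose Psi w := coords_mean b M s (F w) 0.
have PsiE w : Psi w = \prod_(l <- s) cos (b * Z w 0 l) ^+ M.
  by rewrite /Psi coords_mean_cos dotp0l cos0 mulr1.
(* Even powers keep [Psi] nonnegative where [Z] is large and the cosines may be negative. *)
have M_even : ~~ odd M by rewrite /M oddM.
have Psi0 w : 0 <= Psi w.
  by rewrite PsiE prodr_ge0// => l _; rewrite exprn_even_ge0.
have upper : \int[P]_w Psi w <= (8 / 9) ^+ size s.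
  rewrite /Psi EPsi.
  have := @coords_mean_gauss R b d M I (16 * d%:R)^-1
    (fun h => \int[P]_w F w h) s 0.
  rewrite dotp0l mulr0 oppr0 expR0 mulr1; apply.
  - by rewrite invr_ge0 mulr_ge0.
  - by rewrite /M /b natrM; field; rewrite gt_eqF.
  - move=> h hI; rewrite /F (noise_comb_cos NN iN) ler_expR lerN2.
    have hv : dotp h v ^+ 2 <= dotp h h / 2.
      pose v' : 'rV[R]_d := \row_l (if l \in I then v 0 l else 0).
      have -> : dotp h v = dotp h v'.
        apply: eq_bigr => l _; rewrite mxE; case: ifPn => // lI.
        by rewrite hI// !mul0r.
      have v'2 : dotp v' v' <= 2^-1.
        rewrite (le_trans _ vI)// /dotp [in leRHS]big_mkcond/=.
        apply: ler_sum => l _; rewrite !mxE; case: ifP => _; last by rewrite mulr0.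
        by rewrite expr2.
      by rewrite (le_trans (cauchy_schwarz_sqr _ _))// ler_wpM2l// dotp_ge0.
    have p : dotp h h / 2 <= dotp h h - dotp h v ^+ 2 by lra.
    have p0 : 0 <= dotp h h / 2 by rewrite divr_ge0// dotp_ge0.
    have := ler_pM (ltac:(lra) : 0 <= 4^-1 :> R) p0 c4 p => q.
    rewrite [leRHS](_ : _ = d%:R^-1 / 2 *
      (dotp c c * (dotp h h - dotp h v ^+ 2))); last by field; rewrite gt_eqF.
    rewrite [leLHS](_ : _ = d%:R^-1 / 2 * (4^-1 * (dotp h h / 2))).
      by rewrite ler_wpM2l// divr_ge0// invr_ge0 ltW.
    by field; rewrite gt_eqF.
  - exact: enum_uniq.
  - by move=> l; rewrite mem_enum.
  - by move=> l _; rewrite mxE.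
  - by move=> l _; rewrite mxE.
set A := [set w | _].
have mA : measurable A.
  rewrite (_ : A = (fun w => dotp (Z w) (Z w)) @^-1` `]-oo, 256^-1]); last first.
    by apply/seteqP; split => w /=; rewrite in_itv.
  by rewrite -[X in measurable X]setTI; exact: measurable_noise_comb_sqr.
have lower w : A w -> expR (- (d%:R / 72)) <= Psi w.
  rewrite /A /= -/(Z w) => Zw; rewrite PsiE.
  have Zl l : Z w 0 l ^+ 2 <= 256^-1.
    rewrite (le_trans _ Zw)// /dotp (bigD1 l)//= -expr2 lerDl sumr_ge0// => i _.
    by rewrite -expr2 sqr_ge0.
  apply: (@le_trans _ _ (\prod_(l <- s) expR (- (b * Z w 0 l) ^+ 2) ^+ M)); last first.
    rewrite !big_seq; apply: ler_prod => l _; rewrite exprn_ge0 ?expR_ge0//=.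
    rewrite lerXn2r ?nnegrE ?expR_ge0//.
      apply: le_trans (cos_ge_gauss _); rewrite ?expR_ge0//.
      by rewrite exprMn /b; have := Zl l; lra.
    by apply: cos_ge_gauss; rewrite exprMn /b; have := Zl l; lra.
  rewrite (eq_bigr (fun l => expR (- (M%:R * b ^+ 2 * Z w 0 l ^+ 2)))); last first.
    by move=> l _; rewrite -expRM_natl; congr expR; ring.
  rewrite -expR_sum ler_expR sumrN lerN2 -mulr_sumr.
  have : \sum_(l <- s) Z w 0 l ^+ 2 <= 256^-1.
    rewrite (le_trans _ Zw)// /s big_enum/= [leRHS](bigID (mem I))/= lerDl.
      by rewrite sumr_ge0// => l _; rewrite -expr2 sqr_ge0.
  have p : 0 <= M%:R * b ^+ 2 by rewrite mulr_ge0 ?sqr_ge0.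
  move=> /(ler_wpM2l p) /le_trans; apply.
  by rewrite /M natrM /b le_eqVlt; apply/orP; left; apply/eqP; field.
have iPsi : P.-integrable setT (EFin \o Psi).
  by apply: (@integrable_bounded_by _ _ _ _ _ 1); [exact: mPsi|move=> w; exact: bPsi].
have mk : expR (- (d%:R / 72)) * fine (P A) <= \int[P]_w Psi w.
  have -> : fine (P A) = \int[P]_w (\1_A w).
    by rewrite /Rintegral integral_indic// setIT.
  have iA : P.-integrable setT (EFin \o (\1_A : T -> R)).
    apply: (@integrable_bounded_by _ _ _ _ _ 1) => // w.
    by rewrite indicE; case: (_ \in _); rewrite ?normr1 ?normr0.
  rewrite -RintegralZl//; apply: le_Rintegral => //.
    apply: (@integrable_bounded_by _ _ _ _ _ (expR (- (d%:R / 72)))) => [|w].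
      by apply: measurable_funM.
    rewrite normrM ger0_norm ?expR_ge0// ler_piMr ?expR_ge0//.
    by rewrite indicE; case: (_ \in _); rewrite ?normr1 ?normr0.
  move=> w _; rewrite indicE; case: (boolP (w \in A)) => wA.
    by rewrite mulr1; apply: lower; rewrite inE in wA.
  by rewrite mulr0.
have PA : (P A = (fine (P A))%:E)%E by rewrite fineK// fin_num_measure.
rewrite PA lee_fin; have := le_trans mk upper.
have e89 : (8 / 9 : R) ^+ size s <= expR (- (d%:R / 27)).
  apply: (@le_trans _ _ (expR (- 9^-1) ^+ size s)).
    rewrite lerXn2r ?nnegrE ?expR_ge0//.
    by apply: le_trans (expR_ge1Dx _); lra.
  rewrite -expRM_natl ler_expR mulrN lerN2 /s -cardE.
  have : d%:R <= 3 * #|I|%:R :> R by rewrite -natrM ler_nat.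
  lra.
move=> /le_trans/(_ e89) h.
rewrite -(ler_pM2l (expR_gt0 (- (d%:R / 72)))) (le_trans h)// -expRD ler_expR.
by lra.
Qed.

End SmallBall.

(** * Nets and operator norms *)

Section Nets.
Context {R : realType}.

(** A point of the lattice of mesh [1 / (K sqrt n)], coded by numerators and sign bits so that nets
    are finite sets. Numerators up to [n * K] reach all coordinates in [[-1, 1]], as
    [sqrt n <= n]. *)
Definition grid_point (K n D : nat) (f : {ffun 'I_n -> 'I_D.+1 * bool}) : 'rV[R]_n :=
  \row_i ((-1) ^+ (f i).2 * (f i).1%:R / (K%:R * Num.sqrt n%:R)).

Definition grid_net (K n : nat) : {set {ffun 'I_n -> 'I_(n * K).+1 * bool}} :=
  [set f | dotp (grid_point K f) (grid_point K f) <= 1].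

Lemma sum_half_powers (D : nat) : \sum_(m < D) (2^-1 : R) ^+ m <= 2.
Proof.
suff -> : \sum_(m < D) (2^-1 : R) ^+ m = 2 - 2 * 2^-1 ^+ D.
  by rewrite lerBlDr lerDl mulr_ge0// exprn_ge0.
elim: D => [|D IH]; first by rewrite big_ord0 expr0; lra.
by rewrite big_ord_recr/= IH exprS; field.
Qed.

(** In the unit ball the numerators [m_i] have [sum m_i^2 <= K^2 n], hence [sum m_i <= n K].
    Weighting each point by [2 ^ (n K - sum m_i) >= 1] and summing over all lattice codes gives at
    most [2 ^ (n K) * 4 ^ n], where [4] is two signs times a geometric sum. Counting all codes would
    not give an exponent linear in [n]. *)
Lemma card_grid_net (K n : nat) : (0 < n)%N -> (0 < K)%N ->
  #|grid_net K n|%:R <= expR ((K%:R + 2) * n%:R) :> R.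
Proof.
move=> n0 K0; have npos : 0 < n%:R :> R by rewrite ltr0n.
have Kpos : 0 < K%:R :> R by rewrite ltr0n.
have sq0 : 0 < Num.sqrt n%:R :> R by rewrite sqrtr_gt0.
have sqn : Num.sqrt n%:R ^+ 2 = n%:R :> R by rewrite sqr_sqrtr// ltW.
have sumf (f : {ffun 'I_n -> 'I_(n * K).+1 * bool}) : f \in grid_net K n ->
    (\sum_i (f i).1 <= n * K)%N.
  rewrite inE /dotp => f1.
  have H : \sum_i ((f i).1%:R : R) ^+ 2 <= K%:R ^+ 2 * n%:R.
    have dE : \sum_(l < n) grid_point K f 0 l * grid_point K f 0 l =
        (\sum_i ((f i).1%:R : R) ^+ 2) / (K%:R ^+ 2 * n%:R).
      rewrite mulr_suml; apply: eq_bigr => i _; rewrite mxE -expr2 exprMn exprMn.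
      by rewrite sqrr_sign mul1r exprVn exprMn sqn.
    by move: f1; rewrite dE ler_pdivrMr ?mulr_gt0 ?exprn_gt0// mul1r.
  rewrite -(ler_nat R) natr_sum natrM.
  apply: (@le_trans _ _ (\sum_(i < n) ((f i).1%:R ^+ 2 / (2 * K%:R) + K%:R / 2))).
    apply: ler_sum => i _; set m : R := _%:R.
    have : 0 <= (m - K%:R) ^+ 2 / (2 * K%:R) by rewrite divr_ge0 ?sqr_ge0// mulr_ge0// ltW.
    rewrite (_ : (m - K%:R) ^+ 2 / (2 * K%:R) = m ^+ 2 / (2 * K%:R) + K%:R / 2 - m).
      by rewrite subr_ge0.
    by field; rewrite gt_eqF.
  rewrite big_split/= -mulr_suml sumr_const card_ord.
  have : (\sum_(i < n) (f i).1%:R ^+ 2) / (2 * K%:R) <= (K%:R ^+ 2 * n%:R) / (2 * K%:R) :> R.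
    by rewrite ler_wpM2r// invr_ge0 mulr_ge0// ltW.
  rewrite (_ : K%:R ^+ 2 * n%:R / (2 * K%:R) = K%:R * n%:R / 2 :> R); last first.
    by field; rewrite gt_eqF.
  by rewrite -mulr_natr; lra.
apply: (@le_trans _ _ (\sum_(f in grid_net K n)
    (2 ^+ (n * K) * \prod_i 2^-1 ^+ (f i).1) : R)).
  rewrite -sum1_card natr_sum; apply: ler_sum => f /sumf fK.
  rewrite -expr_sum exprVn -exprB//; last by rewrite unitfE.
  by rewrite exprn_ege1// ler1n.
apply: (@le_trans _ _ (\sum_(f : {ffun 'I_n -> 'I_(n * K).+1 * bool})
    (2 ^+ (n * K) * \prod_i 2^-1 ^+ (f i).1) : R)).
  rewrite big_mkcond/=; apply: ler_sum => f _; case: ifP => // _.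
  by rewrite mulr_ge0 ?exprn_ge0// prodr_ge0// => i _; rewrite exprn_ge0.
rewrite -mulr_sumr.
rewrite -(bigA_distr_bigA (fun _ (mb : 'I_(n * K).+1 * bool) => (2^-1 : R) ^+ mb.1)).
apply: (@le_trans _ _ (2 ^+ (n * K) * 4 ^+ n : R)).
  rewrite ler_wpM2l ?exprn_ge0// -[in leRHS](card_ord n) -prodr_const.
  apply: ler_prod => i _; rewrite sumr_ge0/=; last by move=> mb _; rewrite exprn_ge0.
  rewrite -(pair_bigA _ (fun (m : 'I_(n * K).+1) (b : bool) => (2^-1 : R) ^+ m))/=.
  under eq_bigr do rewrite sumr_const card_bool.
  rewrite sumrMnl; have := sum_half_powers (n * K).+1; lra.
have e1 : (2 : R) <= expR 1 by apply: le_trans (expR_ge1Dx _); lra.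
have e2 : (4 : R) <= expR 2.
  rewrite (_ : 2 = 1 + 1 :> R)// expRD.
  by apply: le_trans (ler_pM _ _ e1 e1) => //; lra.
rewrite mulrDl expRD ler_pM ?exprn_ge0//.
  rewrite mulrC -natrM -[in leRHS](mulr1 (n * K)%:R) expRM_natl.
  by rewrite lerXn2r ?nnegrE ?expR_ge0.
by rewrite mulrC expRM_natl lerXn2r ?nnegrE ?expR_ge0.
Qed.

(** Coordinates are rounded towards 0, so the norm does not increase and the net point stays in the
    ball; each of the [n] errors is at most [1 / (K sqrt n)]. *)
Lemma grid_netP (K n : nat) (u : 'rV[R]_n) : (0 < n)%N -> (0 < K)%N ->
  dotp u u <= 1 -> exists2 f, f \in grid_net K n &
    dotp (u - grid_point K f) (u - grid_point K f) <= K%:R ^- 2.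
Proof.
move=> n0 K0 u1; have npos : 0 < n%:R :> R by rewrite ltr0n.
have Kpos : 0 < K%:R :> R by rewrite ltr0n.
have sq0 : 0 < Num.sqrt n%:R :> R by rewrite sqrtr_gt0.
have sqn : Num.sqrt n%:R ^+ 2 = n%:R :> R by rewrite sqr_sqrtr// ltW.
pose e : R := K%:R * Num.sqrt n%:R; have epos : 0 < e by rewrite mulr_gt0.
have ui i : `|u 0 i| <= 1.
  rewrite -(ler_pXn2r (ltn0Sn 1)) ?nnegrE// expr1n real_normK ?num_real//.
  rewrite (le_trans _ u1)// /dotp (bigD1 i)//= -expr2 lerDl sumr_ge0// => j _.
  by rewrite -expr2 sqr_ge0.
pose m i := Num.truncn (`|u 0 i| * e).
have m1 i : (m i)%:R <= `|u 0 i| * e.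
  by rewrite truncn_le// mulr_ge0// ltW.
have m2 i : `|u 0 i| * e < (m i)%:R + 1.
  by rewrite natr1 truncnS_gt.
have sn : Num.sqrt n%:R <= n%:R :> R.
  rewrite -[leRHS]sqn expr2 ler_peMl ?(ltW sq0)// -[leLHS]sqrtr1 ler_sqrt//.
  by rewrite ler1n.
have mD i : (m i < (n * K).+1)%N.
  rewrite ltnS -(ler_nat R) (le_trans (m1 i))// natrM.
  rewrite (le_trans (ler_piMl (ltW epos) (ui i)))// /e [leRHS]mulrC.
  by rewrite ler_wpM2l// ltW.
pose f := [ffun i => (Ordinal (mD i), u 0 i < 0)].
have fE i : grid_point K f 0 i = (-1) ^+ (u 0 i < 0)%R * ((m i)%:R / e).
  by rewrite mxE ffunE/= mulrA.
have uE i : u 0 i = (-1) ^+ (u 0 i < 0)%R * `|u 0 i|.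
  by case: ltrgt0P => [h|h|->]; rewrite ?expr1 ?expr0 ?mul1r ?mulN1r ?opprK ?mulr0.
have me i : (m i)%:R / e <= `|u 0 i| by rewrite ler_pdivrMr.
have me0 i : 0 <= (m i)%:R / e by rewrite divr_ge0// ltW.
exists f.
  rewrite inE (le_trans _ u1)//; apply: ler_sum => i _.
  rewrite fE -!expr2 exprMn sqrr_sign mul1r -[leRHS]real_normK ?num_real//.
  by rewrite lerXn2r ?nnegrE.
apply: (@le_trans _ _ (\sum_(i < n) (e ^- 2))).
  apply: ler_sum => i _.
  have -> : (u - grid_point K f) 0 i = (-1) ^+ (u 0 i < 0)%R * (`|u 0 i| - (m i)%:R / e).
    rewrite [LHS]mxE [X in _ + X]mxE fE mulrBr; congr (_ - _); exact: uE.
  rewrite -expr2 exprMn sqrr_sign mul1r -exprVn lerXn2r ?nnegrE ?subr_ge0 ?invr_ge0 ?(ltW epos)//.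
  rewrite lerBlDr -(ler_pM2r epos) mulrDl mulVf ?gt_eqF// divfK ?gt_eqF//.
  by rewrite addrC ltW.
rewrite sumr_const card_ord -mulr_natr /e exprMn sqn le_eqVlt.
by apply/orP; left; apply/eqP; field; rewrite !gt_eqF.
Qed.

End Nets.

Section OperatorNorm.
Context {R : realType}.

(** Replacing both arguments by net points at distance at most [1 / 4] costs two quarters of the
    supremum, so [sup V <= t + sup V / 2]; the crude entrywise bound makes the supremum finite. *)
Lemma bilinear_net_bound (n d : nat) (Y : 'M[R]_(n, d)) (t : R) :
  (0 < n)%N -> (0 < d)%N ->
  (forall f g, f \in @grid_net R 4 n -> g \in @grid_net R 4 d ->
    dotp (grid_point 4 g) (grid_point 4 f *m Y) <= t) ->
  forall u z, dotp u u <= 1 -> dotp z z <= 1 -> dotp z (u *m Y) <= 2 * t.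
Proof.
move=> n0 d0 Yt.
pose V := [set x | exists u z, [/\ dotp u u <= 1, dotp z z <= 1 & x = dotp z (u *m Y)]].
have coord_le1 k (u : 'rV[R]_k) i : dotp u u <= 1 -> `|u 0 i| <= 1.
  move=> u1; rewrite -(ler_pXn2r (ltn0Sn 1)) ?nnegrE// expr1n real_normK ?num_real//.
  rewrite (le_trans _ u1)// /dotp (bigD1 i)//= -expr2 lerDl sumr_ge0// => j _.
  by rewrite -expr2 sqr_ge0.
have Vsup : has_sup V.
  split; first by exists 0, 0, 0; split; rewrite ?dotp0l.
  exists (\sum_l \sum_i `|Y i l|) => _ [u [z [u1 z1 ->]]].
  rewrite (le_trans (ler_norm _))// (le_trans (ler_norm_sum _ _ _))//.
  apply: ler_sum => l _; rewrite normrM mxE.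
  rewrite (le_trans (ler_piMl _ (coord_le1 _ _ l z1)))//.
  rewrite (le_trans (ler_norm_sum _ _ _))//; apply: ler_sum => i _.
  by rewrite normrM ler_piMl// coord_le1.
have Vle x : V x -> x <= sup V by move=> Vx; exact: ub_le_sup Vsup.2 x Vx.
have quarter k (a : 'rV[R]_k) : dotp a a <= 4%:R ^- 2 -> dotp (4 *: a) (4 *: a) <= 1.
  by rewrite dotpZl dotpZr mulrA -expr2 => h; rewrite -ler_pdivlMl ?exprn_gt0// mulr1.
suff S : sup V <= t + sup V / 2.
  by move=> u z u1 z1; rewrite (le_trans (Vle _ _))//; [exists u, z|lra].
apply: ge_sup; first exact: Vsup.1.
move=> _ [u [z [u1 z1 ->]]].
have [f fN uf] := grid_netP n0 (ltn0Sn 3) u1.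
have [g gN zg] := grid_netP d0 (ltn0Sn 3) z1.
set p := grid_point 4 f in uf *; set q := grid_point 4 g in zg *.
have p1 : dotp p p <= 1 by move: fN; rewrite inE.
have -> : dotp z (u *m Y) = dotp q (p *m Y) + dotp (4 *: (z - q)) (p *m Y) / 4 +
    dotp z ((4 *: (u - p)) *m Y) / 4.
  by rewrite -scalemxAl dotpZl dotpZr mulmxBl !dotpBl dotpBr; field.
have h1 := Yt f g fN gN.
have h2 : dotp (4 *: (z - q)) (p *m Y) <= sup V.
  by apply: Vle; exists p, (4 *: (z - q)); split=> //; exact: quarter.
have h3 : dotp z ((4 *: (u - p)) *m Y) <= sup V.
  by apply: Vle; exists (4 *: (u - p)), z; split=> //; exact: quarter.
rewrite -/p -/q in h1; lra.
Qed.

Lemma enorm_mulmx_le (n d : nat) (Y : 'M[R]_(n, d)) (t : R) : 0 <= t ->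
  (forall u z, dotp u u <= 1 -> dotp z z <= 1 -> dotp z (u *m Y) <= t) ->
  forall u, enorm (u *m Y) <= t * enorm u.
Proof.
move=> t0 Yt u; have [u0|un0] := eqVneq (enorm u) 0.
  by rewrite (enorm_eq0 u0) mul0mx !enorm0 mulr0.
have [y0|yn0] := eqVneq (enorm (u *m Y)) 0; first by rewrite y0 mulr_ge0 ?enorm_ge0.
have upos : 0 < enorm u by rewrite lt_neqAle eq_sym un0 enorm_ge0.
have ypos : 0 < enorm (u *m Y) by rewrite lt_neqAle eq_sym yn0 enorm_ge0.
have unit k (a : 'rV[R]_k) : enorm a != 0 ->
    dotp ((enorm a)^-1 *: a) ((enorm a)^-1 *: a) <= 1.
  move=> a0; rewrite dotpZl dotpZr -sqr_enorm le_eqVlt; apply/orP; left; apply/eqP.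
  by field.
have := Yt _ _ (unit _ _ un0) (unit _ _ yn0).
rewrite -scalemxAl dotpZl dotpZr -sqr_enorm.
rewrite [leLHS](_ : _ = enorm (u *m Y) / enorm u); first by rewrite ler_pdivrMr.
by field; rewrite un0 yn0.
Qed.

(* The net points of norm at least [1 / 2] are not contracted below [1 / 16];
   the operator norm bound transfers this to the whole sphere. *)
Lemma enorm_mulmx_ge (n d K : nat) (Y : 'M[R]_(n, d)) : (0 < n)%N ->
  K%:R = 12 * 32 :> R ->
  (forall u, enorm (u *m Y) <= 12 * enorm u) ->
  (forall f, f \in @grid_net R K n ->
    4^-1 <= dotp (grid_point K f) (grid_point K f : 'rV[R]_n) ->
    256^-1 < dotp (grid_point K f *m Y) (grid_point K f *m Y)) ->
  forall u, enorm u <= 32 * enorm (u *m Y).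
Proof.
move=> n0 KE Yop Ynet.
have Kpos : 0 < K%:R :> R by rewrite KE mulr_gt0.
have K0 : (0 < K)%N by rewrite -(ltr_nat R).
have unit (u : 'rV[R]_n) : enorm u = 1 -> 1 <= 32 * enorm (u *m Y).
  move=> u1; have uu : dotp u u <= 1 by rewrite -sqr_enorm u1 expr1n.
  have [f fN uf] := grid_netP n0 K0 uu.
  set p := grid_point K f in uf.
  have up : enorm (u - p) <= K%:R^-1.
    rewrite -(ler_pXn2r (ltn0Sn 1)) ?nnegrE ?enorm_ge0 ?invr_ge0 ?(ltW Kpos)// sqr_enorm.
    by rewrite (le_trans uf)// exprVn.
  have h1 : 1 <= enorm (u - p) + enorm p.
    by rewrite -u1 -[X in enorm X <= _](subrK p) ler_enormD.
  have p2 : 4^-1 <= dotp p p.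
    rewrite -sqr_enorm (_ : 4^-1 = 2^-1 ^+ 2); last by field.
    rewrite lerXn2r ?nnegrE ?enorm_ge0//; have := h1; move: up.
    have : K%:R^-1 <= 2^-1 :> R by rewrite lef_pV2 ?posrE// KE; lra.
    lra.
  have := Ynet f fN p2; rewrite -/p -sqr_enorm.
  rewrite (_ : 256^-1 = 16^-1 ^+ 2); last by field.
  rewrite ltr_pXn2r ?nnegrE ?enorm_ge0// => h2.
  have h3 : enorm (p *m Y) <= enorm (u *m Y) + enorm ((u - p) *m Y).
    rewrite -[enorm ((u - p) *m Y)]enormN -mulNmx opprB mulmxBl.
    by rewrite -{1}[p *m Y](subrK (u *m Y)) addrC ler_enormD.
  have h4 := Yop (u - p).
  (* The choice [K = 12 * 32] makes the rounding error half of the [1 / 16] available at the net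
     point. *)
  have h5 : 12 * enorm (u - p) <= 32^-1.
    have := ler_wpM2l (ler0n R 12) up; rewrite KE => /le_trans; apply.
    by rewrite le_eqVlt; apply/orP; left; apply/eqP; field.
  lra.
move=> u; have [u0|un0] := eqVneq (enorm u) 0.
  by rewrite u0 mulr_ge0 ?enorm_ge0.
have upos : 0 < enorm u by rewrite lt_neqAle eq_sym un0 enorm_ge0.
have := unit ((enorm u)^-1 *: u).
rewrite enormZ gtr0_norm ?invr_gt0// mulVf// => /(_ erefl).
rewrite -scalemxAl enormZ gtr0_norm ?invr_gt0//.
by rewrite mulrCA ler_pdivlMl// mulr1.
Qed.

End OperatorNorm.

(** * Flipped labels *)

Section Labels.
Context {R : realType} {disp : measure_display} {T : measurableType disp}.
Variable P : probability T R.

Lemma union_bound (I : finType) (S : {set I}) (A : I -> set T) (E : set T) :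
  measurable E -> (forall i, measurable (A i)) ->
  (forall w, E w -> exists2 i, i \in S & A i w) ->
  (P E <= \sum_(i in S) P (A i))%E.
Proof.
move=> mE mA EA.
have H (s : seq I) : (P (\big[setU/set0]_(i <- s) A i) <= \sum_(i <- s) P (A i))%E.
  elim: s => [|i s IH]; first by rewrite !big_nil measure0.
  rewrite !big_cons; apply: le_trans (measureU2 _ _ _) _ => //.
    exact: bigsetU_measurable.
  exact: leeD2l.
have -> : (\sum_(i in S) P (A i) = \sum_(i <- enum S) P (A i))%E by rewrite big_enum.
apply: le_trans (H _); apply: le_measure; rewrite ?inE//.
  exact: bigsetU_measurable.
move=> w /EA[i iS Aiw]; rewrite -bigcup_seq; exists i => //=.
by rewrite mem_enum.
Qed.

Definition label_count n (b : {set 'I_n}) (y : 'I_n -> T -> R) (e : R) (w : T) : R :=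
  \sum_(i in b) \1_[set e] (y i w).

Lemma measurable_label_count n (b : {set 'I_n}) (y : 'I_n -> T -> R) (e : R) :
  (forall i, measurable_fun setT (y i)) -> measurable_fun setT (label_count b y e).
Proof.
move=> my; rewrite /label_count; under eq_fun do rewrite -big_filter.
by apply: measurable_sum => i; exact: measurable_indic_comp.
Qed.

(** A Chernoff bound in which [exp (- 2 * 1)] is majorized by [1 - 3 / 4 * 1], affine in the
    indicator and of mean [5 / 8 <= exp (- 3 / 8)]. On the event the exponential is at least
    [exp (- #|b| / 8)], and [3 / 8 - 1 / 8 = 1 / 4]. *)
Lemma label_count_tail n (b : {set 'I_n}) (y : 'I_n -> T -> R) (e : R) :
  (forall i, measurable_fun setT (y i)) -> independent_rvs P y ->
  (forall i, P (y i @^-1` [set e]) = (2^-1)%:E) ->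
  (P [set w | (label_count b y e w <= #|b|%:R / 16)%R] <=
   (expR (- (#|b|%:R / 4)))%:E)%E.
Proof.
move=> my iy ye; set A := [set w | _].
pose h i : R -> R :=
  if i \in b then (fun x => 1 - 3 / 4 * \1_[set e] x) else cst 1.
have mA : measurable A.
  rewrite (_ : A = label_count b y e @^-1` `]-oo, #|b|%:R / 16]); last first.
    by apply/seteqP; split => w /=; rewrite in_itv.
  by rewrite -[X in measurable X]setTI; exact: measurable_label_count.
have mh i : measurable_fun setT (h i).
  rewrite /h; case: ifP => // _.
  by apply: measurable_funB => //; apply: measurable_funM => //; exact: measurable_indic.
have h01 i x : 0 <= h i x <= 1.
  rewrite /h; case: ifP => _ /=; last by rewrite ler01 lexx.
  by rewrite indicE; case: (_ \in _) => /=; apply/andP; split; lra.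
have Eh i : (\int[P]_w (h i (y i w))%:E = (if i \in b then 5 / 8 else 1)%:E)%E.
  rewrite /h; case: ifP => _; last first.
    by rewrite (integral_cst P measurableT 1%E)/= probability_setT mul1e.
  have mI : measurable_fun setT (fun w => \1_[set e] (y i w) : R).
    exact: measurable_indic_comp.
  have iI : P.-integrable setT (EFin \o (fun w => \1_[set e] (y i w) : R)).
    apply: (@integrable_bounded_by _ _ _ _ _ 1) => // w.
    by rewrite indicE; case: (_ \in _); rewrite ?normr1 ?normr0.
  have fin : (\int[P]_w (1 - 3 / 4 * \1_[set e] (y i w))%:E)%E \is a fin_num.
    apply: integrable_fin_num => //; apply: (@integrable_bounded_by _ _ _ _ _ 2).
      by apply: measurable_funB => //; exact: measurable_funM.
    by move=> w; rewrite indicE; case: (_ \in _); rewrite ger0_norm /=; lra.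
  rewrite -(fineK fin).
  congr EFin; rewrite -[LHS]/(\int[P]_w (1 - 3 / 4 * \1_[set e] (y i w))).
  rewrite RintegralB//; last 2 first.
  - by apply: (@integrable_bounded_by _ _ _ _ _ 1) => // w; rewrite normr1.
  - apply: (@integrable_bounded_by _ _ _ _ _ 1) => [|w]; first exact: measurable_funM.
    by rewrite indicE; case: (_ \in _); rewrite ger0_norm /=; lra.
  rewrite RintegralZl// Rintegral_cst//= probability_setT/= mul1r.
  have -> : \int[P]_w \1_[set e] (y i w) = 2^-1.
    rewrite /Rintegral integral_indic//; last first.
      by rewrite -[X in measurable X]setTI; exact: my.
    rewrite setIT; apply: (congr1 fine (ye i)).
  by field.
have : (\int[P]_w (\prod_i h i (y i w))%:E = ((5 / 8) ^+ #|b|)%:E)%E.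
  rewrite expectation_prod_ge0//.
  - under eq_bigr do rewrite Eh.
    by rewrite prodEFin -big_mkcond/= prodr_const.
  - by move=> i x; case/andP: (h01 i x).
  - by move=> i; rewrite Eh ltry.
move=> Eprod; rewrite -[A]setIT -integral_indic//.
have lower w : expR (- (#|b|%:R / 8)) * \1_A w <= \prod_i h i (y i w).
  rewrite indicE; case: (boolP (w \in A)) => [|_]; last first.
    by rewrite mulr0 prodr_ge0// => i _; case/andP: (h01 i (y i w)).
  rewrite inE /A /= mulr1 => Aw.
  apply: (@le_trans _ _ (\prod_(i in b) expR (- (2 * \1_[set e] (y i w))))).
    rewrite -expR_sum ler_expR sumrN lerN2 -mulr_sumr.
    move: Aw; rewrite /label_count => Aw.
    rewrite (le_trans (ler_wpM2l _ Aw))// le_eqVlt.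
    by apply/orP; left; apply/eqP; field.
  rewrite [in leLHS]big_mkcond/=; apply: ler_prod => i _; rewrite /h.
  case: ifP => _ /=; last by rewrite ler01 lexx.
  rewrite expR_ge0/= indicE; case: (_ \in _); last by rewrite !mulr0 oppr0 expR0; lra.
  rewrite mulr1 expRN -div1r ler_pdivrMr ?expR_gt0// (_ : 2 = 1 + 1 :> R)// expRD.
  have e1 : (2 : R) <= expR 1 by apply: le_trans (expR_ge1Dx _); lra.
  by rewrite /= mulr1; nra.
have : ((expR (- (#|b|%:R / 8)))%:E * \int[P]_w (\1_A w)%:E <= ((5 / 8) ^+ #|b|)%:E)%E.
  rewrite -Eprod -ge0_integralZl//; try first [by rewrite lee_fin expR_ge0
    | exact/measurable_EFinP].
  apply: ge0_le_integral => //.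
  - by apply/measurable_EFinP; exact: measurable_funM.
  - apply/measurable_EFinP.
    exact: (@measurable_prod_comp _ _ _ _ predT).
  - by move=> w _; rewrite -EFinM lee_fin; exact: lower.
rewrite integral_indic// setIT.
have PA : (P A = (fine (P A))%:E)%E by rewrite fineK// fin_num_measure.
rewrite -[X in (_ * X <= _)%E]/(P A) -[X in (_ -> X <= _)%E]/(P A) PA -EFinM !lee_fin.
have e58 : (5 / 8 : R) ^+ #|b| <= expR (- (3 / 8 * #|b|%:R)).
  rewrite (_ : - (3 / 8 * #|b|%:R) = #|b|%:R * (- (3 / 8))) ?expRM_natl; last by ring.
  rewrite lerXn2r ?nnegrE ?expR_ge0//.
  by apply: le_trans (expR_ge1Dx _); lra.
move=> /le_trans/(_ e58) h'.
rewrite -(ler_pM2l (expR_gt0 (- (#|b|%:R / 8)))) (le_trans h')// -expRD ler_expR.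
by rewrite le_eqVlt; apply/orP; left; apply/eqP; field.
Qed.

(** The random set has finitely many values, all of size [k]. By independence each value [b]
    contributes its probability times the tail for fixed [b]. *)
Lemma flipped_count_tail n k (y : 'I_n -> T -> R) (B : T -> {set 'I_n}) (e : R) :
  (forall i, measurable_fun setT (y i)) -> independent_rvs P y ->
  (forall i, P (y i @^-1` [set e]) = (2^-1)%:E) ->
  sigma_discrete B `<=` measurable -> (forall w, #|B w| = k) ->
  mutually_independent P
    (fun b : bool => if b then sigma_discrete B else sigma_rv y) ->
  (P [set w | (label_count (B w) y e w <= k%:R / 16)%R] <=
   (expR (- (k%:R / 4)))%:E)%E.
Proof.
move=> my iy ye mB cB iB; set E := [set w | _].
pose bad (b : {set 'I_n}) := [set w | label_count b y e w <= k%:R / 16].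
have sbad b : sigma_rv y (bad b).
  rewrite (_ : bad b = label_count b y e @^-1` `]-oo, k%:R / 16]); last first.
    by apply/seteqP; split => w /=; rewrite in_itv.
  rewrite (_ : label_count b y e =
      (fun w => \sum_(i <- [seq i <- index_enum 'I_n | i \in b]) \1_[set e] (y i w))).
    apply: sigma_rv_preimage => //.
    have m1 : measurable_fun setT (\1_[set e] : R -> R) by exact: measurable_indic.
    apply: measurable_sum => i.
    exact: (measurableT_comp m1 (measurable_sigma_rv_type (F := y) i)).
  by apply/funext => w; rewrite big_filter.
have mbad b : measurable (bad b) by exact: sigma_rv_measurable (sbad b).
pose A b := B @^-1` [set b] `&` bad b.
have sB b : sigma_discrete B (B @^-1` [set b]) by exists [set b].
have mA b : measurable (A b) by apply: measurableI => //; exact: mB.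
have PA b : P (A b) = (P (B @^-1` [set b]) * P (bad b))%E.
  have := iB [set: bool]%SET (fun c => if c then B @^-1` [set b] else bad b).
  rewrite (_ : \bigcap_(i in _) _ = A b); last first.
    apply/seteqP; split => w /=.
      by move=> h; split; [apply: (h true)|apply: (h false)]; rewrite /= inE.
    by case=> h1 h2 [].
  move=> ->; last by case=> _; [exact: sB|exact: sbad].
  by rewrite (eq_bigl predT) ?big_bool// => i; rewrite inE.
have mE : measurable E.
  rewrite (_ : E = \big[setU/set0]_(b : {set 'I_n}) A b).
    by apply: bigsetU_measurable.
  rewrite -bigcup_seq; apply/seteqP; split => w /=.
    by move=> Ew; exists (B w) => //=; rewrite mem_index_enum.
  by case=> b _ [/= Bb]; rewrite /bad /E /= Bb.
apply: (@le_trans _ _ (\sum_(b in [set: {set 'I_n}]%SET) P (A b))%E).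
  by apply: union_bound => // w Ew; exists (B w); rewrite ?inE.
apply: (@le_trans _ _ (\sum_(b in [set: {set 'I_n}]%SET)
    P (B @^-1` [set b]) * (expR (- (k%:R / 4)))%:E)%E).
  apply: lee_sum => b _; rewrite PA; have [bk|bk] := eqVneq #|b| k.
    by rewrite /bad -bk; apply: lee_wpmul2l => //; exact: label_count_tail.
  rewrite (_ : B @^-1` [set b] = set0) ?measure0 ?mul0e//.
  by apply/seteqP; split => w //= Bb; move: bk; rewrite -Bb cB eqxx.
rewrite -ge0_sume_distrl//.
have -> : (\sum_(b in [set: {set 'I_n}]%SET) P (B @^-1` [set b]) = P setT)%E.
  rewrite (_ : setT = \bigcup_(b in [set` enum [set: {set 'I_n}]%SET]) B @^-1` [set b]).
    rewrite measure_fin_bigcup//=.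
    - by rewrite -fsbig_seq ?enum_uniq// big_enum.
    - by move=> b c _ _ [w [/= <- <-]].
    - by move=> b _; exact: mB.
  by apply/seteqP; split => // w _; exists (B w) => //=; rewrite mem_enum inE.
by rewrite probability_setT mul1e.
Qed.

End Labels.

(** * Gradient descent *)

Section SumSquares.
Context {R : realType}.

Lemma sqr_sum_le (k : nat) (a : 'I_k -> R) :
  (\sum_j a j) ^+ 2 <= k%:R * \sum_j a j ^+ 2.
Proof.
have := cauchy_schwarz_sqr (\row_j a j) (\row__ 1 : 'rV[R]_k).
rewrite /dotp; under eq_bigr do rewrite !mxE mulr1.
under [X in _ <= X * _]eq_bigr do rewrite !mxE -expr2.
under [X in _ <= _ * X]eq_bigr do rewrite !mxE mulr1.
by rewrite sumr_const card_ord mulrC.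
Qed.

Lemma linear_sqr_unbounded (a b c q : R) : 0 < a -> 0 <= b -> 0 <= q ->
  ~ (forall t : nat, (c + t%:R * a) ^+ 2 <= q + t%:R * b).
Proof.
move=> a0 b0 q0 H.
(* Beyond the first summand [c + t a >= t a / 2]; beyond the second
   [(t a / 2)^2 > t (q + b) >= q + t b]. *)
pose x := 2 * `|c| / a + 4 * (q + b) / a ^+ 2.
have x0 : 0 <= x.
  by rewrite addr_ge0// divr_ge0 ?mulr_ge0 ?addr_ge0 ?sqr_ge0// ltW.
pose t := (Num.truncn x).+1.
have xt : x < t%:R by rewrite truncnS_gt.
have t1 : 1 <= t%:R :> R by rewrite ler1n.
have h1 : 2 * `|c| <= t%:R * a.
  rewrite -ler_pdivrMr// (le_trans _ (ltW xt))// lerDl divr_ge0 ?sqr_ge0//.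
  by rewrite mulr_ge0// addr_ge0.
have h2 : 4 * (q + b) < t%:R * a ^+ 2.
  rewrite -ltr_pdivrMr ?exprn_gt0// (le_lt_trans _ xt)// lerDr divr_ge0 ?mulr_ge0//.
  exact: ltW.
have h3 : (t%:R * a / 2) ^+ 2 <= (c + t%:R * a) ^+ 2.
  have hc := ler_norm (- c); rewrite normrN in hc.
  by rewrite lerXn2r ?nnegrE; nra.
have := le_trans h3 (H t).
have -> : (t%:R * a / 2) ^+ 2 = t%:R * (t%:R * a ^+ 2) / 4 by field.
have : t%:R * (4 * (q + b)) < t%:R * (t%:R * a ^+ 2).
  by rewrite ltr_pM2l// (lt_le_trans _ t1).
have : q <= t%:R * q by rewrite ler_peMl.
lra.
Qed.

End SumSquares.

Section GradientDescent.
Context {R : realType} {n d m : nat}.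
Variables (alpha eta : R) (X : 'M[R]_(n, d)) (yhat : 'I_n -> R).
Hypothesis alpha01 : 0 < alpha <= 1.
Hypothesis eta0 : 0 < eta.
Hypothesis m0 : (0 < m)%N.
Hypothesis yhat_sgn : forall i, yhat i = 1 \/ yhat i = -1.

Let alpha0 : 0 < alpha. Proof. by case/andP: alpha01. Qed.
Let alpha1 : alpha <= 1. Proof. by case/andP: alpha01. Qed.

Notation sgn := (@neuron_sign R m).
Notation net := (net alpha).
Notation step := (@gd_step R d m alpha n eta X yhat).
Notation active W i := (yhat i * net W (row i X) < 1).

Lemma neuron_signE j : sgn j * sgn j = 1.
Proof. by rewrite /neuron_sign -expr2 sqrr_sign. Qed.

Lemma dlrelu_bounds z : alpha <= dlrelu alpha z <= 1.
Proof. by rewrite /dlrelu; case: ifP => _; rewrite lexx ?alpha1. Qed.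

Lemma dlreluM z : dlrelu alpha z * z = lrelu alpha z.
Proof.
rewrite /dlrelu /lrelu; case: leP => z0.
  by rewrite mul1r max_l// ler_piMl.
by rewrite max_r//; have := alpha1; nra.
Qed.

Let gsum (W : 'M[R]_(2 * m, d)) j : 'rV[R]_d := \sum_(i < n | active W i)
  (yhat i * dlrelu alpha (dotp (row j W) (row i X))) *: row i X.

Lemma gd_step_row W j : row j (step W) = row j W + (eta * sgn j) *: gsum W j.
Proof. by rewrite /gd_step rowK. Qed.

Lemma gd_step_fixed W : (forall i, ~~ (active W i)) -> step W = W.
Proof.
move=> FW; apply/row_matrixP => j; rewrite gd_step_row /gsum big1 ?scaler0 ?addr0//.
by move=> i; rewrite (negbTE (FW i)).
Qed.

Section Perceptron.
Variable ws : 'rV[R]_d.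
Hypothesis wsP : forall i, yhat i * dotp (row i X) ws = 1.

(* Perceptron argument: while some example is active, [V] and [Q] grow by at
   least, resp. at most, a constant per step, but [V ^+ 2] is [O(Q)]. *)
Let V (W : 'M[R]_(2 * m, d)) := \sum_j sgn j * dotp (row j W) ws.
Let Q (W : 'M[R]_(2 * m, d)) := \sum_j dotp (row j W) (row j W).
Let xs := \sum_i enorm (row i X).

Let V_step W : (exists i, active W i) ->
  V W + (2 * m)%:R * (eta * alpha) <= V (step W).
Proof.
move=> [i0 i0F].
have -> : (2 * m)%:R * (eta * alpha) = \sum_(j < 2 * m) eta * alpha.
  by rewrite sumr_const card_ord mulr_natl.
rewrite /V -big_split/=; apply: ler_sum => j _.
rewrite gd_step_row dotpDl dotpZl mulrDr lerD2l.
rewrite [leRHS](_ : _ = sgn j * sgn j * (eta * dotp (gsum W j) ws)); last by ring.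
rewrite neuron_signE mul1r ler_pM2l//.
rewrite /gsum dotp_suml (bigD1 i0)//= -[leLHS]addr0 lerD//.
  rewrite dotpZl mulrAC wsP mul1r.
  by case/andP: (dlrelu_bounds (dotp (row j W) (row i0 X))).
apply: sumr_ge0 => i _; rewrite dotpZl mulrAC wsP mul1r.
by case/andP: (dlrelu_bounds (dotp (row j W) (row i X))) => /(le_trans (ltW alpha0)).
Qed.

(** By [dlreluM] the network is recovered from its gradient, so the cross term is [2 * eta] times
    the sum of the margins of the active examples, each of which is below 1. *)
Let Q_step W : Q (step W) <= Q W + (2 * eta * n%:R + (2 * m)%:R * (eta * xs) ^+ 2).
Proof.
have gs j : enorm (gsum W j) <= xs.
  rewrite (le_trans (ler_enorm_sum _ _ _))// /xs big_mkcond/=; apply: ler_sum => i _.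
  case: ifP => _; last exact: enorm_ge0.
  rewrite enormZ ler_piMl ?enorm_ge0// normrM.
  have -> : `|yhat i| = 1 by case: (yhat_sgn i) => ->; rewrite ?normrN normr1.
  have /andP[h1 h2] := dlrelu_bounds (dotp (row j W) (row i X)).
  by rewrite mul1r ger0_norm// (le_trans (ltW alpha0)).
have -> : Q (step W) = Q W + 2 * eta * (\sum_j sgn j * dotp (row j W) (gsum W j)) +
    eta ^+ 2 * \sum_j dotp (gsum W j) (gsum W j).
  rewrite /Q !mulr_sumr -!big_split/=; apply: eq_bigr => j _.
  rewrite gd_step_row dotpDl !dotpDr !dotpZl !dotpZr (dotpC (gsum W j)).
  have := neuron_signE j; set s := sgn j => s1.
  rewrite (_ : eta * s * (eta * s * dotp (gsum W j) (gsum W j)) =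
     (s * s) * (eta ^+ 2 * dotp (gsum W j) (gsum W j))); last by ring.
  by rewrite s1; ring.
rewrite -addrA lerD2l lerD//.
  rewrite ler_pM2l ?mulr_gt0//.
  have -> : \sum_j sgn j * dotp (row j W) (gsum W j) =
      \sum_(i | active W i) yhat i * net W (row i X).
    under eq_bigr do rewrite /gsum dotp_sumr mulr_sumr.
    rewrite exchange_big/=; apply: eq_bigr => i _; rewrite /net mulr_sumr.
    by apply: eq_bigr => j _; rewrite dotpZr -dlreluM; ring.
  apply: (@le_trans _ _ (\sum_(i | active W i) 1)); first by apply: ler_sum => i /ltW.
  rewrite big_mkcond/=; apply: (@le_trans _ _ (\sum_(i < n) 1)).
    by apply: ler_sum => i _; case: ifP.
  by rewrite sumr_const card_ord.
rewrite exprMn mulrCA ler_pM2l ?exprn_gt0//.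
apply: (@le_trans _ _ (\sum_(j < 2 * m) xs ^+ 2)).
  apply: ler_sum => j _; rewrite -sqr_enorm lerXn2r ?nnegrE ?enorm_ge0//.
  by apply: sumr_ge0 => i _; exact: enorm_ge0.
by rewrite sumr_const card_ord mulr_natl.
Qed.

Let VQ W : V W ^+ 2 <= (2 * m)%:R * (dotp ws ws * Q W).
Proof.
rewrite (le_trans (sqr_sum_le _))// ler_wpM2l// /Q mulr_sumr; apply: ler_sum => j _.
rewrite exprMn [sgn j ^+ 2]expr2 neuron_signE mul1r mulrC.
exact: cauchy_schwarz_sqr.
Qed.

Lemma gd_margin_reached (W0 : 'M[R]_(2 * m, d)) :
  exists t, forall i, ~~ (active (gd alpha eta X yhat W0 t) i).
Proof.
apply: contrapT => H.
have F t : exists i, active (gd alpha eta X yhat W0 t) i.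
  apply: contrapT => Ft; apply: H; exists t => i; apply/negP => Fi.
  by apply: Ft; exists i.
set a := (2 * m)%:R * (eta * alpha).
set b := 2 * eta * n%:R + (2 * m)%:R * (eta * xs) ^+ 2.
have a0 : 0 < a by rewrite mulr_gt0 ?mulr_gt0// ltr0n muln_gt0.
have b0 : 0 <= b.
  by rewrite addr_ge0// mulr_ge0 ?sqr_ge0// mulr_ge0// ltW.
have Vt t : V W0 + t%:R * a <= V (gd alpha eta X yhat W0 t).
  elim: t => [|t IH]; first by rewrite mul0r addr0.
  rewrite /gd iterS (le_trans _ (V_step (F t)))// -/a -natr1 mulrDl mul1r addrA.
  by rewrite lerD2r.
have Qt t : Q (gd alpha eta X yhat W0 t) <= Q W0 + t%:R * b.
  elim: t => [|t IH]; first by rewrite mul0r addr0.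
  rewrite /gd iterS -/(gd _ _ _ _ _ _); apply: le_trans (Q_step _) _.
  by rewrite -/b -natr1 mulrDl mul1r [leRHS]addrA lerD2r.
pose c := (2 * m)%:R * dotp ws ws.
have c0 : 0 <= c by rewrite mulr_ge0// dotp_ge0.
have Q0 : 0 <= Q W0 by apply: sumr_ge0 => j _; exact: dotp_ge0.
have sq (x y : R) : x <= y -> 0 <= x -> x ^+ 2 <= y ^+ 2.
  by move=> xy x0; rewrite lerXn2r ?nnegrE// (le_trans x0).
(* Time is counted from [t0], when the lower bound on [V] has become nonnegative and may be
   squared. *)
pose t0 := (Num.truncn (`|V W0| / a)).+1.
have t0V : 0 <= V W0 + t0%:R * a.
  have : `|V W0| <= t0%:R * a by rewrite -ler_pdivrMr// ltW// truncnS_gt.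
  by have := ler_norm (- V W0); rewrite normrN; lra.
apply: (@linear_sqr_unbounded _ a (c * b) (V W0 + t0%:R * a) (c * (Q W0 + t0%:R * b))) => //.
- by rewrite mulr_ge0.
- by rewrite mulr_ge0// addr_ge0// mulr_ge0.
move=> t; apply: (@le_trans _ _ (V (gd alpha eta X yhat W0 (t0 + t)) ^+ 2)).
  apply: sq; last by rewrite addr_ge0// mulr_ge0// ltW.
  by rewrite (le_trans _ (Vt _))// natrD mulrDl addrA.
rewrite (le_trans (VQ _))// mulrA -/c mulrCA -mulrDr ler_wpM2l//.
by rewrite (le_trans (Qt _))// natrD mulrDl addrA.
Qed.

(** Once no example is active the step is the identity, so the iterates are eventually constant and
    the limit inherits all the margins. *)
Lemma gd_cvg (W0 : 'M[R]_(2 * m, d)) : exists t,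
  (forall i, ~~ (active (gd alpha eta X yhat W0 t) i)) /\
  cvgn (gd alpha eta X yhat W0) /\
  A_GD alpha eta X yhat W0 = gd alpha eta X yhat W0 t.
Proof.
have [t Ft] := gd_margin_reached W0; exists t; split=> //.
have gdE s : gd alpha eta X yhat W0 (t + s) = gd alpha eta X yhat W0 t.
  elim: s => [|s IH]; first by rewrite addn0.
  by rewrite addnS /gd iterS -/(gd _ _ _ _ _ _) IH; exact: gd_step_fixed.
have C : gd alpha eta X yhat W0 s @[s --> \oo] --> gd alpha eta X yhat W0 t.
  apply: cvg_near_cst; near=> s.
  have ts : (t <= s)%N by near: s; exact: nbhs_infty_ge.
  by rewrite -(subnKC ts) gdE.
split; first by apply/cvg_ex; exists (gd alpha eta X yhat W0 t).
by apply/cvg_lim => //; exact: norm_hausdorff.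
Unshelve. all: by end_near. Qed.

End Perceptron.

(** [L i] is [eta] times the number of steps at which example [i] was active, and [l j i] weights
    these steps by slopes in [[alpha, 1]]. That [L] is common to all neurons is what makes their
    dual vectors comparable. *)
Lemma gd_dual (W0 : 'M[R]_(2 * m, d)) t : exists (L : 'I_n -> R) (l : 'I_(2 * m) -> 'I_n -> R),
  (forall i, 0 <= L i) /\
  (forall j i, alpha * L i <= l j i <= L i) /\
  (forall j, row j (gd alpha eta X yhat W0 t) =
    row j W0 + sgn j *: \sum_i (l j i * yhat i) *: row i X).
Proof.
elim: t => [|t [L [l [L0 [lL Wt]]]]].
  exists (fun=> 0), (fun _ _ => 0); split=> //; split => [j i|j].
    by rewrite mulr0 lexx.
  by rewrite big1 ?scaler0 ?addr0// => i _; rewrite mul0r scale0r.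
set W := gd alpha eta X yhat W0 t in Wt.
pose e i : R := if active W i then eta else 0.
exists (fun i => L i + e i),
  (fun j i => l j i + e i * dlrelu alpha (dotp (row j W) (row i X))).
have e0 i : 0 <= e i by rewrite /e; case: ifP => // _; exact: ltW.
split=> [i|]; first by rewrite addr_ge0.
split.
  move=> j i; have /andP[h1 h2] := lL j i.
  have /andP[g1 g2] := dlrelu_bounds (dotp (row j W) (row i X)).
  have ei := e0 i.
  by apply/andP; split; nra.
move=> j; rewrite /gd iterS -/(gd _ _ _ _ _ _) gd_step_row -/W.
have -> : gsum W j = eta^-1 *: \sum_i
    (e i * dlrelu alpha (dotp (row j W) (row i X)) * yhat i) *: row i X.
  rewrite scaler_sumr /gsum big_mkcond/=; apply: eq_bigr => i _; rewrite /e.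
  case: ifP => _; last by rewrite !mul0r scale0r scaler0.
  by rewrite scalerA; congr (_ *: _); field; rewrite gt_eqF.
rewrite scalerA mulrAC mulfV ?gt_eqF// mul1r [X in X + _ = _]Wt -addrA -scalerDr -big_split/=.
by congr (_ + _ *: _); apply: eq_bigr => i _; rewrite -scalerDl mulrDl.
Qed.

End GradientDescent.

(** * Margin and test error of the limit network *)

Section LeakyRelu.
Context {R : realType}.
Variable alpha : R.
Hypothesis alpha01 : 0 < alpha <= 1.

Lemma lrelu_lipschitz a b : `|lrelu alpha a - lrelu alpha b| <= `|a - b|.
Proof.
case/andP: alpha01 => a0 a1; rewrite -!dlreluM// /dlrelu ler_norml.
have := ler_norm (a - b); have := ler_norm (- (a - b)); rewrite normrN.
by case: (leP 0 a) => ha; case: (leP 0 b) => hb *; apply/andP; split; nra.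
Qed.

Lemma lreluBN z : lrelu alpha z - lrelu alpha (- z) = (1 + alpha) * z.
Proof.
rewrite -!dlreluM// /dlrelu oppr_ge0; case: (leP 0 z) => z0; last first.
  by rewrite ltW//; ring.
case: (leP z 0) => z1; last by ring.
by rewrite (_ : z = 0); [rewrite oppr0 !mulr0 subr0|lra].
Qed.

Definition signed_sum d m (W : 'M[R]_(2 * m, d)) : 'rV[R]_d :=
  \sum_j @neuron_sign R m j *: row j W.

Lemma net_odd_part d m (W : 'M[R]_(2 * m, d)) (x : 'rV[R]_d) :
  net alpha W x - net alpha W (- x) = (1 + alpha) * dotp (signed_sum W) x.
Proof.
rewrite /net -sumrB /signed_sum dotp_suml mulr_sumr; apply: eq_bigr => j _.
by rewrite dotpNr -mulrBr lreluBN dotpZl; ring.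
Qed.

Lemma net_lipschitz d m (W : 'M[R]_(2 * m, d)) (x z : 'rV[R]_d) :
  `|net alpha W x - net alpha W z| <= \sum_j `|dotp (row j W) (x - z)|.
Proof.
rewrite /net -sumrB (le_trans (ler_norm_sum _ _ _))//; apply: ler_sum => j _.
rewrite -mulrBr normrM /neuron_sign normrX normrN normr1 expr1n mul1r dotpBr.
exact: lrelu_lipschitz.
Qed.

End LeakyRelu.

Section DualWeights.
Context {R : realType}.

(* [sum_j |l_j| <= |sum_j l_j| / sqrt alpha]: each [l_j] lies between
   [alpha L] and [L], and multiplying the two bounds [|sum l| |L| >= sum |l_j|^2]
   and [|sum l| >= N alpha |L|] loses only one factor [alpha]. *)
Lemma sum_enorm_le (n N : nat) (alpha : R) (L : 'rV[R]_n)
    (l : 'I_N -> 'rV[R]_n) : 0 < alpha ->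
  (forall j i, alpha * L 0 i <= l j 0 i <= L 0 i) -> (forall i, 0 <= L 0 i) ->
  Num.sqrt alpha * \sum_j enorm (l j) <= enorm (\sum_j l j).
Proof.
move=> a0 lL L0; set A := \sum_j l j.
have l0 j i : 0 <= l j 0 i.
  by case/andP: (lL j i) => /(le_trans (mulr_ge0 (ltW a0) (L0 i))).
have AE i : A 0 i = \sum_j l j 0 i by rewrite summxE.
have h1 : N%:R * alpha * enorm L <= enorm A.
  have <- : enorm ((N%:R * alpha) *: L) = N%:R * alpha * enorm L.
    by rewrite enormZ ger0_norm// mulr_ge0// ltW.
  rewrite /enorm ler_sqrt ?dotp_ge0//; apply: ler_sum => i _.
  have p : 0 <= ((N%:R * alpha) *: L) 0 i by rewrite mxE mulr_ge0// mulr_ge0// ltW.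
  have q : ((N%:R * alpha) *: L) 0 i <= A 0 i.
    rewrite mxE AE -mulrA mulr_natl -[X in _ *+ X]card_ord -sumr_const.
    by apply: ler_sum => j _; case/andP: (lL j i).
  exact: ler_pM.
have h2 : \sum_j enorm (l j) ^+ 2 <= enorm A * enorm L.
  apply: le_trans (le_trans (ler_norm _) (cauchy_schwarz A L)).
  rewrite /A dotp_suml; apply: ler_sum => j _; rewrite sqr_enorm.
  by apply: ler_sum => i _; rewrite ler_wpM2l//; case/andP: (lL j i).
have h3 := sqr_sum_le (fun j => enorm (l j)).
have s0 : 0 <= \sum_j enorm (l j) by apply: sumr_ge0 => j _; exact: enorm_ge0.
rewrite -(ler_pXn2r (ltn0Sn 1)) ?nnegrE ?enorm_ge0 ?mulr_ge0 ?sqrtr_ge0//.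
rewrite exprMn sqr_sqrtr ?(ltW a0)//.
apply: (@le_trans _ _ (enorm A * (N%:R * alpha * enorm L))).
  have := ler_wpM2l (ltW a0) (le_trans h3 (ler_wpM2l (ler0n R N) h2)).
  by move=> h; rewrite (le_trans h)// le_eqVlt; apply/orP; left; apply/eqP; ring.
by rewrite expr2 ler_wpM2l ?enorm_ge0.
Qed.

End DualWeights.

Section MarginBound.
Context {R : realType} {n d m : nat}.
Variables (alpha gamma : R) (v : 'rV[R]_d) (X : 'M[R]_(n, d)) (yhat ys : 'I_n -> R).
Variables (Y : 'M[R]_(n, d)).
Let g := Num.sqrt gamma.
Let rho := Num.sqrt (1 - gamma).
Hypothesis alpha01 : 0 < alpha <= 1.
Hypothesis gamma01 : 0 < gamma < 1.
Hypothesis v1 : dotp v v = 1.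
Hypothesis XE : forall i, row i X = (g * ys i) *: v + rho *: row i Y.
Hypothesis Yv : forall i, dotp (row i Y) v = 0.
Hypothesis Yop : forall u, enorm (u *m Y) <= 12 * enorm u.
Hypothesis Ylow : forall u, enorm u <= 32 * enorm (u *m Y).
Hypothesis yhat_sgn : forall i, yhat i = 1 \/ yhat i = -1.

Let alpha0 : 0 < alpha. Proof. by case/andP: alpha01. Qed.
Let alpha1 : alpha <= 1. Proof. by case/andP: alpha01. Qed.
Let rho0 : 0 < rho.
Proof. by rewrite sqrtr_gt0 subr_gt0; case/andP: gamma01. Qed.
Let rho1 : rho <= 1.
Proof.
rewrite -[leRHS]sqrtr1 ler_sqrt// lerBlDr lerDl.
by case/andP: gamma01 => /ltW.
Qed.

Definition orth (w : 'rV[R]_d) : 'rV[R]_d := w - dotp w v *: v.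

Lemma enorm_orth w : enorm (orth w) <= enorm w.
Proof.
rewrite /enorm ler_sqrt ?dotp_ge0// /orth dotpBl !dotpBr !dotpZl !dotpZr v1.
by rewrite (dotpC v w); nra.
Qed.

Lemma orthD w1 w2 : orth (w1 + w2) = orth w1 + orth w2.
Proof. by rewrite /orth dotpDl scalerDl opprD addrACA. Qed.

Lemma orthZ a w : orth (a *: w) = a *: orth w.
Proof. by rewrite /orth dotpZl -scalerA scalerBr. Qed.

Lemma orth_sum (I : finType) (w : I -> 'rV[R]_d) :
  orth (\sum_i w i) = \sum_i orth (w i).
Proof.
apply: (big_morph orth orthD); by rewrite /orth dotp0l scale0r subr0.
Qed.

Lemma orth_row i : orth (row i X) = rho *: row i Y.
Proof.
rewrite XE orthD !orthZ /orth v1 scale1r subrr scaler0 add0r.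
by rewrite Yv scale0r subr0.
Qed.

(** The transpose inherits the operator norm bound by duality, and it kills the component of [w]
    along [v]. *)
Lemma enorm_dual w : enorm (w *m Y^T) <= 12 * enorm (orth w).
Proof.
set c := w *m Y^T; have [c0|c0] := eqVneq (enorm c) 0.
  by rewrite c0 mulr_ge0 ?enorm_ge0.
have cpos : 0 < enorm c by rewrite lt_neqAle eq_sym c0 enorm_ge0.
rewrite -(ler_pM2l cpos) -expr2 sqr_enorm.
have -> : dotp c c = dotp (c *m Y) (orth w).
  rewrite dotp_mulmx /c /orth mulmxBl -scalemxAl.
  have -> : v *m Y^T = 0.
    apply/rowP => i; rewrite mxE [RHS]mxE -[RHS](Yv i) dotpC.
    by apply: eq_bigr => l _; rewrite !mxE.
  by rewrite scaler0 subr0.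
rewrite (le_trans (ler_norm _))// (le_trans (cauchy_schwarz _ _))//.
by rewrite mulrA [_ * 12]mulrC ler_wpM2r ?enorm_ge0.
Qed.

Variables (W0 W : 'M[R]_(2 * m, d)) (lam : R) (L : 'I_n -> R) (l : 'I_(2 * m) -> 'I_n -> R).
Hypothesis W0lam : forall j, enorm (row j W0) <= lam.
Hypothesis L0 : forall i, 0 <= L i.
Hypothesis lL : forall j i, alpha * L i <= l j i <= L i.
Hypothesis WE : forall j, row j W =
  row j W0 + @neuron_sign R m j *: \sum_i (l j i * yhat i) *: row i X.
Hypothesis margin : forall i, 1 <= yhat i * net alpha W (row i X).
Hypothesis lam_small : (2 * m)%:R * lam <= 64 * Num.sqrt alpha.

Let a j : 'rV[R]_n := \row_i (l j i * yhat i).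
Let S := \sum_j enorm (orth (row j W)).

Let norm_sgn j : `|@neuron_sign R m j| = 1 :> R.
Proof. by rewrite /neuron_sign normrX normrN1 expr1n. Qed.

Let orth_rowW j : orth (row j W) =
  orth (row j W0) + (@neuron_sign R m j * rho) *: (a j *m Y).
Proof.
rewrite WE orthD orthZ orth_sum -scalerA; congr (_ + _ *: _).
rewrite mulmx_sum_row scaler_sumr; apply: eq_bigr => i _.
by rewrite orthZ orth_row mxE !scalerA mulrC.
Qed.

(** The labels flip coordinates simultaneously in all [a j], which changes neither side, so
    [sum_enorm_le] applies to the nonnegative weights. *)
Let enorm_sum_a : Num.sqrt alpha * \sum_j enorm (a j) <= enorm (\sum_j a j).
Proof.
have yy i : yhat i * yhat i = 1 by case: (yhat_sgn i) => ->; rewrite ?mulrNN mulr1.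
pose l' j : 'rV[R]_n := \row_i l j i.
have e1 j : enorm (a j) = enorm (l' j).
  rewrite /enorm; congr Num.sqrt; apply: eq_bigr => i _; rewrite !mxE.
  by rewrite mulrACA yy mulr1.
have e2 : enorm (\sum_j a j) = enorm (\sum_j l' j).
  rewrite /enorm; congr Num.sqrt; apply: eq_bigr => i _; rewrite !summxE.
  have -> : \sum_j a j 0 i = (\sum_j l' j 0 i) * yhat i.
    by rewrite mulr_suml; apply: eq_bigr => j _; rewrite !mxE.
  by rewrite mulrACA yy mulr1.
rewrite e2 (eq_bigr (fun j => enorm (l' j))) => [|j _]; last exact: e1.
have [m0|m0] := posnP m.
  rewrite [X in _ * X]big1 ?mulr0 ?enorm_ge0// => j _; exfalso.
  by have := ltn_ord j; move: (nat_of_ord j) => i; rewrite m0 muln0.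
apply: (@sum_enorm_le _ _ _ _ (\row_i L i)) => // [j i|i]; first by rewrite !mxE.
by rewrite mxE.
Qed.

Let twice_m (c : R) : \sum_(j < 2 * m) c = (2 * m)%:R * c.
Proof. by rewrite sumr_const card_ord mulr_natl. Qed.

Let S_le : S <= (2 * m)%:R * lam + 12 * rho * \sum_j enorm (a j).
Proof.
rewrite mulr_sumr -twice_m -big_split/=; apply: ler_sum => j _.
rewrite orth_rowW (le_trans (ler_enormD _ _))// lerD//.
  by rewrite (le_trans (enorm_orth _)).
rewrite enormZ normrM norm_sgn mul1r (ger0_norm (ltW rho0)) [12 * _]mulrC -mulrA.
by rewrite ler_wpM2l ?Yop// ltW.
Qed.

(** In the signed sum the neuron signs cancel, so its noise part is [rho] times [\sum_j a j] applied
    to [Y], up to the initial weights; the lower singular value bound inverts this. *)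
Let rho_a_le : rho * enorm (\sum_j a j) <=
  32 * (enorm (orth (signed_sum W)) + (2 * m)%:R * lam).
Proof.
have E : orth (signed_sum W) = \sum_j @neuron_sign R m j *: orth (row j W0) +
    rho *: ((\sum_j a j) *m Y).
  rewrite /signed_sum orth_sum mulmx_suml scaler_sumr -big_split/=.
  apply: eq_bigr => j _; rewrite orthZ orth_rowW scalerDr scalerA mulrA.
  by rewrite neuron_signE mul1r.
have h : enorm (rho *: ((\sum_j a j) *m Y)) <=
    enorm (orth (signed_sum W)) + (2 * m)%:R * lam.
  rewrite -[X in enorm X <= _](addKr (\sum_j @neuron_sign R m j *: orth (row j W0))) -E.
  rewrite addrC (le_trans (ler_enormD _ _))// lerD2l enormN.
  rewrite (le_trans (ler_enorm_sum _ _ _))// -twice_m; apply: ler_sum => j _.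
  by rewrite enormZ norm_sgn mul1r (le_trans (enorm_orth _)).
rewrite enormZ (ger0_norm (ltW rho0)) in h.
have := ler_wpM2l (ltW rho0) (Ylow (\sum_j a j)); lra.
Qed.

(** This limits cancellation between neurons: their total noise norm exceeds that of the signed sum
    by at most a factor of order [1 / sqrt alpha]. The summands 64 come from the initial weights. *)
Let S_bound : S <= 64 + 12 * 32 * (64 + enorm (orth (signed_sum W)) / Num.sqrt alpha).
Proof.
set e := enorm (orth _); have sa0 : 0 < Num.sqrt alpha by rewrite sqrtr_gt0.
have sa1 : Num.sqrt alpha <= 1 by rewrite -[leRHS]sqrtr1 ler_sqrt.
apply: (le_trans S_le).
have h1 : rho * \sum_j enorm (a j) <= 32 * (e + (2 * m)%:R * lam) / Num.sqrt alpha.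
  rewrite ler_pdivlMr// -mulrA [_ * Num.sqrt alpha]mulrC.
  by rewrite (le_trans _ rho_a_le)// ler_wpM2l ?enorm_sum_a// ltW.
have h2 : (2 * m)%:R * lam / Num.sqrt alpha <= 64 by rewrite ler_pdivrMr.
have -> : 12 * rho * \sum_j enorm (a j) = 12 * (rho * \sum_j enorm (a j)) by rewrite mulrA.
have : 32 * (e + (2 * m)%:R * lam) / Num.sqrt alpha =
  32 * (e / Num.sqrt alpha) + 32 * ((2 * m)%:R * lam / Num.sqrt alpha) by field; rewrite gt_eqF.
have h0 : (2 * m)%:R * lam <= 64.
  by rewrite (le_trans lam_small)// ler_piMr.
by move: h0 h1 h2; lra.
Qed.

(** Cauchy-Schwarz over the examples of [I] bounds their sum by [sqrt #|I|] times an operator norm,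
    so the average gains [1 / sqrt #|I|]. *)
Let sum_row_le (I : {set 'I_n}) (q : R) : 0 < q -> q <= #|I|%:R ->
  forall c, (forall i, i \in I -> c <= \sum_j `|dotp (row j W) (orth (row i X))|) ->
  c <= 12 * rho * S / Num.sqrt q.
Proof.
move=> q0 qI c cI; have Ipos : 0 < #|I|%:R :> R by exact: lt_le_trans qI.
have [c0|c0] := leP c 0.
  rewrite (le_trans c0)// divr_ge0 ?sqrtr_ge0// !mulr_ge0 ?(ltW rho0)//.
  by apply: sumr_ge0 => j _; exact: enorm_ge0.
have B j : \sum_(i in I) `|dotp (row j W) (orth (row i X))| <=
    Num.sqrt #|I|%:R * (12 * rho * enorm (orth (row j W))).
  pose b : 'rV[R]_n := \row_i (if i \in I then 1 else 0).
  pose t : 'rV[R]_n := \row_i `|dotp (row j W) (row i Y)|.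
  have -> : \sum_(i in I) `|dotp (row j W) (orth (row i X))| = rho * dotp b t.
    rewrite [dotp b t]/dotp mulr_sumr [LHS]big_mkcond/=; apply: eq_bigr => i _.
    rewrite [b 0 i]mxE [t 0 i]mxE; case: ifP => _; last by rewrite mul0r mulr0.
    by rewrite orth_row dotpZr normrM mul1r (ger0_norm (ltW rho0)).
  have bE : enorm b = Num.sqrt #|I|%:R.
    rewrite /enorm; congr Num.sqrt; rewrite -sum1_card natr_sum /dotp [RHS]big_mkcond/=.
    by apply: eq_bigr => i _; rewrite !mxE; case: ifP; rewrite ?mulr1 ?mulr0.
  have tE : enorm t = enorm (row j W *m Y^T).
    rewrite /enorm; congr Num.sqrt; apply: eq_bigr => i _; rewrite mxE -expr2.
    rewrite real_normK ?num_real// expr2; congr (_ * _);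
      by rewrite [RHS]mxE; apply: eq_bigr => r _; rewrite !mxE.
  have h := le_trans (ler_norm _) (cauchy_schwarz b t); rewrite bE tE in h.
  have h' := ler_wpM2l (sqrtr_ge0 #|I|%:R) (enorm_dual (row j W)).
  have := ler_wpM2l (ltW rho0) (le_trans h h').
  by move=> h''; rewrite (le_trans h'')// le_eqVlt; apply/orP; left; apply/eqP; ring.
have H : #|I|%:R * c <= Num.sqrt #|I|%:R * (12 * rho * S).
  apply: (@le_trans _ _ (\sum_(i in I) \sum_j `|dotp (row j W) (orth (row i X))|)).
    by rewrite mulr_natl -sumr_const; exact: ler_sum.
  rewrite exchange_big/= /S !mulr_sumr; exact: ler_sum.
have sI : 0 < Num.sqrt #|I|%:R :> R by rewrite sqrtr_gt0.
have sq : 0 < Num.sqrt q by rewrite sqrtr_gt0.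
rewrite ler_pdivlMr//.
have h3 : Num.sqrt q <= Num.sqrt #|I|%:R by rewrite ler_sqrt// ltW.
apply: (@le_trans _ _ (c * Num.sqrt #|I|%:R)); first by rewrite ler_pM2l.
by rewrite -(ler_pM2l sI) mulrCA -expr2 sqr_sqrtr ?(ltW Ipos)// mulrC.
Qed.

(** Flipped examples of true label 1 give [f0 + 1 <= U], those of true label -1 give [1 - f1 <= U].
    The sum isolates the odd part of the network, and its margin 2 absorbs the contribution of the
    initial weights to [2 U], which is at most 2 for [k] this large. The factor 48 is [12 * 4], the
    4 coming from [k / 16]. *)
Lemma linear_margin_bound (k : R) : (48 * (64 + 12 * 32 * 64)) ^+ 2 <= k ->
  k / 16 <= #|[set i | (yhat i == -1) && (ys i == 1)]%SET|%:R ->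
  k / 16 <= #|[set i | (yhat i == 1) && (ys i == -1)]%SET|%:R ->
  g * dotp (signed_sum W) v <=
    96 * 12 * 32 * rho * (enorm (orth (signed_sum W)) / Num.sqrt (alpha * k)).
Proof.
move=> kbig; set Bp := [set i | _]%SET; set Bn := [set i | _]%SET => kp kn.
have kpos : 0 < k by rewrite (lt_le_trans _ kbig)// exprn_gt0//; lra.
have q0 : 0 < k / 16 by rewrite divr_gt0.
set f0 := net alpha W (g *: v); set f1 := net alpha W (- (g *: v)).
have xE i : row i X = (ys i * g) *: v + orth (row i X).
  by rewrite orth_row XE (mulrC g).
have hp : f0 + 1 <= 12 * rho * S / Num.sqrt (k / 16).
  apply: (sum_row_le q0 kp) => i; rewrite inE => /andP[/eqP yi /eqP si].
  have := margin i; rewrite yi mulN1r => fi.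
  have := net_lipschitz alpha01 W (g *: v) (row i X).
  rewrite {2}xE si mul1r opprD addNKr -/f0 => /(le_trans (ler_norm _)).
  by under eq_bigr do rewrite dotpNr normrN; lra.
have hn : 1 - f1 <= 12 * rho * S / Num.sqrt (k / 16).
  apply: (sum_row_le q0 kn) => i; rewrite inE => /andP[/eqP yi /eqP si].
  have := margin i; rewrite yi mul1r => fi.
  have := net_lipschitz alpha01 W (row i X) (- (g *: v)).
  rewrite {2}xE si mulN1r scaleNr opprK addrAC addNr add0r -/f1.
  by move=> /(le_trans (ler_norm _)); lra.
have hf : f0 - f1 = (1 + alpha) * (g * dotp (signed_sum W) v).
  by rewrite net_odd_part// dotpZr.
set s := g * _ in hf *; set e := enorm _.
set U := 12 * rho * S / Num.sqrt (k / 16) in hp hn.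
have e0 : 0 <= e by exact: enorm_ge0.
have ak0 : 0 < Num.sqrt (alpha * k) by rewrite sqrtr_gt0 mulr_gt0.
have [s0|s0] := leP s 0.
  by rewrite (le_trans s0)// mulr_ge0 ?mulr_ge0 ?(ltW rho0)// divr_ge0// ltW.
have sk : Num.sqrt (k / 16) = Num.sqrt k / 4.
  rewrite sqrtrM ?(ltW kpos)// sqrtrV//; congr (_ / _).
  by rewrite (_ : 16 = 4 ^+ 2) ?sqrtr_sqr ?ger0_norm//; ring.
have skpos : 0 < Num.sqrt k by rewrite sqrtr_gt0.
have U1 : U <= 48 * rho * (64 + 12 * 32 * (64 + e / Num.sqrt alpha)) / Num.sqrt k.
  rewrite /U sk invfM invrK mulrA -[leLHS]mulrA [_^-1 * 4]mulrC mulrA.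
  rewrite ler_pM2r ?invr_gt0// -mulrA [S * 4]mulrC mulrA.
  rewrite (_ : 12 * rho * 4 = 48 * rho); last by ring.
  by rewrite ler_wpM2l ?S_bound// mulr_ge0// ltW.
have kbig' : 48 * (64 + 12 * 32 * 64) <= Num.sqrt k.
  have c0 : 0 <= 48 * (64 + 12 * 32 * 64) :> R by lra.
  by rewrite -(ler_pXn2r (ltn0Sn 1)) ?nnegrE ?sqrtr_ge0// sqr_sqrtr ?(ltW kpos).
have small : 48 * rho * (64 + 12 * 32 * 64) / Num.sqrt k <= 1.
  rewrite ler_pdivrMr// mul1r (le_trans _ kbig')// mulrAC.
  by apply: ler_piMr; [lra|exact: rho1].
have sak : Num.sqrt (alpha * k) = Num.sqrt alpha * Num.sqrt k by rewrite sqrtrM// ltW.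
have sapos : 0 < Num.sqrt alpha by rewrite sqrtr_gt0.
have key : 48 * rho * (64 + 12 * 32 * (64 + e / Num.sqrt alpha)) / Num.sqrt k =
   48 * rho * (64 + 12 * 32 * 64) / Num.sqrt k +
   48 * 12 * 32 * rho * (e / Num.sqrt (alpha * k)).
  by rewrite sak; field; rewrite !gt_eqF.
have s1 : s <= (1 + alpha) * s by rewrite mulrDl mul1r lerDl mulr_ge0// ltW.
have -> : 96 * 12 * 32 * rho * (e / Num.sqrt (alpha * k)) =
  2 * (48 * 12 * 32 * rho * (e / Num.sqrt (alpha * k))) by ring.
move: s1 hf hp hn U1 small; rewrite key; lra.
Qed.

End MarginBound.

Section TestError.
Context {R : realType} {disp : measure_display} {T : measurableType disp}.
Variable P : probability T R.

Lemma measurable_net dU (U : measurableType dU) d m (alpha : R)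
    (W : 'M[R]_(2 * m, d)) (u : 'rV[R]_d) (b : R) (Z : U -> 'rV[R]_d) :
  (forall l, measurable_fun setT (fun w => Z w 0 l)) ->
  measurable_fun setT (fun w => net alpha W (u + b *: Z w)).
Proof.
move=> mZ; apply: measurable_sum => j; apply: measurable_funM => //.
have mdot : measurable_fun setT (fun w => dotp (row j W) (u + b *: Z w)).
  under eq_fun do rewrite dotpDr dotpZr.
  apply: measurable_funD => //; apply: measurable_funM => //.
  by apply: measurable_sum => l; exact: measurable_funM.
by apply: measurable_maxr => //; exact: measurable_funM.
Qed.

Lemma measurable_set_le dU (U : measurableType dU) (f : U -> R) (c : R) :
  measurable_fun setT f -> measurable [set w | f w <= c].
Proof.
move=> mf; rewrite (_ : [set w | _] = f @^-1` `]-oo, c]).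
  by rewrite -[X in measurable X]setTI; exact: mf.
by apply/seteqP; split => w /=; rewrite in_itv.
Qed.

Lemma measurable_set_ge dU (U : measurableType dU) (f : U -> R) (c : R) :
  measurable_fun setT f -> measurable [set w | c <= f w].
Proof.
move=> mf; rewrite (_ : [set w | _] = f @^-1` `[c, +oo[).
  by rewrite -[X in measurable X]setTI; exact: mf.
by apply/seteqP; split => w /=; rewrite in_itv/= andbT.
Qed.

Variables (d m : nat) (gamma alpha : R) (v : 'rV[R]_d).
Variables (yt : T -> R) (Nt : T -> 'rV[R]_d) (S : 'M[R]_d) (G : set (set T)).
Hypothesis alpha01 : 0 < alpha <= 1.
Hypothesis ytU : uniform_sign P yt.
Hypothesis NtN : normal_vec P S Nt.
Hypothesis GT : G setT.
Hypothesis indep : mutually_independent P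
  (tnth [tuple sigma_rv (fun _ : unit => yt); sigma_rv (coords Nt); G]).
Let g := Num.sqrt gamma.
Let rho := Num.sqrt (1 - gamma).

Let indep2 (A B : set T) : sigma_rv (fun _ : unit => yt) A ->
  sigma_rv (coords Nt) B -> P (A `&` B) = (P A * P B)%E.
Proof.
move=> GA GB; have := indep (J := [set: 'I_3]%SET) (A := tnth [tuple A; B; setT]).
rewrite (_ : \bigcap_(i in _) _ = A `&` B); last first.
  apply/seteqP; split => w /=.
    move=> h; split; [apply: (h ord0)|apply: (h (lift ord0 ord0))];
      by rewrite /= inE.
  by move=> [h1 h2] [[|[|[|//]]] i3] _.
move=> ->; last by move=> [[|[|[|//]]] i3] _.
rewrite (eq_bigl predT); last by move=> i; rewrite inE.
by rewrite !big_ord_recl big_ord0 /= probability_setT !mule1.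
Qed.

(* [(y, x)] and [(- y, - x)] have the same law, and by [net_odd_part] one of them
   is misclassified whenever the linear classifier [signed_sum W] errs. *)
Lemma linear_error_le_test_error (W : 'M[R]_(2 * m, d)) :
  (P [set w | (g * dotp (signed_sum W) v +
      rho * dotp (signed_sum W) (Nt w) <= 0)%R] <=
   2%:E * test_error P gamma alpha v yt Nt W)%E.
Proof.
set lin := [set w | _].
pose A := [set z : 'rV[R]_d | net alpha W (g *: v + rho *: z) <= 0].
pose A' := [set z : 'rV[R]_d | 0 <= net alpha W (- (g *: v) + rho *: z)].
have mcoord l := @measurable_box_coord R d l.
have mA : measurable (A : set (@box_type R d)).
  exact: (@measurable_set_le _ _
    (fun z : @box_type R d => net alpha W (g *: v + rho *: (z : 'rV[R]_d)))
    0 (measurable_net _ _ _ _ mcoord)).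
have mA' : measurable (A' : set (@box_type R d)).
  exact: (@measurable_set_ge _ _
    (fun z : @box_type R d => net alpha W (- (g *: v) + rho *: (z : 'rV[R]_d)))
    0 (measurable_net _ _ _ _ mcoord)).
have mNt := NtN.1.
have sNt l := @measurable_sigma_rv_type _ _ _ _ (coords Nt) l.
have sA : sigma_rv (coords Nt) (Nt @^-1` A).
  rewrite (_ : Nt @^-1` A =
    (fun w => net alpha W (g *: v + rho *: Nt w)) @^-1` `]-oo, 0]).
    by apply: sigma_rv_preimage => //; exact: (measurable_net _ _ _ _ sNt).
  by apply/seteqP; split => w /=; rewrite in_itv.
have sA' : sigma_rv (coords Nt) (Nt @^-1` A').
  rewrite (_ : Nt @^-1` A' =
    (fun w => net alpha W (- (g *: v) + rho *: Nt w)) @^-1` `[0, +oo[).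
    by apply: sigma_rv_preimage => //; exact: (measurable_net _ _ _ _ sNt).
  by apply/seteqP; split => w /=; rewrite in_itv/= andbT.
have mPA := sigma_rv_measurable mNt sA.
have mPA' := sigma_rv_measurable mNt sA'.
have [myt y1 yN1] := ytU.
have sy e : sigma_rv (fun _ : unit => yt) (yt @^-1` [set e]).
  by apply: sigma_rv_preimage => //; exact: measurable_sigma_rv_type tt.
have my e : measurable (yt @^-1` [set e]) by exact: sigma_rv_measurable (sy e).
pose e1 := yt @^-1` [set 1] `&` Nt @^-1` A.
pose e2 := yt @^-1` [set -1] `&` Nt @^-1` A'.
have me1 : measurable e1 by exact: measurableI.
have me2 : measurable e2 by exact: measurableI.
have e12 : [disjoint e1 & e2].
  apply/disj_setPS => w [[/= h1 _] [/= h2 _]].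
  have : (1 : R) = -1 by exact: etrans (esym h1) h2.
  by lra.
have mtest : measurable [set w | yt w * net alpha W (input gamma v yt Nt w) <= 0].
  apply: measurable_set_le; apply: measurable_funM => //.
  apply: measurable_sum => j; apply: measurable_funM => //.
  have mdot : measurable_fun setT (fun w => dotp (row j W) (input gamma v yt Nt w)).
    rewrite /input; under eq_fun do rewrite dotpDr !dotpZr.
    apply: measurable_funD; first by apply: measurable_funM => //; exact: measurable_funM.
    by apply: measurable_funM => //; exact: (measurable_normal_vec_dotp NtN).
  by apply: measurable_maxr => //; exact: measurable_funM.
have t12 : (P e1 + P e2 <= test_error P gamma alpha v yt Nt W)%E.
  rewrite -measureU//; last by apply/disj_set2P.
  apply: le_measure; rewrite ?inE//; first exact: measurableU.
  move=> w [[/= yw]|[/= yw]]; rewrite /A /A' /input /= yw.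
    by rewrite mulr1 mul1r.
  by rewrite mulrN1 scaleNr mulN1r oppr_le0.
have Pe1 : (2%:E * P e1 = P (Nt @^-1` A))%E.
  by rewrite /e1 indep2// muleA y1 -EFinM mulfV// mul1e.
have Pe2 : (2%:E * P e2 = P (Nt @^-1` A'))%E.
  by rewrite /e2 indep2// muleA yN1 -EFinM mulfV// mul1e.
apply: (@le_trans _ _ (2%:E * (P e1 + P e2))%E); last by rewrite lee_pmul2l.
(* Replacing the noise by its opposite in the second event makes both events concern one point [x]
   and its opposite. *)
rewrite ge0_muleDr// Pe1 Pe2 (normal_vec_symmetric NtN mA').
have mlin : measurable lin.
  apply: measurable_set_le; apply: measurable_funD => //; apply: measurable_funM => //.
  exact: (measurable_normal_vec_dotp NtN).
have mN' : measurable ((fun w => - Nt w) @^-1` A').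
  have m1 : measurable_fun setT ((fun w => - Nt w) : T -> @box_type R d).
    apply: measurable_to_box => l; rewrite (_ : (fun w => _) = \- coords Nt l).
      by apply: measurable_funN; exact: mNt.
    by apply/funext => w; rewrite mxE.
  by rewrite -[X in measurable X]setTI; exact: m1.
apply: le_trans (measureU2 _ mPA mN'); apply: le_measure; rewrite ?inE//.
  exact: measurableU.
move=> w /= lw; rewrite /A /A' /=.
have := net_odd_part alpha01 W (g *: v + rho *: Nt w).
rewrite dotpDr !dotpZr opprD -(scalerN rho) => h.
have [le0|gt0] := leP (net alpha W (g *: v + rho *: Nt w)) 0; [by left|right].
have : (1 + alpha) * (g * dotp (signed_sum W) v +
    rho * dotp (signed_sum W) (Nt w)) <= 0.
  by case/andP: alpha01 => a0 _; rewrite pmulr_rle0// addr_gt0.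
by rewrite -h subr_le0 => /(le_trans (ltW gt0)).
Qed.

End TestError.

(** * Typical training data *)

Section GoodEvent.
Context {R : realType}.

(* [Y] stands for the matrix of the noise vectors, [ys] for the true labels. *)
Definition good_training_data n d (gamma : R) (v : 'rV[R]_d) (k : nat)
    (X : 'M[R]_(n, d)) (yhat : 'I_n -> R) : Prop :=
  exists (ys : 'I_n -> R) (Y : 'M[R]_(n, d)),
    ((forall i, row i X = (Num.sqrt gamma * ys i) *: v +
                          Num.sqrt (1 - gamma) *: row i Y) /\
     (forall i, dotp (row i Y) v = 0) /\
     (forall u, enorm (u *m Y) <= 12 * enorm u) /\
     (forall u, enorm u <= 32 * enorm (u *m Y))) /\
    ((forall i, ys i = 1 \/ ys i = -1) /\
     (forall i, yhat i = 1 \/ yhat i = -1) /\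
     k%:R / 16 <= #|[set i | (yhat i == -1) && (ys i == 1)]%SET|%:R :> R /\
     k%:R / 16 <= #|[set i | (yhat i == 1) && (ys i == -1)]%SET|%:R :> R).

Lemma card_indic n (a b : 'I_n -> R) (s t : R) :
  #|[set i | (a i == s) && (b i == t)]%SET|%:R =
  \sum_i \1_[set s] (a i) * \1_[set t] (b i) :> R.
Proof.
rewrite -sum1_card natr_sum big_mkcond/=; apply: eq_bigr => i _.
rewrite inE !indicE; have [->|ai] := eqVneq (a i) s; last first.
  by rewrite [_ \in _]memNset ?mul0r//=; apply/eqP.
rewrite mem_set//=; have [->|bi] := eqVneq (b i) t.
  by rewrite mem_set//= mulr1.
by rewrite memNset ?mulr0//=; apply/eqP.
Qed.

Lemma measurable_forall_fin dU (U : measurableType dU) (I : finType)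
    (Q : I -> U -> Prop) :
  (forall i, measurable [set w | Q i w]) -> measurable [set w | forall i, Q i w].
Proof.
move=> mQ; rewrite (_ : [set w | _] = \bigcap_(i in [set: I]) [set w | Q i w]).
  by apply: fin_bigcap_measurable.
by apply/seteqP; split => w /= h i => [_|]; exact: h.
Qed.

Lemma measurable_imply dU (U : measurableType dU) (c : Prop) (Q : U -> Prop) :
  measurable [set w | Q w] -> measurable [set w | c -> Q w].
Proof.
move=> mQ; have [hc|hc] := pselect c.
  by rewrite (_ : [set w | _] = [set w | Q w])//; apply/seteqP; split => w /=; tauto.
by rewrite (_ : [set w | _] = setT)//; apply/seteqP; split => w /=; tauto.
Qed.

Lemma measurable_pm1 dU (U : measurableType dU) (f : U -> R) :
  measurable_fun setT f -> measurable [set w | f w = 1 \/ f w = -1].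
Proof.
move=> mf; rewrite (_ : [set w | _] = f @^-1` ([set 1] `|` [set -1])).
  by rewrite -[X in measurable X]setTI; apply: mf => //; exact: measurableU.
by apply/seteqP; split => w.
Qed.

Context {disp : measure_display} {T : measurableType disp}.
Variable P : probability T R.
Variables (d n k : nat) (gamma : R) (v : 'rV[R]_d) (y : 'I_n -> T -> R)
  (N : 'I_n -> T -> 'rV[R]_d) (B : T -> {set 'I_n}).
Hypothesis v1 : dotp v v = 1.
Hypothesis gamma01 : 0 < gamma < 1.
Hypothesis yU : forall i, uniform_sign P (y i).
Hypothesis NN : forall i, normal_vec P (noise_cov v) (N i).

Let g : R := Num.sqrt gamma.
Let rho : R := Num.sqrt (1 - gamma).
Let g0 : 0 < g. Proof. by rewrite sqrtr_gt0; case/andP: gamma01. Qed.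
Let rho0 : 0 < rho.
Proof. by rewrite sqrtr_gt0 subr_gt0; case/andP: gamma01. Qed.

Let X := train_X gamma v y N.
(** True labels and noise are recovered from [X] alone, so that conditions on them define an event
    of [sigma_train]; they agree with [y] and [N] only almost surely. *)
Let ysf (i : 'I_n) (w : T) : R := g^-1 * dotp (row i (X w)) v.
Let Yf w : 'M[R]_(n, d) :=
  \matrix_i (rho^-1 *: (row i (X w) - dotp (row i (X w)) v *: v)).
Let yh := observed y B.
Let K := (12 * 32)%N.

(** Conditioning is imposed on finite nets, which keeps the event measurable and open to union
    bounds. The 6 becomes the operator norm 12 through [bilinear_net_bound]. *)
Let good : set T := [set w |
  ((forall i, ysf i w = 1 \/ ysf i w = -1) /\
   (forall i, yh w i = 1 \/ yh w i = -1)) /\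
  ((forall f g', f \in @grid_net R 4 n -> g' \in @grid_net R 4 d ->
     dotp (grid_point 4 g') (grid_point 4 f *m Yf w) <= 6 :> R) /\
   (forall f, f \in @grid_net R K n ->
     4^-1 <= dotp (grid_point K f) (grid_point K f) :> R ->
     256^-1 < dotp (grid_point K f *m Yf w) (grid_point K f *m Yf w) :> R)) /\
  (k%:R / 16 <= \sum_i \1_[set (-1 : R)] (yh w i) * \1_[set (1 : R)] (ysf i w) :> R /\
   k%:R / 16 <= \sum_i \1_[set (1 : R)] (yh w i) * \1_[set (-1 : R)] (ysf i w) :> R)].

Let good_sigma_train : sigma_train gamma v y N B good.
Proof.
pose F := fun (s : ('I_n * 'I_d) + 'I_n) w =>
  match s with inl (i, l) => X w i l | inr i => yh w i end.
have mF s := @measurable_sigma_rv_type _ _ _ _ F s.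
have mX i l : measurable_fun [set: sigma_rv_type F] (fun w => X w i l).
  exact: (mF (inl (i, l))).
have my i : measurable_fun [set: sigma_rv_type F] (fun w => yh w i).
  exact: (mF (inr i)).
have mXv i : measurable_fun [set: sigma_rv_type F] (fun w => dotp (row i (X w)) v).
  rewrite /dotp; apply: measurable_sum => l; apply: measurable_funM => //.
  rewrite (_ : (fun w => row i (X w) 0 l) = (fun w => X w i l))//.
  by apply/funext => w; rewrite mxE.
have mys i : measurable_fun [set: sigma_rv_type F] (ysf i).
  exact: measurable_funM.
have mY i l : measurable_fun [set: sigma_rv_type F] (fun w => Yf w i l).
  rewrite (_ : (fun w => Yf w i l) =
    (fun w => rho^-1 * (X w i l - dotp (row i (X w)) v * v 0 l))).
    apply: measurable_funM => //; apply: measurable_funB => //.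
    exact: measurable_funM.
  by apply/funext => w; rewrite !mxE.
have mpY (p : 'rV[R]_n) l :
    measurable_fun [set: sigma_rv_type F] (fun w => (p *m Yf w) 0 l).
  rewrite (_ : (fun w => _) = (fun w => \sum_i p 0 i * Yf w i l)).
    by apply: measurable_sum => i; exact: measurable_funM.
  by apply/funext => w; rewrite mxE.
suff : measurable (good : set (sigma_rv_type F)) by [].
apply: measurableI; first apply: measurableI.
- by apply: measurable_forall_fin => i; exact: measurable_pm1.
- by apply: measurable_forall_fin => i; exact: measurable_pm1.
apply: measurableI; first apply: measurableI.
- apply: measurable_forall_fin => f; apply: measurable_forall_fin => g'.
  apply: measurable_imply; apply: measurable_imply.
  apply: measurable_set_le; apply: measurable_sum => l.
  exact: measurable_funM.
- apply: measurable_forall_fin => f; apply: measurable_imply; apply: measurable_imply.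
  rewrite (_ : [set w | _] = ~` [set w | dotp (grid_point K f *m Yf w)
     (grid_point K f *m Yf w) <= 256^-1]).
    apply: measurableC; apply: measurable_set_le; apply: measurable_sum => l.
    exact: measurable_funM.
  by apply/seteqP; split => w /=; [rewrite ltNge => /negP|move/negP; rewrite -ltNge].
have m1 (c : R) : measurable_fun setT (\1_[set c] : R -> R) by exact: measurable_indic.
apply: measurableI; apply: measurable_set_ge; apply: measurable_sum => i;
  apply: measurable_funM; (apply: measurableT_comp; first exact: m1) => //.
Qed.

Let good_spec w : (0 < n)%N -> (0 < d)%N -> good w ->
  good_training_data gamma v k (X w) (yh w).
Proof.
move=> n0 d0 [[ys1 yh1] [[net6 netK] [cp cn]]].
exists (ysf ^~ w), (Yf w).
have rowY i : row i (Yf w) = rho^-1 *: (row i (X w) - dotp (row i (X w)) v *: v).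
  by rewrite rowK.
have op u : enorm (u *m Yf w) <= 12 * enorm u.
  apply: enorm_mulmx_le => // a b a1 b1.
  have := bilinear_net_bound n0 d0 net6 a1 b1; lra.
split; last by rewrite !card_indic.
split=> [i|].
  rewrite rowY scalerA mulfV ?gt_eqF// scale1r /ysf mulrA mulfV ?gt_eqF// mul1r.
  by rewrite addrC subrK.
split=> [i|].
  by rewrite rowY dotpZl dotpBl dotpZl v1 mulr1 subrr mulr0.
split=> //; apply: (enorm_mulmx_ge (K := K)) => //.
by rewrite natrM.
Qed.

(** Along [v] the noise has variance [d^-1 (1 - 1) = 0], and the two label values already have total
    probability 1. *)
Let typical : {ae P, forall w, forall i,
  dotp (N i w) v = 0 /\ (y i w = 1 \/ y i w = -1)}.
Proof.
apply: filter_forall => i; apply: filterI.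
  have [r [c [h [cE _ _ _ hN]]]] := normal_vec_dotp (NN i) v.
  have c0 : c = 0.
    by apply: dotp_eq0; rewrite cE noise_cov_quad v1 expr1n subrr mulr0.
  apply: filterS hN => w; rewrite dotpC => ->.
  by rewrite big1// => l _; rewrite c0 mxE mul0r.
have [my y1 yN1] := yU i.
have m1 (e : R) : measurable (y i @^-1` [set e]).
  by rewrite -[X in measurable X]setTI; exact: my.
exists (~` (y i @^-1` [set 1] `|` y i @^-1` [set -1])); split.
- by apply: measurableC; exact: measurableU.
- have disj : y i @^-1` [set 1] `&` y i @^-1` [set -1] = set0.
    apply/seteqP; split => w //= [h1 h2].
    have : (1 : R) = -1 by exact: etrans (esym h1) h2.
    by lra.
  have PU : P (y i @^-1` [set 1] `|` y i @^-1` [set -1]) = 1%E.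
    apply: etrans (measureU P (m1 _) (m1 _) disj) _.
    by rewrite [X in (X + _)%E]y1 [X in (_ + X)%E]yN1 -EFinD -[2^-1]mul1r -splitr.
  apply: etrans (probability_setC P _) _; first exact: measurableU.
  by rewrite [X in (_ - X)%E]PU subee.
- by move=> w /= h [h1|h1]; apply: h; [left|right].
Qed.

Hypothesis iN : mutually_independent P (fun i => sigma_rv (coords (N i))).
Hypothesis iy : mutually_independent P (fun i => sigma_rv (fun _ : unit => y i)).
Hypothesis mB : sigma_discrete B `<=` measurable.
Hypothesis cB : forall w, #|B w| = k.
Hypothesis iB : mutually_independent P
    (fun b : bool => if b then sigma_discrete B else sigma_rv y).

Let my i : measurable_fun setT (y i). Proof. by case: (yU i). Qed.

(** Four bad events have probability at most [exp (- k / 4)] each. For the operator norm the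
    exponent is [6 n + 6 d - 18 d]. For the small ball it is [(K + 2) n - d / 48], and
    [d >= 48 (K + 3) n] leaves a spare [n >= k]. Finally [4 <= expR 2] and the bound on [k] bring
    the total below [delta]. *)
Lemma training_data_good (delta : R) : (0 < n)%N -> (1 < d)%N -> 0 < delta < 1 ->
  (k <= n)%N -> 48 * (12 * 32 + 3) * n%:R <= d%:R :> R ->
  8 * (ln (1 / delta) + 1) <= k%:R ->
  exists2 E, sigma_train gamma v y N B E &
    ((1 - delta)%:E <= P E)%E /\
    forall w, E w -> good_training_data gamma v k (X w) (yh w).
Proof.
move=> n0 d1 /andP[delta0 delta1] kn nd kd; exists good; first exact: good_sigma_train.
split; last by move=> w; apply: good_spec => //; exact: ltnW.
have d0 : (0 < d)%N by exact: ltnW.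
have mN i l : measurable_fun setT (fun w => N i w 0 l) by exact: (NN i).1.
have mgood : measurable good.
  apply: sigma_rv_measurable good_sigma_train => -[[i l]|i].
    rewrite /train_X; under eq_fun do rewrite !mxE.
    apply: measurable_funD; apply: measurable_funM => //.
    exact: measurable_funM.
  rewrite /observed.
  pose Q := [set w | i \in B w].
  have mQ : measurable Q by apply: mB; exists [set b : {set 'I_n} | i \in b].
  rewrite (_ : (fun w => _) = (fun w => y i w * (1 - 2 * \1_Q w))).
    apply: measurable_funM => //; apply: measurable_funB => //.
    by apply: measurable_funM => //; exact: measurable_indic.
  apply/funext => w; rewrite indicE; case: (boolP (i \in B w)) => iB'.
    by rewrite mem_set//=; ring.
  by rewrite memNset /=; [ring|exact/negP].
have yE1 i : P (y i @^-1` [set 1]) = (2^-1)%:E by case: (yU i).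
have yEN1 i : P (y i @^-1` [set -1]) = (2^-1)%:E by case: (yU i).
have iyR : independent_rvs P y.
  apply: (mutually_independent_rvs iy) => i A mA.
  by apply: sigma_rv_preimage => //; exact: (@measurable_sigma_rv_type _ _ _ _ _ tt).
pose S2 := [set fg | (fg.1 \in @grid_net R 4 n) && (fg.2 \in @grid_net R 4 d)]%SET.
pose A2 (fg : {ffun 'I_n -> 'I_(n * 4).+1 * bool} *
              {ffun 'I_d -> 'I_(d * 4).+1 * bool}) :=
  [set w | 6 <= dotp (grid_point 4 fg.2) (noise_comb N (grid_point 4 fg.1) w) :> R].
pose S3 := [set f in @grid_net R K n | 4^-1 <= dotp (grid_point K f) (grid_point K f) :> R]%SET.
pose A3 (f : {ffun 'I_n -> 'I_(n * K).+1 * bool}) := [set w | dotp (noise_comb N (grid_point K f) w)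
                           (noise_comb N (grid_point K f) w) <= 256^-1 :> R].
pose A4 e := [set w | label_count (B w) y e w <= k%:R / 16 :> R].
have mA2 fg : measurable (A2 fg).
  by apply: measurable_set_ge; exact: (measurable_noise_comb_dotp NN).
have mA3 f : measurable (A3 f).
  by apply: measurable_set_le; exact: (measurable_noise_comb_sqr NN).
have mA4 e : measurable (A4 e).
  rewrite (_ : A4 e = \bigcup_(b in [set: {set 'I_n}])
      (B @^-1` [set b] `&` [set w | label_count b y e w <= k%:R / 16])).
    apply: fin_bigcup_measurable => // b _; apply: measurableI.
      by apply: mB; exists [set b].
    by apply: measurable_set_le; exact: measurable_label_count.
  apply/seteqP; split => w /=; first by move=> h; exists (B w).
  by case=> b _ [/= <-].
pose bad2 := \bigcup_(fg in [set` S2]) A2 fg.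
pose bad3 := \bigcup_(f in [set` S3]) A3 f.
have mbad2 : measurable bad2 by exact: fin_bigcup_measurable.
have mbad3 : measurable bad3 by exact: fin_bigcup_measurable.
pose u := expR (- (k%:R / 4)) : R.
have npos : 0 < n%:R :> R by rewrite ltr0n.
have knR : k%:R <= n%:R :> R by rewrite ler_nat.
have P2 : (P bad2 <= u%:E)%E.
  apply: le_trans (union_bound P (S := S2) mbad2 mA2 _) _.
    by move=> w [fg /= fgS fgA]; exists fg.
  apply: le_trans (_ : (\sum_(fg in S2) (expR (- (d%:R * 6 ^+ 2 / 2)))%:E <= _)%E).
    apply: lee_sum => -[f h]; rewrite !inE/= => /andP[f1 h1].
    exact: (noise_bilinear_tail v1 NN iN).
  rewrite sumEFin lee_fin sumr_const -[leLHS]mulr_natl.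
  rewrite (_ : #|S2| = #|@grid_net R 4 n| * #|@grid_net R 4 d|)%N; last first.
    by rewrite -cardsX; apply: eq_card => -[f h]; rewrite !inE.
  rewrite natrM.
  apply: le_trans (_ : expR ((4 + 2) * n%:R) * expR ((4 + 2) * d%:R) *
     expR (- (d%:R * 6 ^+ 2 / 2)) <= _).
    by rewrite ler_wpM2r ?expR_ge0// ler_pM ?ler0n// card_grid_net.
  rewrite -!expRD ler_expR; lra.
have P3 : (P bad3 <= u%:E)%E.
  apply: le_trans (union_bound P (S := S3) mbad3 mA3 _) _.
    by move=> w [f /= fS fA]; exists f.
  apply: le_trans (_ : (\sum_(f in S3) (expR (- (d%:R / 48)))%:E <= _)%E).
    apply: lee_sum => f; rewrite inE => /andP[_ f4].
    exact: (noise_small_ball v1 NN iN).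
  rewrite sumEFin lee_fin sumr_const -[leLHS]mulr_natl.
  apply: le_trans (_ : expR ((K%:R + 2) * n%:R) * expR (- (d%:R / 48)) <= _).
    rewrite ler_wpM2r ?expR_ge0//.
    apply: le_trans (card_grid_net n0 (_ : 0 < K)%N) => //.
    by rewrite ler_nat; apply: subset_leq_card; apply/fintype.subsetP => f; rewrite inE => /andP[].
  rewrite -expRD ler_expR natrM; lra.
have P4 : (P (A4 (1 : R)%R) <= u%:E)%E by exact: flipped_count_tail.
have P5 : (P (A4 (-1 : R)%R) <= u%:E)%E by exact: flipped_count_tail.
(* The bad events speak of [y] and [N], [good] of their reconstructions from [X]; the two match on
   the typical outcomes. *)
have covered : {ae P, forall w, (~` good) w -> (bad2 `|` bad3 `|` (A4 1 `|` A4 (-1))) w}.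
  apply: filterS typical => w tw ngood; apply: contrapT => nbad; apply: ngood.
  have Xi i : row i (X w) = (g * y i w) *: v + rho *: N i w by rewrite rowK.
  have Xv i : dotp (row i (X w)) v = g * y i w.
    by rewrite Xi dotpDl !dotpZl v1 (tw i).1; ring.
  have ysE i : ysf i w = y i w by rewrite /ysf Xv mulrA mulVf ?gt_eqF// mul1r.
  have YE i : row i (Yf w) = N i w.
    rewrite rowK Xv Xi addrAC subrr add0r scalerA mulVf ?gt_eqF//.
    by rewrite scale1r.
  have cY (c : 'rV[R]_n) : c *m Yf w = noise_comb N c w.
    by rewrite mulmx_sum_row; apply: eq_bigr => i _; rewrite YE.
  have count e : (e = 1 \/ e = -1) -> label_count (B w) y e w <=
      \sum_i \1_[set (- e : R)] (yh w i) * \1_[set (e : R)] (ysf i w) :> R.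
    move=> e1; rewrite /label_count big_mkcond/=; apply: ler_sum => i _.
    rewrite ysE /yh /observed; case: ifP => iB'.
      rewrite !indicE; have [->|ye] := eqVneq (y i w) e.
        by rewrite !mem_set//= mulr1.
      by rewrite [y i w \in _]memNset ?mulr0//=; apply/eqP.
    by rewrite mulr_ge0// indicE ler0n.
  split; first split => i; rewrite ?ysE.
  - exact: (tw i).2.
  - rewrite /yh /observed; case: ifP => _; last exact: (tw i).2.
    by case: (tw i).2 => ->; [right|left; rewrite opprK].
  split; first split.
  - move=> f h fn hn; rewrite cY leNgt; apply/negP => h6; apply: nbad; left; left.
    by exists (f, h) => /=; [rewrite inE fn hn|exact: ltW].
  - move=> f fn f4; rewrite cY ltNge; apply/negP => h6; apply: nbad; left; right.
    by exists f => //=; rewrite inE fn f4.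
  split; rewrite leNgt; apply/negP => hlt; apply: nbad; right.
  - by left; apply/ltW; apply: le_lt_trans hlt; exact: count (or_introl _).
  - right; apply/ltW; apply: le_lt_trans hlt.
    by have := count (-1) (or_intror erefl); rewrite opprK.
have Pbad : (P (~` good) <= (4 * u)%:E)%E.
  apply: le_trans (ae_le_probability _ _ covered) _; first exact: measurableC.
    by do !apply: measurableU.
  apply: le_trans (measureU2 _ _ _) _; do ?apply: measurableU => //.
  rewrite (_ : 4 * u = (u + u) + (u + u)); last by ring.
  by rewrite !EFinD; apply: leeD; (apply: le_trans (measureU2 _ _ _) _ => //; exact: leeD).
have udelta : 4 * u <= delta.
  have e2 : 4 <= expR 2 :> R.
    have := expR_ge1Dx (1 : R); rewrite (_ : 2 = 1 + 1 :> R)// expRD; nra.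
  have -> : delta = expR (- ln (1 / delta)).
    by rewrite div1r lnV ?posrE// opprK lnK.
  apply: le_trans (_ : expR 2 * u <= _); first by rewrite ler_wpM2r// expR_ge0.
  rewrite /u -expRD ler_expR.
  have : 0 <= ln (1 / delta) by rewrite ln_ge0// div1r invf_ge1// ltW.
  lra.
have : (P (~` good) <= delta%:E)%E by apply: le_trans Pbad _; rewrite lee_fin.
rewrite (probability_setC P mgood).
have := fin_num_measure P good mgood; case: (P good) => [r _| _ _|]; rewrite ?leey//.
by rewrite -EFinD !lee_fin; lra.
Qed.

End GoodEvent.

(** * Gradient descent on typical data and the final bound *)

Section Output.
Context {R : realType} {n d m : nat}.
Variables (k : nat) (alpha gamma eta : R) (v : 'rV[R]_d) (X : 'M[R]_(n, d)).
Variable yhat : 'I_n -> R.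
Hypothesis alpha01 : 0 < alpha <= 1.
Hypothesis gamma01 : 0 < gamma < 1.
Hypothesis v1 : dotp v v = 1.
Let g : R := Num.sqrt gamma.
Let rho : R := Num.sqrt (1 - gamma).
Let g2 : g ^+ 2 = gamma.
Proof. by rewrite sqr_sqrtr// ltW//; case/andP: gamma01. Qed.
Let rho2 : rho ^+ 2 = 1 - gamma.
Proof. by rewrite sqr_sqrtr// subr_ge0 ltW//; case/andP: gamma01. Qed.
Let rho0 : 0 < rho.
Proof. by rewrite sqrtr_gt0 subr_gt0; case/andP: gamma01. Qed.

Section Rows.
Variables (ys : 'I_n -> R) (Y : 'M[R]_(n, d)).
Hypothesis XE : forall i, row i X = (g * ys i) *: v + rho *: row i Y.
Hypothesis Yv : forall i, dotp (row i Y) v = 0.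
Hypothesis Ylow : forall u, enorm u <= 32 * enorm (u *m Y).
Hypothesis ysgn : forall i, ys i = 1 \/ ys i = -1.

(** Each [|x_i|^2] is the convex combination of 1 and [|Y_i|^2] with weight [gamma], and [Y_i] is
    the image of a unit vector. This turns the condition on [lambda] into
    [2 m lambda <= 64 sqrt alpha]. *)
Lemma min_norm_ge : (0 < n)%N -> 32^-1 <= min_norm X.
Proof.
move=> n0; have row_ge i : 32^-1 <= enorm (row i X).
  have := Ylow (delta_mx 0 i); rewrite -rowE => Yi.
  have e1 : enorm (delta_mx 0 i : 'rV[R]_n) = 1.
    by rewrite /enorm dotp_delta mxE !eqxx sqrtr1.
  rewrite e1 in Yi.
  have Yi2 : (32^-1) ^+ 2 <= dotp (row i Y) (row i Y).
    by rewrite -sqr_enorm ler_pXn2r ?nnegrE ?enorm_ge0//; lra.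
  rewrite -(ler_pXn2r (ltn0Sn 1)) ?nnegrE ?enorm_ge0// sqr_enorm.
  have -> : dotp (row i X) (row i X) = gamma + (1 - gamma) * dotp (row i Y) (row i Y).
    rewrite XE dotpDl !dotpDr !dotpZl !dotpZr v1 Yv (dotpC v) Yv -rho2 -g2.
    by case: (ysgn i) => ->; ring.
  case/andP: gamma01 => g0 g1; nra.
have max_ge : 32^-1 <= max_norm X.
  rewrite /max_norm (bigD1 (Ordinal n0))//= le_max row_ge//.
by rewrite /min_norm; elim/big_ind: _ => // a b a1 b1; rewrite le_min a1.
Qed.

(** [Y] has a right inverse, so the noise alone can fit any labels, flipped ones included;
    projecting off [v] removes the influence of the true labels. This is the comparison vector of
    the perceptron argument. *)
Lemma interpolating_vector : (forall i, yhat i = 1 \/ yhat i = -1) ->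
  exists ws, forall i, yhat i * dotp (row i X) ws = 1.
Proof.
move=> yhat_sgn.
have : row_free Y.
  apply: inj_row_free => u uY; apply: enorm_eq0; apply/eqP.
  by rewrite eq_le enorm_ge0 andbT; have := Ylow u; rewrite uY enorm0 mulr0.
case/row_freeP => B YB; pose c : 'cV[R]_n := \col_i yhat i.
pose z := rho^-1 *: (B *m c)^T; exists (orth v z) => i.
have vo : dotp v (orth v z) = 0 by rewrite /orth dotpBr dotpZr v1 (dotpC v); ring.
have Yz : dotp (row i Y) z = rho^-1 * yhat i.
  rewrite dotpZr dotp_mxE trmxK mulmxA -row_mul YB; congr (_ * _).
  by rewrite -row_mul mul1mx !mxE.
rewrite XE dotpDl !dotpZl vo /orth dotpBr dotpZr Yv Yz.
rewrite !mulr0 add0r subr0 mulVKf ?gt_eqF//.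
by case: (yhat_sgn i) => ->; ring.
Qed.

End Rows.

Lemma gd_output (lambda : R) (W0 : 'M[R]_(2 * m, d)) :
  (0 < n)%N -> (0 < m)%N -> 0 < eta ->
  (48 * (64 + 12 * 32 * 64)) ^+ 2 <= k%:R :> R ->
  good_training_data gamma v k X yhat ->
  lambda <= Num.sqrt alpha / (m%:R * min_norm X) ->
  (forall j, enorm (row j W0) <= lambda) ->
  let w := signed_sum (A_GD alpha eta X yhat W0) in
  cvgn (gd alpha eta X yhat W0) /\
  g * dotp w v <=
    96 * 12 * 32 * rho * (enorm (orth v w) / Num.sqrt (alpha * k%:R)).
Proof.
move=> n0 m0 eta0 kbig [ys [Y [[XE [Yv [Yop Ylow]]] [ysgn [yhat_sgn [kp kn]]]]]] lamle W0lam /=.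
have [ws wsP] := interpolating_vector XE Yv Ylow yhat_sgn.
have [t [tm [cv ->]]] := gd_cvg alpha01 eta0 m0 yhat_sgn wsP W0.
split=> //.
have [L [l [L0 [lL WE]]]] := gd_dual X yhat alpha01 eta0 W0 t.
apply: (linear_margin_bound alpha01 gamma01 v1 XE Yv Yop Ylow yhat_sgn W0lam L0 lL WE) => //.
  by move=> i; rewrite leNgt; exact: tm.
have mpos : 0 < m%:R :> R by rewrite ltr0n.
have mn := min_norm_ge XE Yv Ylow ysgn n0.
have mn0 : 0 < min_norm X by apply: lt_le_trans mn; rewrite invr_gt0.
have sq : 0 < Num.sqrt alpha by rewrite sqrtr_gt0; case/andP: alpha01.
have h : m%:R * lambda * min_norm X <= Num.sqrt alpha.
  by move: lamle; rewrite ler_pdivlMr ?mulr_gt0//; lra.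
rewrite natrM -mulrA.
have [l0|l0] := leP lambda 0; nra.
Qed.

End Output.

Section TestError.
Context {R : realType} {disp : measure_display} {T : measurableType disp}.
Variable P : probability T R.

(** The noise [<w, Nt>] has standard deviation [|P w| / sqrt d], so the signal amounts to at most
    [c sqrt (d / a)] deviations of the scaled noise; [a <= d] keeps this number above the 2 that the
    tail bound requires. *)
Lemma linear_error_ge (d : nat) (gamma a : R) (v w : 'rV[R]_d)
    (Nt : T -> 'rV[R]_d) (c : R) :
  (0 < d)%N -> 0 < gamma < 1 -> 0 < a <= d%:R -> 2 <= c -> dotp v v = 1 ->
  normal_vec P (noise_cov v) Nt ->
  Num.sqrt gamma * dotp w v <=
    c * Num.sqrt (1 - gamma) * (enorm (orth v w) / Num.sqrt a) ->
  ((expR (- (4 * (c ^+ 2 * (d%:R / a)))) / 2)%:E <=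
   P [set u | (Num.sqrt gamma * dotp w v +
               Num.sqrt (1 - gamma) * dotp w (Nt u) <= 0)%R])%E.
Proof.
move=> d0 /andP[gamma0 gamma1] /andP[a0 ad] c2 v1 NtN wv.
have dpos : 0 < d%:R :> R by rewrite ltr0n.
have rho0 : 0 < Num.sqrt (1 - gamma) by rewrite sqrtr_gt0 subr_gt0.
have sd0 : 0 < Num.sqrt d%:R :> R by rewrite sqrtr_gt0.
have sa0 : 0 < Num.sqrt a by rewrite sqrtr_gt0.
pose t := c * (Num.sqrt d%:R / Num.sqrt a).
have t2 : t ^+ 2 = c ^+ 2 * (d%:R / a).
  by rewrite /t !exprMn exprVn !sqr_sqrtr// ltW.
have t_ge : 2 <= t.
  have : 1 <= Num.sqrt d%:R / Num.sqrt a.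
    by rewrite ler_pdivlMr// mul1r ler_sqrt// ltW.
  rewrite /t; nra.
have quad : dotp (w *m noise_cov v) w = (enorm (orth v w) / Num.sqrt d%:R) ^+ 2.
  rewrite noise_cov_quad exprMn exprVn sqr_enorm sqr_sqrtr ?ltW//.
  by rewrite /orth dotpBl !dotpBr !dotpZl !dotpZr v1 (dotpC v); field; rewrite gt_eqF.
have q0 : 0 <= enorm (orth v w) / Num.sqrt d%:R.
  by rewrite divr_ge0 ?enorm_ge0// ltW.
have := normal_vec_lower_tail NtN w t_ge; rewrite t2 quad sqrtr_sqr ger0_norm//.
move/le_trans; apply; apply: le_measure; rewrite ?inE.
- apply: measurable_set_le; exact: (measurable_normal_vec_dotp NtN).
- apply: measurable_set_le; apply: measurable_funD => //.
  by apply: measurable_funM => //; exact: (measurable_normal_vec_dotp NtN).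
move=> u /= hu.
have : t * (enorm (orth v w) / Num.sqrt d%:R) = c * (enorm (orth v w) / Num.sqrt a).
  by rewrite /t; field; rewrite !gt_eqF.
move=> tE; rewrite tE in hu; nra.
Qed.

End TestError.

Theorem theorem3p3 (R : realType) :
  exists C C1 C2 C3 : R,
    [/\ 0 < C, 0 < C1, 0 < C2 & 0 < C3] /\
    forall (d n k m : nat) (gamma delta alpha : R) (v : 'rV[R]_d)
      (disp : measure_display) (T : measurableType disp) (P : probability T R)
      (y : 'I_n -> T -> R) (N : 'I_n -> T -> 'rV[R]_d) (B : T -> {set 'I_n})
      (yt : T -> R) (Nt : T -> 'rV[R]_d),
      (0 < d)%N -> (0 < n)%N -> (0 < k)%N -> (0 < m)%N -> (k <= n)%N ->
      0 < gamma < 1 -> 0 < delta < 1 -> 0 < alpha <= 1 -> enorm v = 1 ->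
      data_model P k gamma v y N B yt Nt ->
      C1 * k%:R <= n%:R -> C2 * n%:R <= d%:R ->
      C3 * (ln (1 / delta) + 1 / alpha) <= k%:R ->
      exists E : set T,
        [/\ sigma_train gamma v y N B E,
            ((1 - delta)%:E <= P E)%E &
            forall w, E w ->
              let X := train_X gamma v y N w in
              let yhat := observed y B w in
              forall (eta lambda : R) (W0 : 'M[R]_(2 * m, d)),
                0 < eta -> 0 < lambda ->
                eta <= 1 / (m%:R * n%:R * max_norm X ^+ 2) ->
                lambda <= Num.sqrt alpha / (m%:R * min_norm X) ->
                (forall j, enorm (row j W0) <= lambda) ->
                cvgn (gd alpha eta X yhat W0) /\
                ((expR (- (C * (d%:R / (alpha * k%:R)))))%:E <=
                   test_error P gamma alpha v yt Nt
                     (A_GD alpha eta X yhat W0))%E].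
Proof.
pose c : R := 96 * 12 * 32; pose b : R := 48 * (64 + 12 * 32 * 64).
have c1 : 2 <= c by rewrite /c; lra.
have b8 : 48 <= b by rewrite /b; lra.
(* [c] and [b] are the constants of [linear_margin_bound], and [48 * (12 * 32 + 3)] that of
   [training_data_good]. With [r = d / (alpha k)] the test error is at least [exp (- 4 c^2 r) / 4],
   one factor 2 lost in the tail and one in the symmetrization. *)
exists (5 * c ^+ 2), 1, (48 * (12 * 32 + 3)), (b ^+ 2).
split; first by split; nra.
move=> d n k m gamma delta alpha v disp T P y N B yt Nt d0 n0 k0 m0 kn gamma01
  delta01 alpha01 v_unit DM _ nd kbig.
have v1 : dotp v v = 1 by rewrite -sqr_enorm v_unit expr1n.
have [a0 a1] := andP alpha01; have [de0 de1] := andP delta01.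
have npos : 1 <= n%:R :> R by rewrite ler1n.
have kpos : 1 <= k%:R :> R by rewrite ler1n.
have dn : n%:R <= d%:R :> R by lra.
have d1 : (1 < d)%N by rewrite -(ltr_nat R); lra.
have lnd : 0 <= ln (1 / delta) by rewrite ln_ge0// div1r invf_ge1// ltW.
have al : 1 <= 1 / alpha by rewrite div1r invf_ge1.
have kb : b ^+ 2 <= k%:R by apply: le_trans kbig; rewrite ler_peMr ?sqr_ge0//; lra.
have kd : 8 * (ln (1 / delta) + 1) <= k%:R.
  apply: le_trans kbig; apply: ler_pM => //; [by lra|nra|lra].
have [yU NN indep mB cB iB ytU NtN tindep] := DM.
have iN := mutually_independent_inr indep.
have iy := mutually_independent_inl indep.
have [E sE [PE EP]] :=
  training_data_good v1 gamma01 yU NN iN iy mB cB iB n0 d1 delta01 kn nd kd.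
exists E; split=> // w Ew X yhat eta lambda W0 eta0 _ _ lamle W0lam.
have [cv lin] := gd_output alpha01 gamma01 v1 n0 m0 eta0 kb (EP w Ew) lamle W0lam.
split=> //; set W := A_GD alpha eta X yhat W0.
have GT : sigma_train gamma v y N B setT by exact: (@measurableT _ (sigma_rv_type _)).
have ak0 : 0 < alpha * k%:R by rewrite mulr_gt0//; lra.
have knR : k%:R <= n%:R :> R by rewrite ler_nat.
have akd : alpha * k%:R <= d%:R by nra.
have akP : 0 < alpha * k%:R <= d%:R by rewrite ak0.
have := linear_error_ge d0 gamma01 akP c1 v1 NtN lin.
move=> /le_trans/(_ (linear_error_le_test_error _ _ alpha01 ytU NtN GT tindep _)).
rewrite -/W; set r : R := d%:R / (alpha * k%:R).
have r1 : 1 <= r by rewrite ler_pdivlMr// mul1r.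
have c4 : 4 <= c ^+ 2 by nra.
move: (c ^+ 2) c4 => s s4.
have e2 : 2 <= expR (s * r / 2).
  have sr : 4 <= s * r by rewrite -[4]mulr1 ler_pM.
  have := expR_ge1Dx (s * r / 2); lra.
(* The fifth multiple of [c^2] in the exponent pays for the factor 4, because [s * r >= 4]. *)
have e4 : expR (- (5 * s * r)) <= expR (- (4 * (s * r))) / 4.
  have -> : - (4 * (s * r)) = - (5 * s * r) + (s * r / 2 + s * r / 2).
    by field.
  rewrite expRD -[leRHS]mulrA ler_peMr ?expR_ge0// expRD.
  have : 2 * 2 <= expR (s * r / 2) * expR (s * r / 2) by rewrite ler_pM.
  lra.
move=> H; rewrite -(@lee_pmul2l _ 2%:E)//; apply: le_trans H.
by rewrite -EFinM lee_fin; lra.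
Qed.
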